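(* Let $\mathcal{G}$ be a $3$-uniform hypergraph on $n$ vertices that does not contain the Fano plane $\mathrm{PG}_2(2)$ as a subgraph. Then for all sufficiently large $n$, $q(\mathcal{G})\le q(\mathcal{B}_n)$, with equality if and only if $\mathcal{G}=\mathcal{B}_n$.
   Context: The Fano plane $\mathrm{PG}_2(2)$ is the $3$-uniform hypergraph with vertex set $\{1,\dots,7\}$ and edges $\{123,345,561,174,275,376,246\}$. $\mathcal{B}_n$ is the balanced complete $2$-colorable $3$-uniform hypergraph on $n$ vertices: the vertex set is partitioned into parts of sizes $\lfloor n/2\rfloor$ and $\lceil n/2\rceil$, and the edges are all $3$-subsets meeting both parts. For a $3$-uniform hypergraph $\mathcal{H}$ on $n$ vertices, the adjacency tensor $\mathcal{A}(\mathcal{H})$ is the order-$3$, dimension-$n$ tensor with entry $a_{ijk}=1/2$ if $\{v_i,v_j,v_k\}\in E(\mathcal{H})$ and $0$ otherwise; $\mathcal{D}(\mathcal{H})$ is the diagonal tensor whose diagonal entries are the vertex degrees; $\mathcal{Q}(\mathcal{H})=\mathcal{D}(\mathcal{H})+\mathcal{A}(\mathcal{H})$. An eigenvalue of an order-$3$ tensor $\mathcal{T}$ is $\lambda\in\mathbb{C}$ with $\mathcal{T}\mathbf{x}=\lambda\mathbf{x}^{[2]}$ for some nonzero $\mathbf{x}$, where $(\mathcal{T}\mathbf{x})_i=\sum_{j,k}t_{ijk}x_jx_k$ and $\mathbf{x}^{[2]}=(x_1^2,\dots,x_n^2)$; $q(\mathcal{H})$ is the maximum modulus of the eigenvalues of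 $\mathcal{Q}(\mathcal{H})$ (the signless Laplacian spectral radius). Equality $\mathcal{G}=\mathcal{B}_n$ is up to isomorphism. *)

(* Defs.v *)
From mathcomp Require Import all_boot all_order all_algebra.
From mathcomp Require Import complex.
From mathcomp Require Import classical_sets reals.

Set Implicit Arguments.
Unset Strict Implicit.
Unset Printing Implicit Defensive.

Import Order.TTheory GRing.Theory Num.Theory.
Local Open Scope ring_scope.

(* A hypergraph on the vertex set V is given by its edge set. *)
Definition hypergraph (V : finType) := {set {set V}}.

Definition uniform (k : nat) (V : finType) (H : hypergraph V) : Prop :=
  forall e : {set V}, e \in H -> #|e| = k.

(* Subgraph containment is up to relabelling and not necessarily induced. *)
Definition contains_subgraph (U V : finType)
    (F : hypergraph U) (H : hypergraph V) : Prop :=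
  exists2 f : U -> V, injective f &
    forall e : {set U}, e \in F -> f @: e \in H.

Definition hypergraph_iso (U V : finType)
    (F : hypergraph U) (H : hypergraph V) : Prop :=
  exists2 f : U -> V, bijective f &
    forall e : {set U}, (f @: e \in H) = (e \in F).

(* The ordinal i : 'I_7 stands for the vertex i.+1 of {1, ..., 7}. *)
Definition fano_lines : seq (seq nat) :=
  [:: [:: 1; 2; 3]; [:: 3; 4; 5]; [:: 5; 6; 1]; [:: 1; 7; 4];
      [:: 2; 7; 5]; [:: 3; 7; 6]; [:: 2; 4; 6] ]%N.

Definition fano : hypergraph 'I_7 :=
  [set:: [seq [set i : 'I_7 | i.+1 \in s] | s <- fano_lines]]%SET.

(* The parts are {i | i < n./2} and its complement, where n./2 is the floor *)
(* of n / 2.                                                                *)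
Definition lower_half (n : nat) : {set 'I_n} := [set i : 'I_n | (i < n./2)%N]%SET.

Definition balanced_bicomplete (n : nat) : hypergraph 'I_n :=
  [set e : {set 'I_n} |
    [&& #|e| == 3, e :&: lower_half n != finset.set0
      & e :&: ~: lower_half n != finset.set0]]%SET.

Section Tensor.
Variables (C : fieldType) (n : nat).

Definition tensor3 := 'I_n -> 'I_n -> 'I_n -> C.

Definition tensor_apply (t : tensor3) (x : 'cV[C]_n) : 'cV[C]_n :=
  \col_i \sum_j \sum_k t i j k * x j 0 * x k 0.

Definition tensor_eigenvalue (t : tensor3) (lambda : C) : Prop :=
  exists2 x : 'cV[C]_n, x != 0 &
    tensor_apply t x = lambda *: (\col_i x i 0 ^+ 2).

Variable H : hypergraph 'I_n.

Definition degree (i : 'I_n) : nat := #|[set e in H | i \in e]%SET|.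

(* On a 3-uniform H, an entry with a repeated index is 0, since then the set *)
(* of its indices has fewer than three elements.                             *)
Definition adjacency_tensor : tensor3 := fun i j k =>
  if [set i; j; k]%SET \in H then 2^-1 else 0.

Definition degree_tensor : tensor3 := fun i j k =>
  if (i == j) && (j == k) then (degree i)%:R else 0.

Definition signless_laplacian : tensor3 := fun i j k =>
  degree_tensor i j k + adjacency_tensor i j k.

End Tensor.

(* The maximum modulus of the eigenvalues of Q(H), written as a supremum in  *)
(* R; for n > 0 the set of moduli is nonempty and has a greatest element.    *)
Definition signless_spectral_radius (R : realType) (n : nat)
    (H : hypergraph 'I_n) : R :=
  sup [set r : R | exists2 lambda : R[i],
         tensor_eigenvalue (@signless_laplacian R[i] n H) lambda &
         r = ComplexField.Normc.normc lambda]%classic.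

(* Main.v *)
(* The moduli y of an eigenvector for lambda satisfy
   2 |lambda| y_i^2 <= sum_(j, k) g_ijk (y_i^2 + y_j y_k), and by a weighted AM-GM inequality a
   positive vector x bounds every such 2 |lambda| by the largest of the ratios
   sum_(j, k) g_ijk (1 + x_j x_k / x_i^2). On a 2-coloured system a vector that is constant on each
   colour class gives sharp bounds, so the point is that a Fano-free system with a near-extremal
   eigenvalue is 2-colourable.

   The links of four vertices spanning all their triples form a multigraph in which, the Fano plane
   being absent, no K4 is rainbow; its weighted density is at most 3. Hence Fano-free systems have
   density at most 3/4, and if all degrees are close to 3/4 then every link is close to the
   complement of a clique on half of the vertices, which yields a 2-colouring.

   For a near-extremal y normalized by mean square 1, the weights (2 + y_i^2)/3 have triple density
   at most 3/4, and the AM-GM gap between (2 + a^2)(2 + b^2)(2 + c^2) and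
   9/2 (a^2 + b^2 + c^2 + ab + ac + bc) forces y to be nearly constant and nearly all degrees to be
   close to 3/4. The remaining vertices are 2-coloured by the above, and a vertex of low degree
   would contribute too little for y to be near-extremal. *)

Require Import Defs.
From mathcomp Require Import all_boot all_order all_algebra.
From mathcomp Require Import complex.
From mathcomp Require Import classical_sets reals.
From mathcomp Require Import ring lra zify.

Set Implicit Arguments.
Unset Strict Implicit.
Unset Printing Implicit Defensive.

Import Order.TTheory GRing.Theory Num.Theory.
Local Open Scope ring_scope.

(** * The gap in an AM-GM inequality *)

(** All density statements are made for arbitrary nonnegative vertex weights rather than for counts:
    vertices can then be removed fractionally and in a prescribed amount, which turns a stability
    claim into a comparison of polynomials before and after the removal.

    A large eigenvalue does not by itself bound the minimum degree, while the structure theorem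
    needs every degree to be large. Hence the eigenvector is first shown to be nearly constant: this
    makes the mass of low-degree vertices small enough to delete them and to charge each one for
    what it fails to contribute.

    For odd n the value 2 q(B_n) comes from a root of a quartic and is not computed. Everything is
    compared on the scale 3/2 n^2 - 3 n: the balanced system loses at most 3/2 there, and only for
    odd n, while a 2-coloured system whose class sizes differ by k loses at least k^2/4. For an
    unbalanced colouring integrality gives k >= 2 or, for odd n, k >= 3, a loss larger by at least
    1/2. Balanced colourings are settled separately, by perturbing a positive vector at a vertex of
    a missing triple. *)

Section AmgmGap.

Variable R : realFieldType.
Implicit Types a b c k p q : R.

(** Vanishes at a = b = c = 1. Writing ab as half of a^2 + b^2 - (a - b)^2 cancels the terms linear
    in 1 - a^2, 1 - b^2, 1 - c^2 and leaves their pairwise products, their triple product and 9/4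
    times the squared differences. The pairwise products are nonnegative when a, b, c lie on one
    side of 1; the mixed cases are the hard ones. *)
Definition amgm_gap a b c : R :=
  (2 + a ^+ 2) * (2 + b ^+ 2) * (2 + c ^+ 2)
  - 9 / 2 * (a ^+ 2 + b ^+ 2 + c ^+ 2 + a * b + a * c + b * c).

Lemma amgm_gapC12 a b c : amgm_gap a b c = amgm_gap b a c.
Proof. by rewrite /amgm_gap; ring. Qed.

Lemma amgm_gapC23 a b c : amgm_gap a b c = amgm_gap a c b.
Proof. by rewrite /amgm_gap; ring. Qed.

Lemma amgm_gap_small p q k : 0 <= p <= 1 -> 0 <= q <= 1 -> 0 <= k <= 1 ->
  1 / 40 * (p ^+ 2 + q ^+ 2 + k ^+ 2) <= amgm_gap (1 - p) (1 - q) (1 - k).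
Proof.
move=> /andP[p0 p1] /andP[q0 q1] /andP[k0 k1].
pose x := p * (2 - p); pose y := q * (2 - q); pose z := k * (2 - k).
have [xp x1] : p <= x /\ x <= 1 by rewrite /x; split; nra.
have [yq y1] : q <= y /\ y <= 1 by rewrite /y; split; nra.
have [zk z1] : k <= z /\ z <= 1 by rewrite /z; split; nra.
have -> : amgm_gap (1 - p) (1 - q) (1 - k) =
  3 * (x * y + x * z + y * z) - x * y * z
  + 9 / 4 * ((p - q) ^+ 2 + (p - k) ^+ 2 + (q - k) ^+ 2).
  by rewrite /amgm_gap /x /y /z; field.
have xy : p * q <= x * y by apply: ler_pM.
have xz : p * k <= x * z by apply: ler_pM.
have yz : q * k <= y * z by apply: ler_pM.
have xyz : x * y * z <= x * y by rewrite ler_piMr // mulr_ge0 //; lra.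
have pq := sqr_ge0 (p - q); have pk := sqr_ge0 (p - k).
have qk := sqr_ge0 (q - k); have pq0 := mulr_ge0 p0 q0.
have pk0 := mulr_ge0 p0 k0; have qk0 := mulr_ge0 q0 k0.
nra.
Qed.

Lemma amgm_gap_large p q k : 0 <= p -> 0 <= q -> 0 <= k ->
  1 / 40 * (p ^+ 2 + q ^+ 2 + k ^+ 2) <= amgm_gap (1 + p) (1 + q) (1 + k).
Proof.
move=> p0 q0 k0.
pose x := p * (2 + p); pose y := q * (2 + q); pose z := k * (2 + k).
have xp : 2 * p <= x by rewrite /x; nra.
have yq : 2 * q <= y by rewrite /y; nra.
have zk : 2 * k <= z by rewrite /z; nra.
have -> : amgm_gap (1 + p) (1 + q) (1 + k) =
  3 * (x * y + x * z + y * z) + x * y * z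
  + 9 / 4 * ((p - q) ^+ 2 + (p - k) ^+ 2 + (q - k) ^+ 2).
  by rewrite /amgm_gap /x /y /z; field.
have xy : (2 * p) * (2 * q) <= x * y by apply: ler_pM => //; lra.
have xz : (2 * p) * (2 * k) <= x * z by apply: ler_pM => //; lra.
have yz : (2 * q) * (2 * k) <= y * z by apply: ler_pM => //; lra.
have xyz : 0 <= x * y * z by rewrite !mulr_ge0 //; lra.
have pq := sqr_ge0 (p - q); have pk := sqr_ge0 (p - k).
have qk := sqr_ge0 (q - k); have pq0 := mulr_ge0 p0 q0.
have pk0 := mulr_ge0 p0 k0; have qk0 := mulr_ge0 q0 k0.
nra.
Qed.

(* With s = p + q and t = p q the gap is a quadratic polynomial in t; its t^2 term is dropped and
   the linear rest is compared at t = 0 and t = s^2 / 4. *)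
Lemma amgm_gap_large_small p q k :
  0 <= p <= 3 / 7 -> 0 <= q <= 3 / 7 -> 0 <= k <= 1 ->
  1 / 40 * (p ^+ 2 + q ^+ 2 + k ^+ 2) <= amgm_gap (1 + p) (1 + q) (1 - k).
Proof.
move=> /andP[p0 p1] /andP[q0 q1] /andP[k0 k1].
pose s := p + q; pose t := p * q.
pose l := - (3 / 2) + 6 * s + 4 * k - 2 * k ^+ 2 - 4 * k * s + 2 * k ^+ 2 * s.
have -> : amgm_gap (1 + p) (1 + q) (1 - k) =
  9 / 2 * s ^+ 2 + 9 / 2 * k ^+ 2 - 15 / 2 * k * s + 6 * k * s * (k - s)
  + 3 * k ^+ 2 * s ^+ 2 + t * l + t ^+ 2 * (3 - 2 * k + k ^+ 2).
  by rewrite /amgm_gap /l /s /t; field.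
have t0 : 0 <= t by rewrite mulr_ge0.
have ts : t <= s ^+ 2 / 4 by rewrite /s /t; have := sqr_ge0 (p - q); nra.
have nrm : p ^+ 2 + q ^+ 2 <= s ^+ 2 by rewrite /s; nra.
have s0 : 0 <= s by rewrite /s; lra.
have s1 : s <= 6 / 7 by rewrite /s; lra.
have tt : 0 <= t ^+ 2 * (3 - 2 * k + k ^+ 2).
  by rewrite mulr_ge0 ?sqr_ge0 //; nra.
have ks := mulr_ge0 k0 s0.
have sq0 := sqr_ge0 (k * s).
have [l0|l0] := lerP 0 l.
  have tl : 0 <= t * l by rewrite mulr_ge0.
  have sq1 := sqr_ge0 (s - k - 2 / 3 * (k * s)).
  have sq2 := sqr_ge0 (s - k - 4 / 3 * (k * s)).
  nra.
have tl : s ^+ 2 / 4 * l <= t * l by rewrite ler_wnM2r // ltW.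
have c1 : 0 <= s * (3 / 2 * s ^+ 2 - 41 / 7 * (k * s) + 6 * k ^+ 2).
  by rewrite mulr_ge0 //; have := sqr_ge0 (s - 82 / 42 * k); nra.
have c2 : 0 <= (k * s ^+ 2) * (6 / 7 - s).
  by rewrite mulr_ge0 ?subr_ge0 ?mulr_ge0 ?sqr_ge0.
have c3 : 0 <= k ^+ 2 * s ^+ 3 by rewrite mulr_ge0 ?sqr_ge0 ?exprn_ge0.
have sq1 := sqr_ge0 (s - 15 / 16 * k).
have kk := sqr_ge0 k.
by move: (t * l) tl => z; rewrite /l; lra.
Qed.

(** The right side is the gap at (1 - p, 1 - p, 1 + k), where 2 p - p^2 = 1 - (1 - p)^2. For p up to
    1/5 it is handled as a quadratic in k, through its leading coefficient and its discriminant. *)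
Lemma amgm_gap_diag_small p k : 0 <= p <= 1 / 5 -> 0 <= k ->
  1 / 20 * (p ^+ 2 + k ^+ 2) <=
  (3 + 2 * k + k ^+ 2) * (2 * p - p ^+ 2) ^+ 2
  - 6 * (2 * k + k ^+ 2) * (2 * p - p ^+ 2) + 9 / 2 * (p + k) ^+ 2.
Proof.
move=> /andP[p0 p1] k0.
pose A := 9 / 2 - 12 * p + 10 * p ^+ 2 - 4 * p ^+ 3 + p ^+ 4 - 1 / 20.
pose b := - 15 + 20 * p - 8 * p ^+ 2 + 2 * p ^+ 3.
pose C := 33 / 2 - 12 * p + 3 * p ^+ 2 - 1 / 20.
rewrite -subr_ge0.
have -> : (3 + 2 * k + k ^+ 2) * (2 * p - p ^+ 2) ^+ 2
  - 6 * (2 * k + k ^+ 2) * (2 * p - p ^+ 2) + 9 / 2 * (p + k) ^+ 2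
  - 1 / 20 * (p ^+ 2 + k ^+ 2) = A * k ^+ 2 + b * (p * k) + C * p ^+ 2.
  by rewrite /A /b /C; field.
have p3 : 0 <= p ^+ 3 by rewrite exprn_ge0.
have p4 : 0 <= p ^+ 4 by rewrite exprn_ge0.
have A0 : 0 < A by rewrite /A; nra.
have q0 : 0 <= 1 / 5 - p by lra.
(* Certified by the Bernstein products of degree 6 in p, all nonnegative on [0, 1/5]. *)
have D0 : b ^+ 2 <= 4 * A * C.
  have h i j : 0 <= p ^+ i * (1 / 5 - p) ^+ j by rewrite mulr_ge0 ?exprn_ge0.
  have := h 0 6%N; have := h 1 5%N; have := h 2 4%N; have := h 3 3%N.
  have := h 4 2%N; have := h 5 1%N; have := h 6 0%N.
  rewrite /A /b /C; lra.
rewrite -(pmulr_rge0 _ (_ : 0 < 4 * A)) ?mulr_gt0 //.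
have -> : 4 * A * (A * k ^+ 2 + b * (p * k) + C * p ^+ 2) =
  (2 * A * k + b * p) ^+ 2 + p ^+ 2 * (4 * A * C - b ^+ 2) by ring.
apply: addr_ge0; first exact: sqr_ge0.
by apply: mulr_ge0; rewrite ?sqr_ge0 // subr_ge0.
Qed.

(** The leading coefficient in k becomes negative as p approaches 1, so the range of k has to enter;
    3/7 is 10/7 - 1. *)
Lemma amgm_gap_diag_large p k : 1 / 5 <= p <= 1 -> 0 <= k <= 3 / 7 ->
  1 / 20 * (p ^+ 2 + k ^+ 2) <=
  (3 + 2 * k + k ^+ 2) * (2 * p - p ^+ 2) ^+ 2
  - 6 * (2 * k + k ^+ 2) * (2 * p - p ^+ 2) + 9 / 2 * (p + k) ^+ 2.
Proof.
move=> /andP[p0 p1] /andP[k0 k1].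
pose b := - 15 + 20 * p - 8 * p ^+ 2 + 2 * p ^+ 3.
pose C := 33 / 2 - 12 * p + 3 * p ^+ 2 - 1 / 20.
pose B2 := 198 / 49 * (2 * p - p ^+ 2) ^+ 2 - 306 / 49 * (2 * p - p ^+ 2)
  + 9 / 2 * (p + 3 / 7) ^+ 2 - 1 / 20 * (p ^+ 2 + 9 / 49).
pose B1 := p * C + 3 / 14 * b.
have q0 : 0 <= p - 1 / 5 by lra.
have r0 : 0 <= 1 - p by lra.
have h i j : 0 <= (p - 1 / 5) ^+ i * (1 - p) ^+ j by rewrite mulr_ge0 ?exprn_ge0.
have C0 : 0 <= C by rewrite /C; nra.
have B20 : 0 <= B2.
  have := h 0 4%N; have := h 1 3%N; have := h 2 2%N; have := h 3 1%N.
  have := h 4 0%N; rewrite /B2; lra.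
have B10 : 0 <= B1.
  have := h 0 3%N; have := h 1 2%N; have := h 2 1%N; have := h 3 0%N.
  rewrite /B1 /b /C; lra.
rewrite -subr_ge0.
(* Bernstein expansion of a quadratic polynomial in k on [0, 3/7] *)
have -> : (3 + 2 * k + k ^+ 2) * (2 * p - p ^+ 2) ^+ 2
  - 6 * (2 * k + k ^+ 2) * (2 * p - p ^+ 2) + 9 / 2 * (p + k) ^+ 2
  - 1 / 20 * (p ^+ 2 + k ^+ 2) =
  p ^+ 2 * C * (1 - 7 / 3 * k) ^+ 2
  + 2 * (p * B1) * (7 / 3 * k) * (1 - 7 / 3 * k) + B2 * (7 / 3 * k) ^+ 2.
  by rewrite /B1 /B2 /b /C; field.
by rewrite !addr_ge0 // !mulr_ge0 ?sqr_ge0 //; lra.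
Qed.

Lemma amgm_gap_small_large p q k :
  0 <= p <= 1 -> 0 <= q <= 1 -> 0 <= k <= 3 / 7 ->
  1 / 40 * (p ^+ 2 + q ^+ 2 + k ^+ 2) <= amgm_gap (1 - p) (1 - q) (1 + k).
Proof.
move=> /andP[p0 p1] /andP[q0 q1] /andP[k0 k1].
(* The gap at p = q = s is split off. The rest is e times a factor of at least 1/20, which pays for
   the 2 e in p^2 + q^2 = 2 s^2 + 2 e. *)
pose s := (p + q) / 2; pose e := (p - q) ^+ 2 / 4.
have e0 : 0 <= e by rewrite divr_ge0 ?sqr_ge0.
have es : e <= s ^+ 2 by rewrite /e /s; have := mulr_ge0 p0 q0; nra.
have s0 : 0 <= s by rewrite /s; lra.
have s1 : s <= 1 by rewrite /s; lra.
have -> : amgm_gap (1 - p) (1 - q) (1 + k) =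
  (3 + 2 * k + k ^+ 2) * (2 * s - s ^+ 2) ^+ 2
  - 6 * (2 * k + k ^+ 2) * (2 * s - s ^+ 2) + 9 / 2 * (s + k) ^+ 2
  + e * (27 / 2 + 6 * (2 * k + k ^+ 2)
         - (3 + 2 * k + k ^+ 2) * (4 - 4 * s + 2 * s ^+ 2 - e)).
  by rewrite /amgm_gap /s /e; field.
have -> : p ^+ 2 + q ^+ 2 + k ^+ 2 = 2 * s ^+ 2 + k ^+ 2 + 2 * e.
  by rewrite /s /e; field.
have he : e * (1 / 20) <= e * (27 / 2 + 6 * (2 * k + k ^+ 2)
         - (3 + 2 * k + k ^+ 2) * (4 - 4 * s + 2 * s ^+ 2 - e)).
  apply: ler_wpM2l => //.
  have h1 : 0 <= 2 * k + k ^+ 2 by nra.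
  have h2 : 4 - 4 * s + 2 * s ^+ 2 - e <= 4 by nra.
  have h3 : (3 + 2 * k + k ^+ 2) * (4 - 4 * s + 2 * s ^+ 2 - e) <=
            (3 + 2 * k + k ^+ 2) * 4 by apply: ler_wpM2l => //; lra.
  lra.
have hk : 0 <= k <= 3 / 7 by rewrite k0.
have [s5|s5] := lerP s (1 / 5).
  have s5' : 0 <= s <= 1 / 5 by rewrite s0.
  have := amgm_gap_diag_small s5' k0; have := sqr_ge0 k; lra.
have s5' : 1 / 5 <= s <= 1 by rewrite ltW.
have := amgm_gap_diag_large s5' hk; have := sqr_ge0 k; lra.
Qed.

(** Two of the three entries lie on the same side of 1, and the gap is symmetric. The bound 10/7 is
    the one available for the entries of a normalized near-extremal vector. *)
Lemma amgm_gap_ge a b c :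
  0 <= a <= 10 / 7 -> 0 <= b <= 10 / 7 -> 0 <= c <= 10 / 7 ->
  1 / 40 * ((a - 1) ^+ 2 + (b - 1) ^+ 2 + (c - 1) ^+ 2) <= amgm_gap a b c.
Proof.
have ll x y z : 0 <= x <= 10 / 7 -> 0 <= y <= 10 / 7 -> 0 <= z <= 10 / 7 ->
    x <= 1 -> y <= 1 ->
    1 / 40 * ((x - 1) ^+ 2 + (y - 1) ^+ 2 + (z - 1) ^+ 2) <= amgm_gap x y z.
  move=> /andP[x0 _] /andP[y0 _] /andP[z0 z2] x1 y1.
  have hx : 0 <= 1 - x <= 1 by apply/andP; split; lra.
  have hy : 0 <= 1 - y <= 1 by apply/andP; split; lra.
  have [z1|z1] := lerP z 1.
    have hz : 0 <= 1 - z <= 1 by apply/andP; split; lra.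
    have := amgm_gap_small hx hy hz; rewrite !opprB !subrKC; lra.
  have hz : 0 <= z - 1 <= 3 / 7 by apply/andP; split; lra.
  have := amgm_gap_small_large hx hy hz; rewrite !opprB !subrKC; lra.
have gg x y z : 0 <= x <= 10 / 7 -> 0 <= y <= 10 / 7 -> 0 <= z <= 10 / 7 ->
    1 <= x -> 1 <= y ->
    1 / 40 * ((x - 1) ^+ 2 + (y - 1) ^+ 2 + (z - 1) ^+ 2) <= amgm_gap x y z.
  move=> /andP[x0 x2] /andP[y0 y2] /andP[z0 z2] x1 y1.
  have hx : 0 <= x - 1 <= 3 / 7 by apply/andP; split; lra.
  have hy : 0 <= y - 1 <= 3 / 7 by apply/andP; split; lra.
  have [z1|z1] := lerP z 1.
    have hz : 0 <= 1 - z <= 1 by apply/andP; split; lra.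
    have := amgm_gap_large_small hx hy hz; rewrite !opprB !subrKC; lra.
  have hz : 0 <= z - 1 by lra.
  have hx' : 0 <= x - 1 by lra.
  have hy' : 0 <= y - 1 by lra.
  have := amgm_gap_large hx' hy' hz; rewrite !subrKC; lra.
move=> ha hb hc.
have [a1|/ltW a1] := lerP a 1; have [b1|/ltW b1] := lerP b 1.
- exact: ll.
- have [c1|/ltW c1] := lerP c 1.
    by rewrite amgm_gapC23 addrAC; apply: ll.
  by rewrite amgm_gapC12 amgm_gapC23 (addrC ((a - 1) ^+ 2)) addrAC; apply: gg.
- have [c1|/ltW c1] := lerP c 1.
    by rewrite amgm_gapC12 amgm_gapC23 (addrC ((a - 1) ^+ 2)) addrAC; apply: ll.
  by rewrite amgm_gapC23 addrAC; apply: gg.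
- exact: gg.
Qed.

End AmgmGap.

(** * Weighted sums *)

Section WeightedSums.

Variables (R : realFieldType) (V : finType).
Implicit Types (u : V -> R) (c : R).

(** For u of total mass 1 these are expectations over independent vertices drawn from u; on
    indicators they are densities. *)
Definition wsum u (f : V -> R) : R := \sum_x u x * f x.
Definition wsum2 u (f : V -> V -> R) : R := wsum u (fun x => wsum u (f x)).
Definition wsum3 u (f : V -> V -> V -> R) : R := wsum u (fun x => wsum2 u (f x)).

Lemma eq_wsum u f g : f =1 g -> wsum u f = wsum u g.
Proof. by move=> fg; apply: eq_bigr => x _; rewrite fg. Qed.

Lemma eq_wsum2 u f g : f =2 g -> wsum2 u f = wsum2 u g.
Proof. by move=> fg; apply: eq_wsum => x; apply: eq_wsum. Qed.

Lemma wsumD u f g : wsum u (fun x => f x + g x) = wsum u f + wsum u g.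
Proof. by rewrite -big_split; apply: eq_bigr => x _; rewrite mulrDr. Qed.

Lemma wsumZ u c f : wsum u (fun x => c * f x) = c * wsum u f.
Proof. by rewrite mulr_sumr; apply: eq_bigr => x _; rewrite mulrCA. Qed.

Lemma wsumZr u c f : wsum u (fun x => f x * c) = wsum u f * c.
Proof. by rewrite mulr_suml; apply: eq_bigr => x _; rewrite mulrA. Qed.

Lemma wsumN u f : wsum u (fun x => - f x) = - wsum u f.
Proof. by rewrite -sumrN; apply: eq_bigr => x _; rewrite mulrN. Qed.

Lemma wsumB u f g : wsum u (fun x => f x - g x) = wsum u f - wsum u g.
Proof. by rewrite wsumD wsumN. Qed.

Lemma wsum_const u c : wsum u (fun=> c) = (\sum_x u x) * c.
Proof. by rewrite mulr_suml. Qed.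

Lemma exchange_wsum u v (f : V -> V -> R) :
  wsum u (fun x => wsum v (f x)) = wsum v (fun y => wsum u (f^~ y)).
Proof.
rewrite /wsum; under eq_bigr do rewrite mulr_sumr.
rewrite exchange_big /=; apply: eq_bigr => y _.
by rewrite mulr_sumr; apply: eq_bigr => x _; rewrite mulrCA.
Qed.

Lemma wsum2C u (f : V -> V -> R) : wsum2 u (fun x y => f y x) = wsum2 u f.
Proof. exact: exchange_wsum. Qed.

Lemma wsum2D u f g :
  wsum2 u (fun x y => f x y + g x y) = wsum2 u f + wsum2 u g.
Proof. by rewrite /wsum2 -wsumD; apply: eq_wsum => x; rewrite wsumD. Qed.

Lemma wsum2Z u c f : wsum2 u (fun x y => c * f x y) = c * wsum2 u f.
Proof. by rewrite /wsum2 -wsumZ; apply: eq_wsum => x; rewrite wsumZ. Qed.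

Lemma wsum2Zr u c f : wsum2 u (fun x y => f x y * c) = wsum2 u f * c.
Proof. by rewrite mulrC -wsum2Z; apply: eq_wsum2 => x y; rewrite mulrC. Qed.

Lemma wsum2B u f g :
  wsum2 u (fun x y => f x y - g x y) = wsum2 u f - wsum2 u g.
Proof. by rewrite /wsum2 -wsumB; apply: eq_wsum => x; rewrite wsumB. Qed.

Lemma wsum2N u f : wsum2 u (fun x y => - f x y) = - wsum2 u f.
Proof. by rewrite /wsum2 -wsumN; apply: eq_wsum => x; rewrite wsumN. Qed.

Lemma wsum2_prod u (f g : V -> R) :
  wsum2 u (fun x y => f x * g y) = wsum u f * wsum u g.
Proof. by rewrite /wsum2 -wsumZr; apply: eq_wsum => x; rewrite wsumZ. Qed.

Section Nonneg.

Variable u : V -> R.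
Hypothesis u0 : forall x, 0 <= u x.

Lemma ler_wsum_supp f g :
  (forall x, 0 < u x -> f x <= g x) -> wsum u f <= wsum u g.
Proof.
move=> fg; apply: ler_sum => x _.
have [ux|ux] := eqVneq (u x) 0; first by rewrite ux !mul0r.
by rewrite ler_wpM2l ?fg // lt_neqAle eq_sym ux u0.
Qed.

Lemma ler_wsum f g : (forall x, f x <= g x) -> wsum u f <= wsum u g.
Proof. by move=> fg; apply: ler_wsum_supp => x _. Qed.

Lemma ler_wsum2 f g :
  (forall x y, f x y <= g x y) -> wsum2 u f <= wsum2 u g.
Proof. by move=> fg; apply: ler_wsum => x; apply: ler_wsum. Qed.

Lemma ler_wsum3 f g :
  (forall x y z, f x y z <= g x y z) -> wsum3 u f <= wsum3 u g.
Proof. by move=> fg; apply: ler_wsum => x; apply: ler_wsum2. Qed.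

Lemma wsum_ge0 f : (forall x, 0 <= f x) -> 0 <= wsum u f.
Proof. by move=> f0; apply: sumr_ge0 => x _; rewrite mulr_ge0. Qed.

Lemma wsum2_ge0 f : (forall x y, 0 <= f x y) -> 0 <= wsum2 u f.
Proof. by move=> f0; apply: wsum_ge0 => x; apply: wsum_ge0. Qed.

Lemma wsum_ltW_ex f g : wsum u f < wsum u g -> exists x, f x < g x.
Proof.
move=> fg; case: (boolP [exists x, f x < g x]) => [/existsP //|].
rewrite negb_exists => /forallP h; move: fg; rewrite ltNge => /negP[].
by apply: ler_wsum => x; rewrite leNgt.
Qed.

End Nonneg.

Section Probability.

Variable u : V -> R.
Hypotheses (u0 : forall x, 0 <= u x) (u1 : \sum_x u x = 1).

Lemma wsum_cst c : wsum u (fun=> c) = c.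
Proof. by rewrite wsum_const u1 mul1r. Qed.

Lemma wsum2_cst c : wsum2 u (fun _ _ => c) = c.
Proof. by rewrite /wsum2 !wsum_cst. Qed.

Lemma wsum2_fst f : wsum2 u (fun x _ => f x) = wsum u f.
Proof. by apply: eq_wsum => x; rewrite wsum_cst. Qed.

Lemma wsum2_snd f : wsum2 u (fun _ => f) = wsum u f.
Proof. by rewrite /wsum2 wsum_cst. Qed.

Lemma sqr_wsum_le f : wsum u f ^+ 2 <= wsum u (fun x => f x ^+ 2).
Proof.
have h : 0 <= wsum u (fun x => (f x - wsum u f) ^+ 2).
  by apply: wsum_ge0 => // x; apply: sqr_ge0.
have e : wsum u (fun x => (f x - wsum u f) ^+ 2) =
    wsum u (fun x => f x ^+ 2) - wsum u f ^+ 2.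
  have -> : wsum u (fun x => (f x - wsum u f) ^+ 2) =
      wsum u (fun x => f x ^+ 2 + (- (2 * wsum u f) * f x + wsum u f ^+ 2)).
    by apply: eq_wsum => x; ring.
  by rewrite !wsumD wsumZ wsum_cst; ring.
by rewrite -subr_ge0 -e.
Qed.

(** Averages a pointwise inequality over four independent vertices: each term on the right sees only
    one pair of them. *)
Lemma wsum4_pairs (p q a1 a2 b1 b2 b3 b4 : V -> V -> R) :
  (forall x y z t, p x y * q z t <=
     a1 x y + a2 z t + b1 x z + b2 x t + b3 y z + b4 y t) ->
  wsum2 u p * wsum2 u q <= wsum2 u a1 + wsum2 u a2 +
     wsum2 u b1 + wsum2 u b2 + wsum2 u b3 + wsum2 u b4.
Proof.
move=> h.
have -> : wsum2 u p * wsum2 u q =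
    wsum2 u (fun x y => wsum2 u (fun z t => p x y * q z t)).
  by rewrite -wsum2Zr; apply: eq_wsum2 => x y; rewrite wsum2Z.
apply: (le_trans (ler_wsum2 u0 (fun x y => ler_wsum2 u0 (h x y)))).
have e x y : wsum2 u (fun z t => a1 x y + a2 z t + b1 x z + b2 x t + b3 y z + b4 y t)
    = a1 x y + (wsum2 u a2 + ((wsum u (b1 x) + wsum u (b2 x))
      + (wsum u (b3 y) + wsum u (b4 y)))).
  rewrite !wsum2D wsum2_cst !wsum2_fst.
  by rewrite !wsum2_snd; ring.
rewrite (eq_wsum2 u e) !wsum2D wsum2_cst.
by rewrite !wsum2_fst !wsum2_snd !addrA.
Qed.

(** The pairs are opposite vertices of an octahedron and m is charged on four alternate faces. These
    are the four Fano lines missing a point whose own lines contain the three pairs. Averaging over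
    z1 and z2 reduces it to four vertices. *)
Lemma wsum6_octahedron (p q r a b : V -> V -> R) (m : V -> V -> V -> R) :
  (forall x1 x2 y1 y2 z1 z2, p x1 x2 * q y1 y2 * r z1 z2 <=
     a x1 x2 + b y1 y2 + m x1 y1 z1 + m x1 y2 z2 + m x2 y1 z2 + m x2 y2 z1) ->
  wsum2 u p * wsum2 u q * wsum2 u r <= wsum2 u a + wsum2 u b + 4 * wsum3 u m.
Proof.
move=> h; pose m' x y := wsum u (m x y).
have e : wsum2 u m' = wsum3 u m by [].
have : wsum2 u (fun x y => wsum2 u r * p x y) * wsum2 u q <=
    wsum2 u a + wsum2 u b + wsum2 u m' + wsum2 u m' + wsum2 u m' + wsum2 u m'.
  apply: wsum4_pairs => x1 x2 y1 y2.
  have -> : wsum2 u r * p x1 x2 * q y1 y2 =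
      wsum2 u (fun z1 z2 => p x1 x2 * q y1 y2 * r z1 z2).
    by rewrite wsum2Z; ring.
  apply: le_trans (ler_wsum2 u0 (h x1 x2 y1 y2)) _.
  rewrite !wsum2D !wsum2_cst !wsum2_fst.
  by rewrite !wsum2_snd /m'; lra.
by rewrite wsum2Z e; lra.
Qed.

End Probability.

End WeightedSums.

(** * Four graphs without a rainbow K4 *)

Section FourColours.

Local Open Scope nat_scope.

(** Greedy choice: one element of the smaller of A and B, another of the larger, which has at least
    two, and then a third of C. *)
Lemma sdr_exists (T : finType) (A B C : {set T}) :
  0 < #|A| -> 0 < #|B| -> 2 < #|A| + #|B| -> 2 < #|C| ->
  exists i j k, [&& i != j, i != k, j != k, i \in A, j \in B & k \in C].
Proof.
wlog AB : A B / #|A| <= #|B| => [wl|] A0 B0 AB2 C2.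
  have [|/ltnW] := leqP #|A| #|B| => [AB|BA]; first exact: wl.
  have [||//||i [j [k /and5P[ij ik jk iB /andP[jA kC]]]]] := wl B A BA; rewrite // 1?addnC //.
  by exists j, i, k; rewrite eq_sym ij ik jk iB jA kC.
have [i iA] := card_gt0P A0.
have /card_gt0P[j] : 0 < #|B :\ i|.
  by move: (cardsD1 i B); case: (i \in B); lia.
rewrite !inE => /andP[ji jB].
have /card_gt0P[k] : 0 < #|C :\ i :\ j|.
  move: (cardsD1 i C) (cardsD1 j (C :\ i)).
  by case: (i \in C); case: (j \in C :\ i); lia.
rewrite !inE => /and3P[kj ki kC].
by exists i, j, k; rewrite eq_sym ji eq_sym ki eq_sym kj iA jB kC.
Qed.

(* Hall's condition for three subsets of a set with four elements *)
Lemma no_sdr_card (S T U : 'I_4 -> bool) :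
  (forall i j k, i != j -> i != k -> j != k -> ~~ [&& S i, T j & U k]) ->
  [|| \sum_i S i == 0, \sum_i T i == 0, \sum_i U i == 0
    | \sum_i S i + \sum_i T i + \sum_i U i <= 6].
Proof.
move=> h.
have sumE (F : 'I_4 -> bool) : \sum_i F i = #|[set i | F i]|.
  rewrite -sum1_card [RHS]big_mkcond; apply: eq_bigr => i _.
  by rewrite inE; case: (F i).
have le4 (A : {set 'I_4}) : #|A| <= 4 by rewrite -[X in _ <= X]card_ord max_card.
rewrite !{}sumE.
have abs i j k : i \in [set i | S i] -> j \in [set i | T i] ->
    k \in [set i | U i] -> [&& i != j, i != k & j != k] -> false.
  rewrite !inE => Si Tj Uk /and3P[ij ik jk].
  by move: (h i j k ij ik jk); rewrite Si Tj Uk.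
move: [set i | S i] [set i | T i] [set i | U i] abs => A B C abs.
have C4 : #|C| <= 4 by apply: le4.
have B4 : #|B| <= 4 by apply: le4.
have A4 : #|A| <= 4 by apply: le4.
apply: contraT; rewrite !negb_or -ltnNge -!lt0n => /and4P[A0 B0 C0 s7].
have [C3|C2] := ltnP 2 #|C|.
  have [//|//||//|i [j [k /and5P[ij ik jk iA /andP[jB kC]]]]] := @sdr_exists _ A B C.
    by lia.
  by move: (abs i j k iA jB kC); rewrite ij ik jk => /(_ isT).
have [B3|B2] := ltnP 2 #|B|.
  have [//|//||//|i [k [j /and5P[ik ij kj iA /andP[kC jB]]]]] := @sdr_exists _ A C B.
    by lia.
  by move: (abs i j k iA jB kC); rewrite ij ik eq_sym kj => /(_ isT).
have [//|//|||j [k [i /and5P[jk ji ki jB /andP[kC iA]]]]] := @sdr_exists _ B C A; try by lia.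
by move: (abs i j k iA jB kC); rewrite eq_sym ji eq_sym ki jk => /(_ isT).
Qed.

Variables (V : finType) (L : 'I_4 -> rel V).
Hypothesis LC : forall i x y, L i x y = L i y x.
Hypothesis L_irr : forall i x, L i x x = false.
Hypothesis L_rainbow : forall i j k x y z t, i != j -> i != k -> j != k ->
  ~~ [&& L i x y, L i z t, L j x z, L j y t, L k x t & L k y z].

Definition mult x y := \sum_i L i x y.
(** The number of colours carried by both edges of the matching xy, zt of a K4. Three distinct
    colours, one common to each of its three matchings, would make the K4 rainbow. *)
Definition common x y z t := \sum_i (L i x y && L i z t).

Lemma multC x y : mult x y = mult y x.
Proof. by apply: eq_bigr => i _; rewrite LC. Qed.

Lemma multxx x : mult x x = 0.
Proof. by apply: big1 => i _; rewrite L_irr. Qed.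

Lemma mult_le4 x y : mult x y <= 4.
Proof. by rewrite -[4]card_ord -sum1_card; apply: leq_sum => i _; case: (L i x y). Qed.

Lemma common_le x y z t : common x y z t <= mult x y.
Proof. by apply: leq_sum => i _; case: (L i x y); case: (L i z t). Qed.

Lemma common_ge x y z t : mult x y + mult z t <= 4 + common x y z t.
Proof.
have e4 : \sum_(j < 4) 1 = 4 by rewrite sum1_card card_ord.
rewrite -[X in _ <= X + _]e4 -!big_split /=.
by apply: leq_sum => i _; case: (L i x y); case: (L i z t).
Qed.

Lemma common_ge_missing i x y z t : ~~ L i x y -> ~~ L i z t ->
  mult x y + mult z t <= 3 + common x y z t.
Proof.
move=> /negPf xy /negPf zt.
have e1 : \sum_(j < 4) (j == i) = 1.
  by rewrite (bigD1 i) //= eqxx big1 // => j /negPf->.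
have e4 : \sum_(j < 4) 1 = 4 by rewrite sum1_card card_ord.
suff : mult x y + mult z t + 1 <= 4 + common x y z t by lia.
rewrite -[X in _ + X <= _]e1 -[X in _ <= X + _]e4 -!big_split /=.
apply: leq_sum => j _; case: eqP => [->|_]; first by rewrite xy zt.
by case: (L j x y); case: (L j z t).
Qed.

Lemma common_rainbow x y z t :
  [|| common x y z t == 0, common x z y t == 0, common x t y z == 0
    | common x y z t + common x z y t + common x t y z <= 6].
Proof.
apply: no_sdr_card => i j k ij ik jk.
by apply: contra (L_rainbow x y z t ij ik jk) => /and3P[/andP[-> ->] /andP[-> ->] /andP[-> ->]].
Qed.

(** A matching carries at most 4 plus its common colours. Either these number at most 6 in all,
    which gives 18, or some matching has none and carries at most 4, the other two at most 8
    each. *)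
Lemma mult_K4 x y z t :
  mult x y + mult x z + mult x t + mult y z + mult y t + mult z t <= 20.
Proof.
have := common_rainbow x y z t.
have := common_ge x y z t; have := common_ge x z y t; have := common_ge x t y z.
have := common_le x y z t; have := common_le x z y t; have := common_le x t y z.
have := mult_le4 x y; have := mult_le4 x z; have := mult_le4 x t.
by lia.
Qed.

(** If zt had multiplicity 3, the matchings would have at least 3, 2 and 2 common colours, more than
    the 6 allowed. *)
Lemma mult_K4_edge4 x y z t : mult x y = 4 -> 3 <= mult x z -> 3 <= mult x t ->
  3 <= mult y z -> 3 <= mult y t -> mult z t <= 2.
Proof.
have := common_rainbow x y z t.
have := common_ge x y z t; have := common_ge x z y t; have := common_ge x t y z.
by lia.
Qed.

Lemma mult_triangle11 x y z v : mult x y = 4 -> mult x z = 4 -> mult y z = 3 ->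
  mult v x + mult v y + mult v z <= 9 /\
  (mult v x + mult v y + mult v z = 9 -> mult v x = 1).
Proof.
rewrite (multC v x) (multC v y) (multC v z).
have := common_rainbow x y z v; have := mult_K4 x y z v.
have := common_ge x y z v; have := common_ge x z y v; have := common_ge x v y z.
have := mult_le4 x v; have := mult_le4 y v; have := mult_le4 z v.
by lia.
Qed.

(** A colour absent from both edges of a matching improves inclusion-exclusion by one, so that
    multiplicities of 3 throughout would again give 3 + 2 + 2 common colours. *)
Lemma mult_K4_missing i x y z t : ~~ L i x y -> ~~ L i z t -> 3 <= mult x y ->
  3 <= mult z t -> 3 <= mult x z -> 3 <= mult y t -> 3 <= mult x t ->
  mult y z <= 2.
Proof.
move=> xy zt; have := common_rainbow x y z t.
have := common_ge_missing xy zt; have := common_ge x z y t; have := common_ge x t y z.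
by lia.
Qed.

(** Full cross edges give two matchings with all four colours in common; a single common colour on
    the third then makes a rainbow K4. *)
Lemma mult_K4_cross i x y z t : mult x z = 4 -> mult x t = 4 -> mult y z = 4 ->
  mult y t = 4 -> L i x y -> ~~ L i z t.
Proof.
move=> h1 h2 h3 h4 xy; apply/negP => zt; have := common_rainbow x y z t.
have := common_ge x z y t; have := common_ge x t y z.
have : 0 < common x y z t by rewrite /common (bigD1 i) //= xy zt.
by lia.
Qed.

(* Deleting such a set D lowers the quadratic form of mult by no more than it lowers 3 |u|^2. *)
Lemma mult_reducing_set (P : {set V}) : P != finset.set0 -> exists2 D : {set V},
  (D != finset.set0) && (D \subset P) &
  forall v, v \in P -> \sum_(d in D) mult v d <= 3 * #|D|.
Proof.
move=> /set0Pn[p pP].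
(* D is a triangle of total at least 11, else an edge of multiplicity 4, else one vertex. The bound
   3 |D| comes from 20 - 11 = 9, from 10 - 4 = 6, and from the absence of multiplicity 4. *)
have [/existsP[x /existsP[y /existsP[z /and4P[xP yP zP h]]]]|no3] :=
  boolP [exists x, exists y, exists z, [&& x \in P, y \in P, z \in P
     & 11 <= mult x y + mult x z + mult y z]].
  exists [set x; y; z].
    apply/andP; split; first by apply/set0Pn; exists x; rewrite !inE eqxx.
    by apply/fintype.subsetP => d; rewrite !inE => /orP[/orP[]|] /eqP->.
  have xy : x != y by apply: contraTneq h => ->; have := mult_le4 y z; rewrite multxx; lia.
  have xz : x != z by apply: contraTneq h => ->; rewrite multxx [mult z y]multC; have := mult_le4 y z; lia.
  have yz : y != z by apply: contraTneq h => ->; rewrite multxx; have := mult_le4 x z; lia.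
  move=> v vP; rewrite -finset.setUA big_setU1 ?big_setU1 ?big_set1 ?inE ?negb_or ?xy //=.
  rewrite cardsU1 cards2 !inE negb_or xy xz yz /=.
  by have := mult_K4 x y z v; rewrite (multC v x) (multC v y) (multC v z); lia.
have [/existsP[x /existsP[y /and3P[xP yP /eqP h]]]|no2] :=
  boolP [exists x, exists y, [&& x \in P, y \in P & mult x y == 4]].
  have xy : x != y by apply: contra_eq_neq h => ->; rewrite multxx.
  exists [set x; y].
    apply/andP; split; first by apply/set0Pn; exists x; rewrite !inE eqxx.
    by apply/fintype.subsetP => d; rewrite !inE => /orP[] /eqP->.
  move=> v vP; rewrite big_setU1 ?inE //= big_set1 cards2 xy /=.
  move: no3; rewrite negb_exists => /forallP/(_ x); rewrite negb_exists.
  move=> /forallP/(_ y); rewrite negb_exists => /forallP/(_ v).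
  by rewrite xP yP vP h (multC v x) (multC v y) /=; lia.
exists [set p].
  apply/andP; split; first by apply/set0Pn; exists p; rewrite !inE eqxx.
  by apply/fintype.subsetP => d; rewrite !inE => /eqP->.
move=> v vP; rewrite big_set1 cards1.
move: no2; rewrite negb_exists => /forallP/(_ v); rewrite negb_exists.
by move=> /forallP/(_ p); rewrite vP pP /=; have := mult_le4 v p; lia.
Qed.

End FourColours.

(** * The weighted density of four graphs without a rainbow K4 *)

Section MultiplicityBound.

Variables (R : realFieldType) (V : finType) (L : 'I_4 -> rel V).
Hypothesis LC : forall i x y, L i x y = L i y x.
Hypothesis L_irr : forall i x, L i x x = false.
Hypothesis L_rainbow : forall i j k x y z t, i != j -> i != k -> j != k ->
  ~~ [&& L i x y, L i z t, L j x z, L j y t, L k x t & L k y z].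

Lemma wsum2_mult u :
  wsum2 u (fun x y => (mult L x y)%:R : R) =
  \sum_i wsum2 u (fun x y => (L i x y)%:R).
Proof.
rewrite /wsum2 /wsum exchange_big /=; apply: eq_bigr => x _.
rewrite -mulr_sumr exchange_big /=; congr (_ * _); apply: eq_bigr => y _.
by rewrite natr_sum mulr_sumr.
Qed.

(** Induction on the support: the least weight on a reducing set D is subtracted from all of D, so a
    vertex leaves the support. The cross term and the square term of the form are each bounded by
    those of 3 |u|^2. *)
Lemma wsum2_mult_le (u : V -> R) : (forall x, 0 <= u x) ->
  wsum2 u (fun x y => (mult L x y)%:R) <= 3 * (\sum_x u x) ^+ 2.
Proof.
have [m] := ubnP #|[set x | u x != 0]|.
elim: m u => // m IHm u /ltnSE supp u0.
pose P := [set x | u x != 0]%SET.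
have [P0|P0] := eqVneq P finset.set0.
  have uE x : u x = 0.
    by apply/eqP; apply: contraT => ux; have := finset.in_set0 x; rewrite -P0 inE ux.
  have -> : wsum2 u (fun x y => (mult L x y)%:R) = 0 :> R.
    by apply: big1 => x _; rewrite uE mul0r.
  by rewrite mulr_ge0 ?sqr_ge0.
have [D /andP[D0 DP] Dle] := mult_reducing_set LC L_irr L_rainbow P0.
have [d0 d0D] := finset.set0Pn _ D0.
pose d := [arg min_(i < d0 in D) u i]%O.
have [dD dmin] : d \in D /\ forall i, i \in D -> u d <= u i.
  by rewrite /d; case: arg_minP.
pose s := u d.
pose t x := u x - s * (x \in D)%:R.
have s0 : 0 <= s by apply: u0.
have t0 x : 0 <= t x.
  rewrite /t subr_ge0; case: (boolP (x \in D)) => [xD|_]; last by rewrite mulr0.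
  by rewrite mulr1; apply: dmin.
have tP x : x \notin P -> t x = 0.
  rewrite inE negbK => /eqP ux; apply/eqP; rewrite eq_le t0 andbT /t ux.
  by rewrite sub0r oppr_le0 mulr_ge0.
have IH : wsum2 t (fun x y => (mult L x y)%:R) <= 3 * (\sum_x t x) ^+ 2.
  apply: IHm => //; apply: leq_trans supp; apply: proper_card.
  apply/properP; split.
    by apply/fintype.subsetP => x; rewrite inE; apply: contraR => /tP ->.
  exists d; first exact: (fintype.subsetP DP).
  by rewrite !inE negbK /t dD mulr1 subrr.
have uE x : u x = t x + s * (x \in D)%:R by rewrite /t subrK.
pose h v : R := (\sum_(e in D) mult L v e)%:R.
have hle v : v \in P -> h v <= 3 * #|D|%:R.
  by move=> vP; rewrite /h -natrM ler_nat; apply: Dle.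
have hE v : wsum (fun x => (x \in D)%:R) (fun y => (mult L v y)%:R : R) = h v.
  rewrite /wsum /h natr_sum [RHS]big_mkcond; apply: eq_bigr => y _.
  by case: (y \in D); rewrite ?mul1r ?mul0r.
have wsum_add (f : V -> R) :
    wsum u f = wsum t f + s * wsum (fun x => (x \in D)%:R) f.
  rewrite /wsum mulr_sumr -big_split; apply: eq_bigr => x _.
  by rewrite uE mulrDl mulrA.
have cross : wsum (fun x => (x \in D)%:R) (fun x => wsum t (fun y => (mult L x y)%:R))
    = wsum t h :> R.
  by rewrite exchange_wsum; apply: eq_wsum => y; rewrite -hE;
    apply: eq_wsum => x; rewrite multC.
have -> : wsum2 u (fun x y => (mult L x y)%:R : R) =
    wsum2 t (fun x y => (mult L x y)%:R) + 2 * s * wsum t h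
    + s ^+ 2 * wsum (fun x => (x \in D)%:R) h.
  have e x : wsum u (fun y => (mult L x y)%:R) =
      wsum t (fun y => (mult L x y)%:R) + s * h x by rewrite wsum_add hE.
  by rewrite /wsum2 (eq_wsum u e) wsum_add !wsumD !wsumZ cross; ring.
have sumE : \sum_x u x = \sum_x t x + s * #|D|%:R.
  rewrite (eq_bigr _ (fun x _ => uE x)) big_split -mulr_sumr /=; congr (_ + _ * _).
  rewrite -sum1_card natr_sum [RHS]big_mkcond; apply: eq_bigr => x _.
  by case: (x \in D).
have th : wsum t h <= (\sum_x t x) * (3 * #|D|%:R).
  rewrite -wsum_const; apply: ler_wsum_supp => // x tx; apply: hle.
  by apply: contraTT tx => /tP ->; rewrite ltxx.
have Dh : wsum (fun x => (x \in D)%:R) h <= #|D|%:R * (3 * #|D|%:R).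
  rewrite -[X in X%:R * (3 * _)]sum1_card natr_sum big_mkcond /= mulr_suml.
  apply: ler_sum => x _; case: ifP => [xD|_]; last by rewrite !mul0r.
  by rewrite !mul1r; apply: hle; apply: (fintype.subsetP DP).
have := ler_wpM2l (mulr_ge0 (ler0n R 2) s0) th.
have := ler_wpM2l (sqr_ge0 s) Dh.
rewrite sumE; lra.
Qed.

End MultiplicityBound.

(** * Density of Fano-free triple systems *)

Section TripleSystems.

Variable V : finType.

Definition triple_system (g : V -> V -> V -> bool) : Prop :=
  [/\ forall x y z, g x y z = g y x z, forall x y z, g x y z = g x z y
    & forall x z, g x x z = false].

(* The seven lines of the Fano plane, presented from a point v on the lines v x1 x2, v y1 y2,
   v z1 z2. Any two points being collinear, such points are distinct in a triple system. *)
Definition fano_hom_free (g : V -> V -> V -> bool) : Prop :=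
  forall v x1 x2 y1 y2 z1 z2,
  ~~ [&& g v x1 x2, g v y1 y2, g v z1 z2,
         g x1 y1 z1, g x1 y2 z2, g x2 y1 z2 & g x2 y2 z1].

Variables (R : realFieldType) (g : V -> V -> V -> bool).
Hypotheses (gS : triple_system g) (gF : fano_hom_free g).

Lemma tripleC12 x y z : g x y z = g y x z. Proof. by case: gS. Qed.
Lemma tripleC23 x y z : g x y z = g x z y. Proof. by case: gS. Qed.
Lemma triplexx x z : g x x z = false. Proof. by case: gS. Qed.

Lemma triple_rot x y z : g x y z = g y z x.
Proof. by rewrite tripleC12 tripleC23. Qed.

Definition deg (u : V -> R) v : R := wsum2 u (fun x y => (g v x y)%:R).

(** Count the triples among vxz, vyz, xyz over the edges xy of the link of v and all z. Without a K4
    the count is at most 2 D, where D is the degree of v. Cauchy-Schwarz for the first two kinds and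
    inclusion-exclusion for the third give at least 2 D^2 + D + d0 - 1. This is impossible, as D >=
    d0 and 2 d0^2 > 1. *)
Lemma K4_exists (u : V -> R) (d0 : R) v :
  (forall x, 0 <= u x) -> \sum_x u x = 1 -> 37 / 50 <= d0 ->
  (forall x, 0 < u x -> d0 <= deg u x) -> 0 < u v ->
  exists x y z, [&& g v x y, g v x z, g v y z & g x y z] /\
    [/\ 0 < u x, 0 < u y & 0 < u z].
Proof.
move=> u0 u1 d0ge dge uv.
pose G x y z : R := (g x y z)%:R.
have [/existsP[x /existsP[y /existsP[z /andP[H /and3P[ux uy uz]]]]]|none] :=
  boolP [exists x, exists y, exists z,
    [&& g v x y, g v x z, g v y z & g x y z] && [&& 0 < u x, 0 < u y & 0 < u z]].
  by exists x, y, z.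
have pw x y z : 0 < u x -> 0 < u y -> 0 < u z ->
    G v x y * (G v x z + G v y z + G x y z) <= 2 * G v x y.
  move=> ux uy uz; move: none; rewrite negb_exists => /forallP/(_ x).
  rewrite negb_exists => /forallP/(_ y); rewrite negb_exists => /forallP/(_ z).
  rewrite ux uy uz andbT /G.
  by case: (g v x y); case: (g v x z); case: (g v y z); case: (g x y z) => //= _; lra.
pose f x := wsum u (G v x).
have fC y : wsum u (fun x => G v x y) = f y.
  by apply: eq_wsum => x; rewrite /G tripleC23.
have dE : deg u v = wsum u f by [].
have pw2 : wsum2 u (fun x y => G v x y * (f x + f y + wsum u (G x y)))
    <= 2 * deg u v.
  rewrite -wsum2Z; apply: ler_wsum_supp => // x ux; apply: ler_wsum_supp => // y uy.
  have -> : G v x y * (f x + f y + wsum u (G x y)) =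
      wsum u (fun z => G v x y * (G v x z + G v y z + G x y z)).
    by rewrite wsumZ !wsumD.
  rewrite -[X in _ <= X](wsum_cst u1); apply: ler_wsum_supp => // z uz.
  exact: pw.
have e1 : wsum2 u (fun x y => G v x y * f x) = wsum u (fun x => f x ^+ 2).
  by apply: eq_wsum => x; rewrite wsumZr expr2.
have e2 : wsum2 u (fun x y => G v x y * f y) = wsum u (fun x => f x ^+ 2).
  rewrite -wsum2C; apply: eq_wsum => y; rewrite wsumZr expr2.
  by rewrite fC.
have e3 : wsum2 u (fun x y => G v x y * wsum u (G x y)) =
    wsum u (fun z => wsum2 u (fun x y => G v x y * G x y z)).
  rewrite [RHS]exchange_wsum; apply: eq_wsum => x.
  by rewrite [RHS]exchange_wsum; apply: eq_wsum => y; rewrite wsumZ.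
have h3 : deg u v + d0 - 1 <= wsum u (fun z => wsum2 u (fun x y => G v x y * G x y z)).
  rewrite -[X in X <= _](wsum_cst u1); apply: ler_wsum_supp => // z uz.
  apply: (@le_trans _ _ (deg u v + deg u z - 1)).
    by rewrite lerB // lerD2l dge.
  rewrite -[X in _ - X](wsum2_cst u1) -wsum2D -wsum2B.
  apply: ler_wsum2 => // x y; rewrite /G (triple_rot z x y).
  by case: (g v x y); case: (g x y z) => /=; lra.
have h1 := sqr_wsum_le u0 u1 f.
have dv := dge _ uv.
have : wsum2 u (fun x y => G v x y * (f x + f y + wsum u (G x y))) =
    2 * wsum u (fun x => f x ^+ 2)
    + wsum u (fun z => wsum2 u (fun x y => G v x y * G x y z)).
  rewrite -e3 mulr_natl mulr2n -{2}e2 -e1 -!wsum2D.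
  by apply: eq_wsum2 => x y; ring.
rewrite -dE in h1.
have : 0 <= (deg u v - d0) * (2 * (deg u v + d0) - 1).
  by rewrite mulr_ge0 //; lra.
nra.
Qed.

Definition K4_vertex (s : 'I_4 -> V) : Prop :=
  forall i j k, i != j -> i != k -> j != k -> g (s i) (s j) (s k).

Lemma K4_vertexP v x y z : [&& g v x y, g v x z, g v y z & g x y z] ->
  K4_vertex (fun i => nth v [:: v; x; y; z] i).
Proof.
move=> /and4P[vxy vxz vyz xyz].
have p6 a b c : g a b c -> [/\ g a c b, g b a c, g b c a & g c a b] /\ g c b a.
  move=> h; rewrite -tripleC23 h -tripleC12 h -triple_rot h.
  by rewrite triple_rot h tripleC23 triple_rot h.
have [[? ? ? ?] ?] := p6 _ _ _ vxy; have [[? ? ? ?] ?] := p6 _ _ _ vxz.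
have [[? ? ? ?] ?] := p6 _ _ _ vyz; have [[? ? ? ?] ?] := p6 _ _ _ xyz.
by case=> [[|[|[|[|//]]]] ?] [[|[|[|[|//]]]] ?] [[|[|[|[|//]]]] ?].
Qed.

Section Links.

Variable s : 'I_4 -> V.
Hypothesis sK4 : K4_vertex s.

Definition link i : rel V := g (s i).

Lemma linkC i x y : link i x y = link i y x.
Proof. exact: tripleC23. Qed.

Lemma link_irr i x : link i x x = false.
Proof. by rewrite /link triple_rot triplexx. Qed.

(** A rainbow K4 on x, y, z, t becomes a Fano plane once the line s i, s j, s k is added; it is
    presented from the point x. *)
Lemma link_rainbow i j k x y z t : i != j -> i != k -> j != k ->
  ~~ [&& link i x y, link i z t, link j x z, link j y t, link k x t & link k y z].
Proof.
move=> ij ik jk; apply: contra (gF x (s i) y (s j) z (s k) t).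
rewrite /link => /and5P[h1 h2 h3 h4 /andP[h5 h6]].
rewrite tripleC12 h1 tripleC12 h3 tripleC12 h5 sK4 // h2 tripleC12 h4.
by rewrite -triple_rot h6.
Qed.

Lemma sum_link_deg_le u : (forall x, 0 <= u x) ->
  \sum_i deg u (s i) <= 3 * (\sum_x u x) ^+ 2.
Proof.
move=> u0; have := wsum2_mult_le linkC link_irr link_rainbow u0.
by rewrite wsum2_mult.
Qed.

End Links.

Lemma deg_scale u c v : deg (fun x => c * u x) v = c ^+ 2 * deg u v.
Proof.
have sc f : wsum (fun x => c * u x) f = c * wsum u f.
  by rewrite /wsum mulr_sumr; apply: eq_bigr => x _; rewrite mulrA.
rewrite /deg /wsum2 sc expr2 -mulrA; congr (_ * _); rewrite -wsumZ.
by apply: eq_wsum => x; rewrite sc.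
Qed.

(** Were all degrees above 3/4 after normalization, there would be a K4 in the support, and its four
    links would have total density above 3. *)
Lemma low_degree_exists u : (forall x, 0 <= u x) -> 0 < \sum_x u x ->
  exists2 v, 0 < u v & deg u v <= 3 / 4 * (\sum_x u x) ^+ 2.
Proof.
move=> u0 U0; set U := \sum_x u x in U0 *.
have [/existsP[v /andP[uv dv]]|none] :=
  boolP [exists v, (0 < u v) && (deg u v <= 3 / 4 * U ^+ 2)].
  by exists v.
have big x : 0 < u x -> 3 / 4 * U ^+ 2 < deg u x.
  move=> ux; move: none; rewrite negb_exists => /forallP/(_ x).
  by rewrite ux /= -ltNge.
have [v uv] : exists v, 0 < u v.
  apply/existsP; apply: contraT; rewrite negb_exists => /forallP h.
  move: U0; rewrite /U big1 ?ltxx // => x _; apply/eqP; rewrite eq_le u0 andbT.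
  by rewrite leNgt.
pose w x := U^-1 * u x.
have w0 x : 0 <= w x by rewrite mulr_ge0 ?invr_ge0 // ltW.
have w1 : \sum_x w x = 1 by rewrite -mulr_sumr mulVf // gt_eqF.
have wu x : (0 < w x) = (0 < u x) by rewrite pmulr_rgt0 ?invr_gt0.
have wdeg x : 0 < w x -> 3 / 4 <= deg w x.
  rewrite wu => /big; rewrite deg_scale => h.
  rewrite exprVn [X in _ <= X]mulrC ler_pdivlMr ?exprn_gt0 //; exact: ltW.
have [||x [y [z [K [wx wy wz]]]]] := K4_exists (v := v) w0 w1 _ wdeg.
- by lra.
- by rewrite wu.
have := sum_link_deg_le (K4_vertexP K) u0.
rewrite !big_ord_recl big_ord0 /= -/U.
have := big v uv; have := big x; have := big y; have := big z.
rewrite -!wu => /(_ wz) ? /(_ wy) ? /(_ wx) ? ? ?.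
by lra.
Qed.

(** Removing a low-degree vertex v lowers the triple sum by 3 u v times its degree. The first-order
    change of 3/4 U^3, with U the total mass, pays for this up to terms of second order in u v,
    which the term with the sum of squares absorbs. *)
Lemma triple_density (u : V -> R) : (forall x, 0 <= u x) ->
  wsum3 u (fun x y z => (g x y z)%:R) <=
  3 / 4 * (\sum_x u x) ^+ 3 + 9 / 4 * (\sum_x u x) * (\sum_x u x ^+ 2).
Proof.
have [m] := ubnP #|[set x | u x != 0]|.
elim: m u => // m IHm u /ltnSE supp u0.
have U0 : 0 <= \sum_x u x by apply: sumr_ge0.
have [Uz|Un] := eqVneq (\sum_x u x) 0.
  have uE x : u x = 0.
    by apply/eqP; move/eqP: Uz; rewrite psumr_eq0 // => /allP/(_ x); rewrite mem_index_enum; apply.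
  by rewrite Uz expr0n mulr0 mulr0 mul0r addr0 /wsum3 /wsum big1 // => x _; rewrite uE mul0r.
have Ugt0 : 0 < \sum_x u x by rewrite lt_neqAle eq_sym Un U0.
have [v uv dv] := low_degree_exists u0 Ugt0.
pose t x := if x == v then 0 else u x.
have t0 x : 0 <= t x by rewrite /t; case: ifP.
have wsum_del f : wsum u f = wsum t f + u v * f v.
  rewrite /wsum (bigD1 v) //= [X in _ = X + _](bigD1 v) //= /t eqxx mul0r add0r addrC.
  by congr (_ + _); apply: eq_bigr => x /negPf->.
have sumE : \sum_x u x = \sum_x t x + u v.
  rewrite (bigD1 v) //= [X in _ = X + _](bigD1 v) //= /t eqxx add0r addrC.
  by congr (_ + _); apply: eq_bigr => x /negPf->.
have sqrE : \sum_x u x ^+ 2 = \sum_x t x ^+ 2 + u v ^+ 2.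
  rewrite (bigD1 v) //= [X in _ = X + _](bigD1 v) //= /t eqxx expr0n add0r addrC.
  by congr (_ + _); apply: eq_bigr => x /negPf->.
pose G x y z : R := (g x y z)%:R.
have Gxyy x y : G x y y = 0 by rewrite /G triple_rot triplexx.
have Gxxy x y : G x x y = 0 by rewrite /G triplexx.
have Gxyx x y : G x y x = 0 by rewrite /G tripleC23 triplexx.
have GC x y z : G x y z = G x z y by rewrite /G tripleC23.
have del2 x : wsum2 u (G x) = wsum2 t (G x) + 2 * u v * wsum t (G x v).
  rewrite /wsum2 wsum_del (eq_wsum _ (fun y => wsum_del _)) wsumD wsumZ wsum_del Gxyy.
  by rewrite (eq_wsum _ (fun y => GC x y v)); ring.
have degE : deg u v = deg t v.
  rewrite /deg -/(G v) del2 (_ : wsum t (G v v) = 0) ?mulr0 ?addr0 //.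
  by rewrite /wsum big1 // => y _; rewrite Gxxy mulr0.
have TE : wsum3 u G = wsum3 t G + 3 * u v * deg u v.
  rewrite /wsum3 wsum_del (eq_wsum _ (fun x => del2 x)) wsumD wsumZ -/(deg u v).
  have -> : wsum t (fun x => wsum t (G x v)) = deg t v.
    by apply: eq_wsum2 => x y; rewrite /G tripleC12.
  by rewrite -degE; ring.
have IH : wsum3 t G <= 3 / 4 * (\sum_x t x) ^+ 3
    + 9 / 4 * (\sum_x t x) * (\sum_x t x ^+ 2).
  apply: IHm => //; apply: leq_trans supp; apply: proper_card.
  apply/properP; split.
    by apply/fintype.subsetP => x; rewrite !inE /t; case: ifP => //; rewrite eqxx.
  exists v; first by rewrite inE gt_eqF.
  by rewrite inE /t !eqxx.
have p0 : 0 <= \sum_x t x by apply: sumr_ge0.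
have q0 : 0 <= \sum_x t x ^+ 2 by apply: sumr_ge0 => x _; apply: sqr_ge0.
have h := ler_wpM2l (mulr_ge0 (ler0n R 3) (ltW uv)) dv.
rewrite -/G TE; apply: le_trans (lerD IH h) _.
rewrite sumE sqrE.
move: (\sum_x t x) (\sum_x t x ^+ 2) (u v) p0 q0 uv => p q a p0 q0 a0.
have a2 : 0 <= a ^+ 3 by rewrite exprn_ge0 // ltW.
have aq : 0 <= a * q by rewrite mulr_ge0 // ltW.
have pa : 0 <= p * a ^+ 2 by rewrite mulr_ge0 // sqr_ge0.
by lra.
Qed.

End TripleSystems.

(** * Stability of the links *)

Lemma ler_natW (R : numDomainType) (m n : nat) : (m <= n)%N -> m%:R <= n%:R :> R.
Proof. by rewrite ler_nat. Qed.

Lemma natr_andb (R : pzSemiRingType) (p q : bool) :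
  (p && q)%:R = p%:R * q%:R :> R.
Proof. by rewrite -mulnb natrM. Qed.

Section LinkStructure.

Variables (R : realFieldType) (V : finType) (L : 'I_4 -> rel V).
Hypothesis LC : forall i x y, L i x y = L i y x.
Hypothesis L_irr : forall i x, L i x x = false.
Hypothesis L_rainbow : forall i j k x y z t, i != j -> i != k -> j != k ->
  ~~ [&& L i x y, L i z t, L j x z, L j y t, L k x t & L k y z].

Variable u : V -> R.
Hypotheses (u0 : forall x, 0 <= u x) (u1 : \sum_x u x = 1).

Variables d e : R.
Hypotheses (d0 : 0 < d) (d18 : d <= 1 / 18) (ed : e <= d ^+ 4 / 13).
Hypothesis L_dense : forall i, 3 / 4 - e <= wsum2 u (fun x y => (L i x y)%:R).

Local Notation W x y := ((mult L x y)%:R : R).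
Local Notation multC := (multC LC).

Let eps := d ^+ 2.
Let wdeg x := wsum u (fun y => W x y).
Let bad x := wdeg x < 3 - eps.
Let b x : R := (bad x)%:R.

Let eps0 : 0 < eps. Proof. by rewrite exprn_gt0. Qed.
Let eps_le : eps <= 1 / 324.
Proof. by rewrite /eps; have := d0; have := d18; nra. Qed.
Let e_le : 4 * e < eps ^+ 2 / 3.
Proof. by rewrite /eps -exprM; have := ed; have : 0 < d ^+ 4 := exprn_gt0 4 d0; lra. Qed.
Let e_le1 : 4 * e <= eps.
Proof. by have := e_le; have := eps0; have := eps_le; nra. Qed.

Let mult_dense : 3 - 4 * e <= wsum2 u (fun x y => W x y).
Proof.
rewrite wsum2_mult; apply: le_trans (ler_sum _ (fun i _ => L_dense i)).
by rewrite sumr_const card_ord -mulr_natl; lra.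
Qed.

Let mult_sparse : wsum2 u (fun x y => W x y) <= 3.
Proof. by have := wsum2_mult_le LC L_irr L_rainbow u0; rewrite u1; lra. Qed.

(** Otherwise scale the bad vertices down until exactly eps/3 of mass is gone. Their degrees are so
    small that the form drops too little: it stays above 3 |t|^2 by at least eps^2/3 - 4 e > 0. *)
Let bad_le : wsum u b <= eps / 3.
Proof.
rewrite leNgt; apply/negP => xib; set xi := wsum u b in xib.
have xi0 : 0 < xi by apply: lt_trans xib; have := eps0; lra.
pose c := eps / 3 / xi.
have cxi : c * xi = eps / 3 by rewrite /c divfK // gt_eqF.
have c0 : 0 <= c by rewrite /c !divr_ge0 // ltW.
have c1 : c <= 1 by rewrite /c ler_pdivrMr // mul1r ltW.
pose t x := u x * (1 - c * b x).
have t0 x : 0 <= t x.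
  by rewrite mulr_ge0 // subr_ge0 /b; case: (bad x); rewrite ?mulr1 ?mulr0.
have wt f : wsum t f = wsum u f - c * wsum u (fun x => b x * f x).
  by rewrite -wsumZ -wsumB; apply: eq_bigr => x _; rewrite /t; ring.
have tsum : \sum_x t x = 1 - eps / 3.
  transitivity (wsum t (fun=> 1)); first by apply: eq_bigr => x _; rewrite mulr1.
  rewrite wt wsum_cst // -cxi /xi; congr (_ - _ * _).
  by apply: eq_wsum => x; rewrite mulr1.
have := wsum2_mult_le LC L_irr L_rainbow t0; rewrite tsum.
have -> : wsum2 t (fun x y => W x y) = wsum2 u (fun x y => W x y)
    - 2 * c * wsum u (fun x => b x * wdeg x)
    + c ^+ 2 * wsum2 u (fun x y => b x * b y * W x y).
  have e1 x : wsum t (fun y => W x y) = wdeg x - c * wsum u (fun y => b y * W x y).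
    exact: wt.
  have e2 : wsum u (fun x => wsum u (fun y => b y * W x y)) =
      wsum u (fun x => b x * wdeg x).
    rewrite exchange_wsum; apply: eq_wsum => y; rewrite wsumZ.
    by congr (_ * _); apply: eq_wsum => x; rewrite multC.
  have e3 x : b x * (wdeg x - c * wsum u (fun y => b y * W x y)) =
      b x * wdeg x - c * wsum u (fun y => b x * b y * W x y).
    have -> : wsum u (fun y => b x * b y * W x y) = b x * wsum u (fun y => b y * W x y).
      by rewrite -wsumZ; apply: eq_wsum => y; rewrite mulrA.
    by ring.
  rewrite /wsum2 wt (eq_wsum u e1) wsumB wsumZ e2.
  have -> : wsum u (fun x => b x * wsum t (fun y => W x y)) =
      wsum u (fun x => b x * wdeg x - c * wsum u (fun y => b x * b y * W x y)).
    by apply: eq_wsum => x; rewrite e1 e3.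
  by rewrite wsumB wsumZ; ring.
have h1 : wsum u (fun x => b x * wdeg x) <= (3 - eps) * xi.
  rewrite /xi -wsumZ; apply: ler_wsum => // x; rewrite /b.
  case: (boolP (bad x)) => [bx|_]; last by rewrite !(mul0r, mulr0).
  by rewrite mul1r mulr1 ltW.
have h2 : 0 <= wsum2 u (fun x y => b x * b y * W x y).
  by apply: wsum2_ge0 => // x y; rewrite !mulr_ge0.
have := ler_wpM2l c0 h1; rewrite [X in _ <= X]mulrCA cxi => h3.
have h4 := mulr_ge0 (sqr_ge0 c) h2.
have := mult_dense; have := e_le.
lra.
Qed.

Let nbad x : ~~ bad x -> 3 - eps <= wdeg x.
Proof. by rewrite /bad -leNgt. Qed.

Let wdegC x : wsum u (fun v => W v x) = wdeg x.
Proof. by apply: eq_wsum => v; rewrite multC. Qed.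

(** Total 9 towards the triangle forces multiplicity 1 towards x. The resulting pointwise bound
    averages to 4 wdeg x + 3 wdeg y + 3 wdeg z <= 28, against a value close to 30. *)
Let no_triangle11_443 x y z : ~~ bad x -> ~~ bad y -> ~~ bad z ->
  mult L x y = 4%N -> mult L x z = 4%N -> mult L y z = 3%N -> False.
Proof.
move=> /nbad gx /nbad gy /nbad gz xy xz yz.
have h v : W v x <= 28 - 3 * (W v x + W v y + W v z).
  have [h1 h2] := mult_triangle11 LC L_rainbow v xy xz yz.
  have : (mult L v x + 3 * (mult L v x + mult L v y + mult L v z) <= 28)%N.
    by move: h1 h2 (mult_le4 L v x); clear; lia.
  by move=> /(ler_natW R); rewrite !(natrM, natrD); lra.
have := ler_wsum u0 h.
by rewrite wsumB wsumZ !wsumD wsum_cst // !wdegC; have := eps_le; lra.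
Qed.

Let no_triangle11 x y z : ~~ bad x -> ~~ bad y -> ~~ bad z ->
  (mult L x y + mult L x z + mult L y z <= 10)%N.
Proof.
move=> gx gy gz; rewrite leqNgt; apply/negP => h11.
have := (mult_le4 L x y, mult_le4 L x z, mult_le4 L y z); move=> [[lxy lxz] lyz].
have [h12|h12] := leqP 12 (mult L x y + mult L x z + mult L y z).
  have h v : W v x + W v y + W v z <= 8.
    have := mult_K4 L_rainbow x y z v.
    rewrite -!natrD ler_nat (multC v x) (multC v y) (multC v z).
    by move: h12; clear; lia.
  have := ler_wsum u0 h; rewrite !wsumD wsum_cst // !wdegC.
  by have := nbad gx; have := nbad gy; have := nbad gz; have := eps_le; lra.
have [xy|xy] := eqVneq (mult L x y) 3%N.
  by apply: (no_triangle11_443 gz gx gy) => //; rewrite ?(multC z);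
    move: h11 lxy lxz lyz xy; clear; lia.
have [xz|xz] := eqVneq (mult L x z) 3%N.
  by apply: (no_triangle11_443 gy gx gz) => //; rewrite ?(multC y x);
    move: h11 lxy lxz lyz xz; clear; lia.
by apply: (no_triangle11_443 gx gy gz) => //;
  move: h11 h12 lxy lxz lyz xy xz; clear; lia.
Qed.

(** Otherwise nearly all pairs have multiplicity exactly 3. Some colour misses a quarter of all
    pairs, and two independent missed pairs force a pair of low multiplicity among their four
    vertices, so low pairs would have density at least 1/96. *)
Let edge4_exists : exists x y, [/\ ~~ bad x, ~~ bad y & mult L x y = 4%N].
Proof.
have [/existsP[x /existsP[y /and3P[gx gy /eqP xy]]]|none] :=
  boolP [exists x, exists y, [&& ~~ bad x, ~~ bad y & mult L x y == 4%N]].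
  by exists x, y.
have le3 x y : ~~ bad x -> ~~ bad y -> (mult L x y <= 3)%N.
  move=> gx gy; move: none; rewrite negb_exists => /forallP/(_ x).
  rewrite negb_exists => /forallP/(_ y); rewrite gx gy /=.
  by move: (mult_le4 L x y); clear; lia.
pose low x y : R := (mult L x y < 3)%:R.
have low_le : wsum2 u low <= 4 * e + 4 * (eps / 3).
  have h x y : low x y <= 3 - W x y + 2 * (b x + b y).
    have : ((mult L x y < 3) + mult L x y <= 3 + 2 * (bad x + bad y))%N.
      have := mult_le4 L x y; have := @le3 x y.
      move: (mult L x y) (bad x) (bad y); clear => m [] [] /= h1 h2; case: ltnP; lia.
    by move=> /(ler_natW R); rewrite !(natrM, natrD) /low /b; lra.
  apply: le_trans (ler_wsum2 u0 h) _.
  rewrite wsum2D wsum2B wsum2Z wsum2D wsum2_cst // wsum2_fst // wsum2_snd //.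
  by have := mult_dense; have := bad_le; lra.
have [i Li] : exists i, wsum2 u (fun x y => (L i x y)%:R) <= 3 / 4.
  apply/existsP; apply: contraT; rewrite negb_exists => /forallP h.
  have := mult_sparse; rewrite wsum2_mult !big_ord_recl big_ord0.
  move: (h ord0) (h (lift ord0 ord0)) (h (lift ord0 (lift ord0 ord0)))
    (h (lift ord0 (lift ord0 (lift ord0 ord0)))); rewrite -!ltNge; lra.
pose miss x y : R := 1 - (L i x y)%:R.
have miss_ge : 1 / 4 <= wsum2 u miss by rewrite wsum2B wsum2_cst //; lra.
have : wsum2 u miss * wsum2 u miss <= wsum2 u low + wsum2 u low + wsum2 u low
    + wsum2 u low + wsum2 u low + wsum2 u low.
  apply: wsum4_pairs => // x y z t.
  have : (~~ L i x y && ~~ L i z t <= (mult L x y < 3) + (mult L z t < 3)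
      + (mult L x z < 3) + (mult L x t < 3) + (mult L y z < 3) + (mult L y t < 3))%N.
    case: (boolP (L i x y)) => //= xy; case: (boolP (L i z t)) => //= zt.
    have := mult_K4_missing L_rainbow xy zt.
    move: (mult L x y) (mult L x z) (mult L x t) (mult L y z) (mult L y t) (mult L z t).
    by clear => ? ? ? ? ? ?; do 6 (case: ltnP => ? //=); lia.
  move=> /(ler_natW R); rewrite !natrD /miss /low.
  by case: (L i x y); case: (L i z t) => /=; lra.
have := eps_le; have := e_le1; nra.
Qed.

(** Over good x, y joined with multiplicity 4, a good v reaches at most 10 - 4 = 6. The average is
    nearly 6 as well, so few vertices fail. *)
Let good6 x y v := ~~ bad v && (mult L v x + mult L v y == 6)%N.
Let bad6 x y v : R := (~~ good6 x y v)%:R.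

Let bad6_le x y : ~~ bad x -> ~~ bad y -> mult L x y = 4%N ->
  wsum u (bad6 x y) <= 3 * eps.
Proof.
move=> gx gy xy.
have h v : bad6 x y v <= 6 - W v x - W v y + 3 * b v.
  have : (~~ good6 x y v + mult L v x + mult L v y <= 6 + 3 * bad v)%N.
    have := @no_triangle11 x y v gx gy; rewrite xy (multC x v) (multC y v) /good6.
    have := mult_le4 L v x; have := mult_le4 L v y.
    move: (mult L v x) (mult L v y) (bad v); clear => m k [] /=; first by lia.
    by case: eqP => /=; lia.
  by move=> /(ler_natW R); rewrite !(natrM, natrD) /bad6 /b; lra.
apply: le_trans (ler_wsum u0 h) _.
rewrite wsumD !wsumB wsumZ wsum_cst // !wdegC.
by have := nbad gx; have := nbad gy; have := bad_le; lra.
Qed.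

(* x and y become members of opposite parts A and B. *)
Lemma link_structure i : exists I : pred V,
  wsum2 u (fun x y => (L i x y != ~~ (I x && I y))%:R) <= 17 * d /\
  `|wsum u (fun x => (I x)%:R) - 1 / 2| <= 17 * d.
Proof.
have [x [y [gx gy xy]]] := edge4_exists.
(* The total 6 splits as 2 + 4, 4 + 2 or 3 + 3; the last class Z has to be shown small. *)
pose A v := [&& ~~ bad v, mult L v x == 2%N & mult L v y == 4%N].
pose B v := [&& ~~ bad v, mult L v x == 4%N & mult L v y == 2%N].
pose Z v := [&& ~~ bad v, mult L v x == 3%N & mult L v y == 3%N].
pose q v w : R := (A w)%:R * bad6 w y v + (B w)%:R * bad6 x w v.
pose a := wsum u (fun v => (A v)%:R : R).
pose c := wsum u (fun v => (B v)%:R : R).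
pose z := wsum u (fun v => (Z v)%:R : R).
have clsE v : (A v)%:R + (B v)%:R + (Z v)%:R = 1 - bad6 x y v :> R.
  have : (A v + B v + Z v + ~~ good6 x y v = 1)%N.
    have := mult_le4 L v x; have := mult_le4 L v y.
    rewrite /A /B /Z /good6; move: (mult L v x) (mult L v y) (bad v); clear => m k [] //= ? ?; lia.
  by move=> /(congr1 (fun n => n%:R : R)); rewrite !natrD /bad6; lra.
have bad6xy := bad6_le gx gy xy.
have acz : a + c + z = 1 - wsum u (bad6 x y).
  have -> : 1 - wsum u (bad6 x y) = wsum u (fun v => 1 - bad6 x y v).
    by rewrite wsumB wsum_cst.
  by rewrite /a /c /z -!wsumD; apply: eq_wsum.
have q_le : wsum2 u q <= 3 * eps.
  rewrite -wsum2C -[X in _ <= X](wsum_cst u1); apply: ler_wsum => // w.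
  rewrite wsumD !wsumZ.
  have b0 : 0 <= 3 * eps by rewrite mulr_ge0 // ltW.
  case: (boolP (A w)) => [/and3P[gw /eqP wx /eqP wy]|_].
    have -> : B w = false by rewrite /B wx andbF.
    by rewrite mul1r mul0r addr0; apply: bad6_le.
  case: (boolP (B w)) => [/and3P[gw /eqP wx /eqP wy]|_]; last by rewrite !mul0r addr0.
  by rewrite mul1r mul0r add0r; apply: bad6_le; rewrite // multC.
have a0 : 0 <= a by apply: wsum_ge0 => // v; apply: ler0n.
have c0 : 0 <= c by apply: wsum_ge0 => // v; apply: ler0n.
have z0 : 0 <= z by apply: wsum_ge0 => // v; apply: ler0n.
pose n v : R := (A v)%:R + (B v)%:R + (Z v)%:R.
pose k v : R := (A v)%:R - (B v)%:R.
(* Up to errors, the multiplicity is 2 within A and within B, 4 between them, 3 between Z and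
   either, and at most 2 within Z. Comparison with the total density near 3 makes (a - c)^2 + z^2 of
   order eps. *)
have Wle v w : W v w <= 3 * (n v * n w) - k v * k w - (Z v)%:R * (Z w)%:R
    + 4 * (bad6 x y v + bad6 x y w) + 4 * (q v w + q w v).
  have : (mult L v w + (A v && A w) + (B v && B w) + (Z v && Z w)
      <= 3 * (good6 x y v && good6 x y w) + (A v && B w) + (B v && A w)
         + 4 * (~~ good6 x y v + ~~ good6 x y w)
         + 4 * ((A w && ~~ good6 w y v) + (B w && ~~ good6 x w v)
                + (A v && ~~ good6 v y w) + (B v && ~~ good6 x v w)))%N.
    have cls0 t : ~~ good6 x y t -> [/\ A t = false, B t = false & Z t = false].
      rewrite /A /B /Z /good6; case: (bad t) => //=.
      move: (mult L t x) (mult L t y); clear => k l kl.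
      by split; apply/negP => /andP[/eqP ek /eqP el]; rewrite ek el in kl.
    have [gv|gv] := boolP (good6 x y v); last first.
      have [-> -> ->] := cls0 v gv; rewrite /= ?andbF ?addn0 ?add0n.
      apply: leq_trans (mult_le4 L v w) _.
      by rewrite mulnDr muln1 -addnA leq_addr.
    have [gw|gw] := boolP (good6 x y w); last first.
      have [-> -> ->] := cls0 w gw; rewrite /= ?andbF ?addn0 ?add0n.
      apply: leq_trans (mult_le4 L v w) _.
      by rewrite (leq_trans _ (leq_addr _ _)).
    have zz := mult_K4_edge4 L_rainbow xy (z := v) (t := w).
    move: gv gw; rewrite /A /B /Z /good6.
    move=> /andP[/negPf-> /= v6] /andP[/negPf-> /= w6].
    move: zz v6 w6 (mult_le4 L v x) (mult_le4 L v y) (mult_le4 L w x)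
      (mult_le4 L w y) (mult_le4 L v w).
    rewrite (multC w v) (multC x v) (multC x w) (multC y v) (multC y w).
    move: (mult L v w) (mult L v x) (mult L v y) (mult L w x) (mult L w y).
    clear => m vx vy wx wy zz v6 w6 vx4 vy4 wx4 wy4 m4.
    have cls k l : (k + l == 6 -> k <= 4 -> l <= 4 -> [|| (k == 2) && (l == 4),
        (k == 4) && (l == 2) | (k == 3) && (l == 3)])%N by lia.
    move: zz.
    case/or3P: (cls _ _ v6 vx4 vy4) => /andP[/eqP-> /eqP->];
    case/or3P: (cls _ _ w6 wx4 wy4) => /andP[/eqP-> /eqP->] /=; lia.
  have nG t : n t = (good6 x y t)%:R.
    by rewrite /n clsE /bad6; case: (good6 x y t) => /=; lra.
  move=> /(ler_natW R); rewrite !nG !(natrM, natrD).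
  rewrite !(natr_andb _ (A v)) !(natr_andb _ (A w)) !(natr_andb _ (B v)) !(natr_andb _ (B w)).
  rewrite !(natr_andb _ (Z v)) !(natr_andb _ (good6 x y v)) /k /q /bad6; lra.
have nE : wsum u n = a + c + z by rewrite /n !wsumD.
have kE : wsum u k = a - c by rewrite /k wsumB.
clearbody q n k.
have Wtot : wsum2 u (fun v w => W v w) <=
    3 * (a + c + z) ^+ 2 - (a - c) ^+ 2 - z ^+ 2 + 48 * eps.
  apply: le_trans (ler_wsum2 u0 Wle) _.
  rewrite !wsum2D !wsum2Z !wsum2D (wsum2C u q) !wsum2N.
  rewrite !wsum2_prod nE kE -/z wsum2_fst // wsum2_snd //.
  by lra.
have bad60 : 0 <= wsum u (bad6 x y) by apply: wsum_ge0 => // v; apply: ler0n.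
have diff : (a - c) ^+ 2 + z ^+ 2 <= 49 * eps.
  have : (a + c + z) ^+ 2 <= 1 by rewrite acz; nra.
  by have := mult_dense; have := e_le1; lra.
have d7 : 0 <= 7 * d by rewrite mulr_ge0 // ltW.
have z7 : z <= 7 * d.
  rewrite -ler_sqr ?nnegrE // exprMn.
  by have := sqr_ge0 (a - c); rewrite /eps in diff; lra.
have /ler_normlP[ac1 ac2] : `|a - c| <= 7 * d.
  rewrite -ler_sqr ?nnegrE // real_normK ?num_real // exprMn.
  by have := sqr_ge0 z; rewrite /eps in diff; lra.
have epsd : eps <= d / 18 by rewrite /eps; have := d0; have := d18; nra.
have edd : e <= d by have := e_le1; lra.
have aP : `|a - 1 / 2| <= 8 * d by apply/ler_normlP; split; lra.
have cP : `|c - 1 / 2| <= 8 * d by apply/ler_normlP; split; lra.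
pose LR v w : R := (L i v w)%:R.
pose PA := wsum2 u (fun v w => (A v)%:R * (A w)%:R * LR v w).
pose PB := wsum2 u (fun v w => (B v)%:R * (B w)%:R * LR v w).
(* By [mult_K4_cross], an edge of colour i within A and one within B cannot be joined by four pairs
   of multiplicity 4. So one of A and B spans few edges of colour i and serves as I. *)
have PAB : PA * PB <= 12 * eps.
  pose q' v w : R := (A v)%:R * bad6 v y w.
  have q'_le : wsum2 u q' <= 3 * eps.
    rewrite -[X in _ <= X](wsum_cst u1); apply: ler_wsum => // v.
    rewrite wsumZ /q'; case: (boolP (A v)) => [/and3P[gv /eqP vx /eqP vy]|_].
      by rewrite mul1r; apply: bad6_le.
    by rewrite mul0r mulr_ge0 // ltW.
  have : PA * PB <= wsum2 u (fun _ _ => 0) + wsum2 u (fun _ _ => 0)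
      + wsum2 u q' + wsum2 u q' + wsum2 u q' + wsum2 u q'.
    apply: wsum4_pairs => // v v' w w'.
    have : ([&& A v, A v' & L i v v'] && [&& B w, B w' & L i w w'] <=
        (A v && ~~ good6 v y w) + (A v && ~~ good6 v y w')
        + (A v' && ~~ good6 v' y w) + (A v' && ~~ good6 v' y w'))%N.
      case: (boolP (A v)) => // Av; case: (boolP (A v')) => // Av'.
      case: (boolP (L i v v')) => // Lv; case: (boolP (B w)) => // Bw.
      case: (boolP (B w')) => // Bw'; case: (boolP (L i w w')) => // Lw.
      have cross t s : B s -> good6 t y s -> mult L t s = 4%N.
        move=> /and3P[_ _ /eqP sy] /andP[_]; rewrite sy (multC t s).
        by move: (mult L s t); clear => m; lia.
      have := mult_K4_cross L_rainbow (i := i) (x := v) (y := v') (z := w) (t := w').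
      case: (boolP (good6 v y w)) => // /(cross _ _ Bw)-> /(_ erefl).
      case: (boolP (good6 v y w')) => // /(cross _ _ Bw')-> /(_ erefl).
      case: (boolP (good6 v' y w)) => // /(cross _ _ Bw)-> /(_ erefl).
      case: (boolP (good6 v' y w')) => // /(cross _ _ Bw')-> /(_ erefl).
      by move=> /(_ Lv); rewrite Lw.
    move=> /(ler_natW R).
    rewrite !(natrM, natrD) (natr_andb _ [&& A v, _ & _]) !(natr_andb _ (A v)).
    rewrite !(natr_andb _ (A v')) (natr_andb _ (B w)) (natr_andb _ (B w')).
    by rewrite /q' /bad6 /LR; lra.
  by rewrite wsum2_cst //; lra.
have main (I : pred V) : `|wsum u (fun v => (I v)%:R) - 1 / 2| <= 8 * d ->
    wsum2 u (fun v w => (I v)%:R * (I w)%:R * LR v w) <= 4 * d ->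
    exists I : pred V,
      wsum2 u (fun x y => (L i x y != ~~ (I x && I y))%:R) <= 17 * d /\
      `|wsum u (fun x => (I x)%:R) - 1 / 2| <= 17 * d.
  move=> Ih PI; exists I; split; last by apply: le_trans Ih _; have := d0; lra.
  have h v w : (L i v w != ~~ (I v && I w))%:R =
      1 - LR v w - (I v)%:R * (I w)%:R + 2 * ((I v)%:R * (I w)%:R * LR v w) :> R.
    by rewrite /LR; case: (L i v w); case: (I v); case: (I w) => /=; lra.
  rewrite (eq_wsum2 u h) wsum2D !wsum2B wsum2Z wsum2_cst // wsum2_prod.
  have := L_dense i; rewrite -/LR; move: Ih PI => /ler_normlP[].
  by have := d18; have := d0; nra.
have [PA4|PA4] := lerP PA (4 * d); first exact: main aP PA4.
have [PB4|PB4] := lerP PB (4 * d); first exact: main cP PB4.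
have d4 : 0 <= 4 * d by rewrite mulr_ge0 // ltW.
have := ler_pM d4 d4 (ltW PA4) (ltW PB4).
by rewrite /eps in PAB *; have := eps0; rewrite /eps; lra.
Qed.

End LinkStructure.

(** * Large minimum degree *)

Section MinDegree.

Variables (R : realFieldType) (V : finType) (g : V -> V -> V -> bool).
Hypotheses (gS : triple_system g) (gF : fano_hom_free g).
Variable u : V -> R.
Hypotheses (u_gt0 : forall x, 0 < u x) (u1 : \sum_x u x = 1).
Variables d e : R.
Hypotheses (d0 : 0 < d) (d_le : 17 * d <= (1 / 150) ^+ 4 / 40).
Hypothesis (ed : e <= d ^+ 4 / 13).
Hypothesis g_dense : forall v, 3 / 4 - e <= deg g u v.

Let u0 x : 0 <= u x. Proof. exact: ltW. Qed.
Let d18 : d <= 1 / 18. Proof. by have := d_le; lra. Qed.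
Let e_le : e <= 1 / 100.
Proof.
have d1 : d <= 1 by have := d18; lra.
have d4 : d ^+ 4 <= d by rewrite exprSr ler_piMl ?(ltW d0) // exprn_ile1 ?(ltW d0).
by have := ed; have := d18; lra.
Qed.

Let eta := 17 * d.

(** A K4 through v makes the link of v the first of the four colours. *)
Let link_set : exists I : V -> pred V, forall v,
  wsum2 u (fun x y => (g v x y != ~~ (I v x && I v y))%:R) <= eta /\
  `|wsum u (fun x => (I v x)%:R) - 1 / 2| <= eta.
Proof.
have := @fin_all_exists V (fun _ => pred V)
  (fun v I => wsum2 u (fun x y => (g v x y != ~~ (I x && I y))%:R) <= eta /\
  `|wsum u (fun x => (I x)%:R) - 1 / 2| <= eta).
apply => v.
have [||x [y [z [/(K4_vertexP gS) K _]]]] := K4_exists gS (v := v) u0 u1 _ (fun x _ => g_dense x).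
- by have := e_le; lra.
- exact: u_gt0.
set s := (fun i : 'I_4 => _) in K.
have dense i : 3 / 4 - e <= wsum2 u (fun x y => (link g s i x y)%:R) by apply: g_dense.
have [J hJ] := link_structure (linkC gS s) (link_irr gS s)
  (link_rainbow gS gF K) u0 u1 d0 d18 ed dense ord0.
by exists J.
Qed.

Section Partition.

Variable I : V -> pred V.
Hypothesis I_err : forall v,
  wsum2 u (fun x y => (g v x y != ~~ (I v x && I v y))%:R) <= eta.
Hypothesis I_half : forall v, `|wsum u (fun x => (I v x)%:R) - 1 / 2| <= eta.

Let err v x y : R := (g v x y != ~~ (I v x && I v y))%:R.
Let eta0 : 0 < eta. Proof. by rewrite mulr_gt0. Qed.

Let eta_le : eta <= 1 / 4000.
Proof. by rewrite /eta; have := d_le; lra. Qed.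

(** [I_err] controls a link by its own centre; here w is an ordinary point of the links of others,
    which is only controlled on average. *)
Let typical_vertex : exists w, wsum2 u (fun x y => err x w y) < 2 * eta.
Proof.
apply: (@wsum_ltW_ex _ _ u u0 _ (fun=> 2 * eta)).
rewrite wsum_cst // -exchange_wsum; apply: (@le_lt_trans _ _ eta).
  by rewrite -[X in _ <= X](wsum_cst u1); apply: ler_wsum => // x; apply: I_err.
by have := eta0; lra.
Qed.

Section Halves.

Variable w : V.
Hypothesis w_err : wsum2 u (fun x y => err x w y) < 2 * eta.

Let A x := I w x.
Let a := wsum u (fun x => (A x)%:R : R).
Let m x y z : R := (A x)%:R * (~~ A y)%:R * (~~ g x y z)%:R.

Let a_half : 1 / 2 - eta <= a <= 1 / 2 + eta.
Proof. by have /ler_normlP[h1 h2] := I_half w; rewrite /a; apply/andP; split; lra. Qed.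

Let wsum_notA : wsum u (fun x => (~~ A x)%:R) = 1 - a.
Proof.
rewrite /a -[X in X - _](wsum_cst u1) -wsumB; apply: eq_wsum => x.
by case: (A x) => /=; lra.
Qed.

(** For x and y in A the triple w x y is mostly absent, so in the link of x the pair w, y is missing
    and y lies in I x. As both sets have about half of the mass, I x is nearly A, and triples with x
    in A and y outside A are mostly present. *)
Let cross_miss : wsum3 u m <= 6 * eta.
Proof.
pose D x y : R := (I x y)%:R.
have h1 x y : (A x)%:R * (A y)%:R * (1 - D x y) <= err w x y + err x w y.
  rewrite /D /err /A (tripleC12 gS x w).
  by case: (g w x y); case: (I w x); case: (I w y); case: (I x w); case: (I x y) => /=; lra.
have AAD : wsum2 u (fun x y => (A x)%:R * (A y)%:R * (1 - D x y)) <= 3 * eta.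
  apply: le_trans (ler_wsum2 u0 h1) _; rewrite wsum2D.
  by have := I_err w; have := w_err; rewrite -/err /err; lra.
have split x y : (A x)%:R * (A y)%:R * (1 - D x y) =
    (A x)%:R * (A y)%:R - (A x)%:R * D x y + (A x)%:R * (~~ A y)%:R * D x y.
  by case: (A y) => /=; ring.
have AD : wsum2 u (fun x y => (A x)%:R * D x y) <= a * (1 / 2 + eta).
  rewrite /a -wsumZr; apply: ler_wsum => // x; rewrite wsumZ ler_wpM2l //.
  by have /ler_normlP[_] := I_half x; rewrite /D; lra.
have AnD : wsum2 u (fun x y => (A x)%:R * (~~ A y)%:R * D x y) <= 5 * eta.
  move: AAD; rewrite (eq_wsum2 u split) !wsum2D wsum2N wsum2_prod -/a.
  by have /andP[] := a_half; have := eta0; have := eta_le; nra.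
have h x y z : m x y z <= err x y z + (A x)%:R * (~~ A y)%:R * D x y.
  rewrite /m /err /D; case: (A x); case: (A y); case: (g x y z); case: (I x y);
    case: (I x z) => /=; lra.
apply: le_trans (ler_wsum3 u0 h) _.
have -> : wsum3 u (fun x y z => err x y z + (A x)%:R * (~~ A y)%:R * D x y) =
    wsum u (fun x => wsum2 u (err x)) +
    wsum2 u (fun x y => (A x)%:R * (~~ A y)%:R * D x y).
  by rewrite -wsumD; apply: eq_wsum => x; rewrite wsum2D wsum2_fst.
suff : wsum u (fun x => wsum2 u (err x)) <= eta by lra.
by rewrite -[X in _ <= X](wsum_cst u1); apply: ler_wsum => // x; apply: I_err.
Qed.

Let p v := wsum u (fun x => (A x && ~~ I v x)%:R : R).
Let q v := wsum u (fun x => (~~ A x && ~~ I v x)%:R : R).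

Let p0 v : 0 <= p v. Proof. by apply: wsum_ge0 => // x; apply: ler0n. Qed.
Let q0 v : 0 <= q v. Proof. by apply: wsum_ge0 => // x; apply: ler0n. Qed.

(** Otherwise take pairs in A and in its complement that avoid I v, and any pair in the link of v:
    the crossing triples complete them to a Fano plane. In numbers, (1/150)^4 * 37/50 <= 26 eta,
    against 40 eta <= (1/150)^4. *)
Let p_or_q_small v : p v < 1 / 150 \/ q v < 1 / 150.
Proof.
have [pv|pv] := ltrP (p v) (1 / 150); first by left.
have [qv|qv] := ltrP (q v) (1 / 150); first by right.
pose P x y : R := (A x && ~~ I v x)%:R * (A y && ~~ I v y)%:R.
pose Q x y : R := (~~ A x && ~~ I v x)%:R * (~~ A y && ~~ I v y)%:R.
have : wsum2 u P * wsum2 u Q * deg g u v <=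
    wsum2 u (err v) + wsum2 u (err v) + 4 * wsum3 u m.
  apply: wsum6_octahedron => // x1 x2 y1 y2 z1 z2.
  rewrite /P /Q -!natr_andb.
  have [/andP[/andP[/andP[/andP[Ax1 Ix1] /andP[Ax2 Ix2]] /andP[/andP[Ay1 Iy1]
    /andP[Ay2 Iy2]]] gz]|_] := boolP (_ && _); last first.
    by rewrite !addr_ge0 // !mulr_ge0.
  have := gF v x1 x2 y1 y2 z1 z2; rewrite /err /m gz.
  rewrite (negPf Ix1) (negPf Iy1) Ax1 Ax2 (negPf Ay1) (negPf Ay2) !mul1r /=.
  case: (g v x1 x2); case: (g v y1 y2); case: (g x1 y1 z1); case: (g x1 y2 z2);
    case: (g x2 y1 z2); case: (g x2 y2 z1) => //= _; lra.
have PE : wsum2 u P = p v ^+ 2 by rewrite wsum2_prod expr2.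
have QE : wsum2 u Q = q v ^+ 2 by rewrite wsum2_prod expr2.
rewrite PE QE => h.
have h1 : (1 / 150) ^+ 4 <= p v ^+ 2 * q v ^+ 2.
  rewrite (_ : (1 / 150) ^+ 4 = (1 / 150) ^+ 2 * (1 / 150) ^+ 2); last by ring.
  by apply: ler_pM; rewrite ?sqr_ge0 // ler_pXn2r ?nnegrE //; lra.
have h2 : (1 / 150) ^+ 4 * (37 / 50) <= p v ^+ 2 * q v ^+ 2 * deg g u v.
  apply: ler_pM => //; first by rewrite exprn_ge0 //; lra.
    by lra.
  by have := g_dense v; have := e_le; lra.
have := I_err v; rewrite -/(err v).
have : 0 < (1 / 150 : R) ^+ 4 by rewrite exprn_gt0 //; lra.
by have := cross_miss; rewrite /eta in h *; have := d_le; lra.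
Qed.

Let theta := 1 / 150 + 3 * eta.

Let A_dense_of v : q v < 1 / 150 ->
  wsum2 u (fun x y => (A x && A y && ~~ g v x y)%:R) <= theta.
Proof.
move=> qv; have h x y : (A x && A y && ~~ g v x y)%:R <= err v x y + (A x && I v x)%:R.
  by rewrite /err; case: (A x); case: (A y); case: (g v x y); case: (I v x); case: (I v y) => /=; lra.
apply: le_trans (ler_wsum2 u0 h) _; rewrite wsum2D wsum2_fst //.
have -> : wsum u (fun x => (A x && I v x)%:R) = wsum u (fun x => (I v x)%:R) - (1 - a) + q v.
  rewrite -wsum_notA -wsumB -wsumD; apply: eq_wsum => x.
  by case: (A x); case: (I v x) => /=; lra.
have := I_err v; have /ler_normlP[_ h2] := I_half v; have /andP[h3 h4] := a_half.
by rewrite -/(err v) /theta; lra.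
Qed.

Let nA_dense_of v : p v < 1 / 150 ->
  wsum2 u (fun x y => (~~ A x && ~~ A y && ~~ g v x y)%:R) <= theta.
Proof.
move=> pv; have h x y : (~~ A x && ~~ A y && ~~ g v x y)%:R <= err v x y + (~~ A x && I v x)%:R.
  by rewrite /err; case: (A x); case: (A y); case: (g v x y); case: (I v x); case: (I v y) => /=; lra.
apply: le_trans (ler_wsum2 u0 h) _; rewrite wsum2D wsum2_fst //.
have -> : wsum u (fun x => (~~ A x && I v x)%:R) = wsum u (fun x => (I v x)%:R) - a + p v.
  rewrite /a -wsumB -wsumD; apply: eq_wsum => x.
  by case: (A x); case: (I v x) => /=; lra.
have := I_err v; have /ler_normlP[_ h2] := I_half v; have /andP[h3 h4] := a_half.
by rewrite -/(err v) /theta; lra.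
Qed.

(** Four vertices of S have three matchings; if the links of v, w', z contain one each, the line v
    w' z completes a Fano plane. The value 1/150 is small enough for 6 theta < (24/100)^2. *)
Let no_edge_of (S : pred V) v w' z : 49 / 100 <= wsum u (fun x => (S x)%:R) ->
  (forall t, t \in [:: v; w'; z] ->
     wsum2 u (fun x y => (S x && S y && ~~ g t x y)%:R) <= theta) ->
  g v w' z = false.
Proof.
move=> Shalf dense; apply/negP => vwz.
pose n t x y : R := (S x && S y && ~~ g t x y)%:R.
pose P x y : R := (S x)%:R * (S y)%:R.
have : wsum2 u P * wsum2 u P <= wsum2 u (n v) + wsum2 u (n v) + wsum2 u (n w')
    + wsum2 u (n z) + wsum2 u (n z) + wsum2 u (n w').
  apply: wsum4_pairs => // x1 x2 x3 x4; rewrite /P /n.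
  rewrite -!natr_andb.
  have [/andP[/andP[-> ->] /andP[-> ->]]|_] := boolP (_ && _); last first.
    by rewrite !addr_ge0.
  have := gF x1 v x2 w' x3 z x4; rewrite vwz !(tripleC12 gS x1).
  rewrite (tripleC12 gS x2 w') (triple_rot gS x2 x3 z) (triple_rot gS x3 z x2).
  case: (g v x1 x2); case: (g v x3 x4); case: (g w' x1 x3); case: (g w' x2 x4);
  case: (g z x1 x4); case: (g z x2 x3) => //= _; lra.
have dv : wsum2 u (n v) <= theta by apply: dense; rewrite !inE eqxx.
have dw : wsum2 u (n w') <= theta by apply: dense; rewrite !inE eqxx orbT.
have dz : wsum2 u (n z) <= theta by apply: dense; rewrite !inE eqxx !orbT.
rewrite wsum2_prod; set s := wsum u _ in Shalf *.
have s2 : 24 / 100 <= s * s by nra.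
have c0 : 0 <= 24 / 100 :> R by lra.
have := ler_pM c0 c0 s2 s2; rewrite /theta in dv dw dz.
by have := eta_le; lra.
Qed.

Lemma bicolouring_of_typical : exists C : pred V, forall x y z,
  g x y z -> ~~ ((C x == C y) && (C y == C z)).
Proof.
exists (fun v => p v < 1 / 150) => x y z; apply: contraTN => /andP[/eqP xy /eqP yz].
have [pz|/negPf pz] := boolP (p z < 1 / 150); rewrite pz in yz xy.
  rewrite (no_edge_of (S := fun v => ~~ A v)) //.
    by rewrite wsum_notA; have /andP[] := a_half; have := eta_le; lra.
  by move=> t; rewrite !inE => /or3P[] /eqP->; apply: nA_dense_of; rewrite ?xy ?yz.
rewrite (no_edge_of (S := A)) //.
  by rewrite -/a; have /andP[] := a_half; have := eta_le; lra.
have qP v : (p v < 1 / 150) = false -> q v < 1 / 150.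
  by have [->|] := p_or_q_small v.
by move=> t; rewrite !inE => /or3P[] /eqP->; apply: A_dense_of; apply: qP; rewrite ?xy ?yz.
Qed.

End Halves.

Lemma bicolouring_of_links : exists C : pred V, forall x y z,
  g x y z -> ~~ ((C x == C y) && (C y == C z)).
Proof.
by have [w w_err] := typical_vertex; exact: (bicolouring_of_typical w_err).
Qed.

End Partition.

Lemma min_degree_bicolouring_aux : exists C : pred V, forall x y z,
  g x y z -> ~~ ((C x == C y) && (C y == C z)).
Proof.
have [I hI] := link_set.
by apply: (@bicolouring_of_links I) => v; have [] := hI v.
Qed.

End MinDegree.

(** The constant e precedes the vertex type because the lemma is applied to induced subsystems. *)
Lemma min_degree_bicolouring (R : realFieldType) : exists2 e : R, 0 < e &
  forall (V : finType) (g : V -> V -> V -> bool) (u : V -> R),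
  triple_system g -> fano_hom_free g -> (forall x, 0 < u x) -> \sum_x u x = 1 ->
  (forall v, 3 / 4 - e <= deg g u v) ->
  exists C : pred V, forall x y z, g x y z -> ~~ ((C x == C y) && (C y == C z)).
Proof.
(* Makes the link error 17 d equal to the tolerance (1/150)^4 / 40. *)
pose d : R := (1 / 150) ^+ 4 / 40 / 17.
have d0 : 0 < d by rewrite !divr_gt0 // exprn_gt0 // divr_gt0.
exists (d ^+ 4 / 13) => [|V g u gS gF u0 u1 g_dense].
  by rewrite divr_gt0 // exprn_gt0.
apply: (min_degree_bicolouring_aux gS gF u0 u1 d0 _ _ g_dense) => //.
by rewrite /d mulrC divfK ?pnatr_eq0.
Qed.

(** * Spectral bounds for bipartite systems *)

Section CubicForm.

Variables (R : realFieldType) (V : finType) (g : V -> V -> V -> bool).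
Hypothesis gS : triple_system g.
Implicit Types x y : V -> R.

Definition cubic_form y : R :=
  \sum_i \sum_j \sum_k (g i j k)%:R * (y i ^+ 3 + y i * y j * y k).

(* The moduli of an eigenvector of Q for lambda satisfy this with c = 2 |lambda|; the factor 2
   comes from summing over ordered pairs. *)
Definition subeigen (c : R) y : Prop :=
  forall i, c * y i ^+ 2 <= \sum_j \sum_k (g i j k)%:R * (y i ^+ 2 + y j * y k).

(** Twice the Collatz-Wielandt quotient of the signless Laplacian at i. *)
Definition ratio x i : R :=
  \sum_j \sum_k (g i j k)%:R * (1 + x j * x k / x i ^+ 2).

Lemma sum_triple_sym (F : V -> V -> V -> R) :
  \sum_i \sum_j \sum_k (g i j k)%:R * F j i k =
  \sum_i \sum_j \sum_k (g i j k)%:R * F i j k.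
Proof.
rewrite exchange_big; apply: eq_bigr => i _; apply: eq_bigr => j _.
by apply: eq_bigr => k _; rewrite (tripleC12 gS).
Qed.

Lemma sum_triple_sym23 (F : V -> V -> V -> R) :
  \sum_i \sum_j \sum_k (g i j k)%:R * F i k j =
  \sum_i \sum_j \sum_k (g i j k)%:R * F i j k.
Proof.
apply: eq_bigr => i _; rewrite exchange_big; apply: eq_bigr => j _.
by apply: eq_bigr => k _; rewrite (tripleC23 gS).
Qed.

Lemma amgm3 (a b c : R) : 0 <= a -> 0 <= b -> 0 <= c ->
  a * b * c <= (a ^+ 3 + b ^+ 3 + c ^+ 3) / 3.
Proof.
move=> a0 b0 c0; rewrite ler_pdivlMr // -subr_ge0.
have -> : a ^+ 3 + b ^+ 3 + c ^+ 3 - a * b * c * 3 =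
  (a + b + c) * ((a - b) ^+ 2 + (a - c) ^+ 2 + (b - c) ^+ 2) / 2 by field.
by rewrite divr_ge0 // mulr_ge0 ?addr_ge0 ?sqr_ge0.
Qed.

(** AM-GM for y_i / x_i, y_j / x_j, y_k / x_k, scaled by x_i x_j x_k; the symmetry of g collects the
    three cubes at one index. *)
Lemma cubic_form_le x y : (forall i, 0 < x i) -> (forall i, 0 <= y i) ->
  cubic_form y <= \sum_i y i ^+ 3 * ratio x i.
Proof.
move=> x0 y0; pose q i := (y i / x i) ^+ 3; pose X i j k := x i * x j * x k.
have h i j k : (g i j k)%:R * (y i ^+ 3 + y i * y j * y k) <=
    (g i j k)%:R * (y i ^+ 3 + X i j k * q i / 3)
    + (g i j k)%:R * (X j i k * q j / 3) + (g i j k)%:R * (X k j i * q k / 3).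
  rewrite -!mulrDr ler_wpM2l // -!addrA lerD2l.
  have := @amgm3 (y i / x i) (y j / x j) (y k / x k).
  rewrite !divr_ge0 ?(ltW (x0 _)) ?y0 // => /(_ isT isT isT).
  have X0 : 0 < X i j k by rewrite !mulr_gt0.
  move=> /(ler_wpM2l (ltW X0)).
  have -> : X i j k * (y i / x i * (y j / x j) * (y k / x k)) = y i * y j * y k.
    by rewrite /X; field; rewrite !gt_eqF.
  by rewrite /X /q; lra.
have qE i j k : X i j k * q i = y i ^+ 3 * (x j * x k / x i ^+ 2).
  by rewrite /X /q; field; rewrite gt_eqF.
apply: (@le_trans _ _ (\sum_i \sum_j \sum_k ((g i j k)%:R * (y i ^+ 3 + X i j k * q i / 3)
    + (g i j k)%:R * (X j i k * q j / 3) + (g i j k)%:R * (X k j i * q k / 3)))).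
  by do 3 (apply: ler_sum => ? _); apply: h.
have -> : \sum_i \sum_j \sum_k ((g i j k)%:R * (y i ^+ 3 + X i j k * q i / 3)
    + (g i j k)%:R * (X j i k * q j / 3) + (g i j k)%:R * (X k j i * q k / 3)) =
  \sum_i \sum_j \sum_k (g i j k)%:R * (y i ^+ 3 + X i j k * q i / 3)
  + \sum_i \sum_j \sum_k (g i j k)%:R * (X j i k * q j / 3)
  + \sum_i \sum_j \sum_k (g i j k)%:R * (X k j i * q k / 3).
  rewrite -!big_split; apply: eq_bigr => i _; rewrite -!big_split.
  by apply: eq_bigr => j _; rewrite -!big_split.
rewrite (sum_triple_sym (fun i j k => X i j k * q i / 3)).
rewrite (sum_triple_sym23 (fun i j k => X j k i * q j / 3)).
rewrite (sum_triple_sym (fun i j k => X i k j * q i / 3)).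
rewrite le_eqVlt; apply/orP; left; apply/eqP.
rewrite -!big_split; apply: eq_bigr => i _; rewrite -!big_split mulr_sumr.
apply: eq_bigr => j _; rewrite -!big_split mulr_sumr; apply: eq_bigr => k _ /=.
have -> : X i k j = X i j k by rewrite /X mulrAC.
by rewrite qE; move: (x j * x k / x i ^+ 2) => t; field.
Qed.

Lemma subeigen_cubic c y : (forall i, 0 <= y i) -> subeigen c y ->
  c * \sum_i y i ^+ 3 <= cubic_form y.
Proof.
move=> y0 yc; rewrite mulr_sumr; apply: ler_sum => i _.
have -> : c * y i ^+ 3 = y i * (c * y i ^+ 2) by ring.
apply: le_trans (ler_wpM2l (y0 i) (yc i)) _; rewrite mulr_sumr; apply: ler_sum => j _.
rewrite mulr_sumr le_eqVlt; apply/orP; left; apply/eqP; apply: eq_bigr => k _; ring.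
Qed.

Lemma subeigen_ratio_le c m x y : (forall i, 0 < x i) -> (forall i, 0 <= y i) ->
  (exists i, y i != 0) -> subeigen c y -> (forall i, ratio x i <= m) -> c <= m.
Proof.
move=> x0 y0 [i0 yi0] yc xm.
have Y0 : 0 < \sum_i y i ^+ 3.
  rewrite (bigD1 i0) //= ltr_pwDl ?sumr_ge0 // => [|i _]; last by rewrite exprn_ge0.
  by rewrite exprn_gt0 // lt_neqAle eq_sym yi0 y0.
rewrite -(ler_pM2r Y0); apply: le_trans (subeigen_cubic y0 yc) _.
apply: le_trans (cubic_form_le x0 y0) _; rewrite mulr_sumr; apply: ler_sum => i _.
by rewrite mulrC ler_wpM2r // exprn_ge0.
Qed.

End CubicForm.

Lemma ratio_subset (R : realFieldType) (V : finType) (g h : V -> V -> V -> bool) (x : V -> R) i :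
  (forall j, 0 <= x j) -> (forall i j k, g i j k -> h i j k) -> ratio g x i <= ratio h x i.
Proof.
move=> x0 gh; do 2 (apply: ler_sum => ? _); rewrite ler_wpM2r //.
  by rewrite addr_ge0 // divr_ge0 ?mulr_ge0 ?sqr_ge0.
by rewrite ler_nat; case: (boolP (g _ _ _)) => // /gh ->.
Qed.

Section Bipartite.

Variables (R : realFieldType) (V : finType).

(** Near a = b and for large sizes, r agrees to leading order with the quotient of entries that
    equalizes the ratios of the two classes. It is inverted by exchanging a and b, so one bound
    serves both classes. The inequality on a - b holds for integers. *)
Lemma bipartite_ratio_le (a b r : R) : 0 <= a -> 0 <= b -> 16 <= a + b ->
  a - b <= (a - b) ^+ 2 -> r = (3 * a + b + 2) / (a + 3 * b + 2) ->
  2 * (a - 1) * b * (1 + r) + b * (b - 1) * (1 + r ^+ 2) <=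
  3 / 2 * (a + b) ^+ 2 - 3 * (a + b) - (a - b) ^+ 2 / 4.
Proof.
move=> a0 b0 ab16 ab ->; set D := a + 3 * b + 2; set C := 3 * a + b + 2.
have D0 : 0 < D by rewrite /D; lra.
rewrite -subr_ge0 -(pmulr_rge0 _ (exprn_gt0 2 D0)).
have -> : D ^+ 2 * (3 / 2 * (a + b) ^+ 2 - 3 * (a + b) - (a - b) ^+ 2 / 4 -
    (2 * (a - 1) * b * (1 + C / D) + b * (b - 1) * (1 + (C / D) ^+ 2))) =
    (a - b) ^+ 2 * (5 / 4 * a ^+ 2 + 11 / 2 * a * b + 5 / 4 * b ^+ 2 + 6 * b + 2 * a)
    - (a - b) * (17 * b + 7 * a + 12).
  by rewrite /C /D; field; rewrite -/D gt_eqF.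
have s0 : 0 <= 17 * b + 7 * a + 12 by lra.
have := ler_wpM2r s0 ab; rewrite subr_ge0 => /le_trans; apply.
rewrite ler_wpM2l ?sqr_ge0 //; have := mulr_ge0 a0 b0; nra.
Qed.

Variables (A B : pred V).
Hypothesis AB : forall v, ~~ (A v && B v).

Definition bicomplete i j k :=
  [&& [&& A i || B i, A j || B j & A k || B k],
      ~~ [&& A i, A j & A k], ~~ [&& B i, B j & B k] & [&& i != j, i != k & j != k]].

Lemma bicomplete_ratio (x : V -> R) (s r : R) i : A i -> 0 < s ->
  (forall j, A j -> x j = s) -> (forall j, B j -> x j = s * r) ->
  ratio bicomplete x i = 2 * (#|A|%:R - 1) * #|B|%:R * (1 + r)
     + #|B|%:R * (#|B|%:R - 1) * (1 + r ^+ 2).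
Proof.
move=> Ai s0 sA sB; pose x' j := x j / s.
have xA j : A j -> x' j = 1 by move=> /sA; rewrite /x' => ->; rewrite divff ?gt_eqF.
have xB j : B j -> x' j = r.
  by move=> /sB; rewrite /x' => ->; rewrite mulrC mulKf ?gt_eqF.
pose a' j : R := (A j && (j != i))%:R; pose b j : R := (B j)%:R.
have sumP (P : pred V) : \sum_j (P j)%:R = #|P|%:R :> R.
  rewrite -sum1_card natr_sum [RHS]big_mkcond; apply: eq_bigr => j _.
  by rewrite -topredE /=; case: (P j).
have sa : \sum_j a' j = #|A|%:R - 1.
  have e : \sum_j (A j)%:R = #|A|%:R :> R by apply: sumP.
  rewrite -e [X in _ = X - _](bigD1 i) //= Ai addrAC subrr add0r.
  rewrite (bigD1 i) //= /a' eqxx andbF add0r.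
  by apply: eq_bigr => j ->; rewrite andbT.
have sb : \sum_j b j = #|B|%:R by apply: sumP.
pose F j k := (1 + r) * (a' j * b k) + (1 + r) * (b j * a' k)
  + (1 + r ^+ 2) * (b j * b k - (j == k)%:R * b j).
have h j k : (bicomplete i j k)%:R * (1 + x j * x k / x i ^+ 2) = F j k.
  have -> : x j * x k / x i ^+ 2 = x' j * x' k.
    by rewrite /x' (sA i) //; field; rewrite gt_eqF.
  have nBi : B i = false by have := AB i; rewrite Ai /= => /negPf.
  rewrite /F /a' /b /bicomplete Ai nBi ![i == _]eq_sym.
  have := xA j; have := xB j; have := xA k; have := xB k.
  have := AB j; have := AB k.
  have [->|ji] := eqVneq j i.
    by rewrite Ai nBi eq_sym /= !andbF; case: (k == i); rewrite ?andbF /=; lra.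
  have [->|ki] := eqVneq k i.
    by rewrite Ai nBi (negPf ji) /= !andbF /=; lra.
  have [<-|jk] := eqVneq j k.
    by rewrite !andbF /=; case: (A j); case: (B j) => //=; lra.
  rewrite !andbT; case: (A j); case: (B j) => //=; case: (A k); case: (B k) => //=;
    move=> _ _ h1 h2 h3 h4;
    rewrite ?(h1 isT) ?(h2 isT) ?(h3 isT) ?(h4 isT); lra.
have -> : ratio bicomplete x i = \sum_j \sum_k F j k.
  by do 2 (apply: eq_bigr => ? _).
have e1 (p q : V -> R) : \sum_j \sum_k p j * q k = (\sum_j p j) * (\sum_k q k).
  by rewrite mulr_suml; apply: eq_bigr => j _; rewrite mulr_sumr.
have e2 : \sum_j \sum_k (j == k)%:R * b j = \sum_j b j.
  apply: eq_bigr => j _; rewrite (bigD1 j) //= eqxx mul1r big1 ?addr0 // => k /negPf kj.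
  by rewrite eq_sym kj mul0r.
have -> : \sum_j \sum_k F j k = (1 + r) * (\sum_j \sum_k a' j * b k)
   + (1 + r) * (\sum_j \sum_k b j * a' k)
   + (1 + r ^+ 2) * (\sum_j \sum_k b j * b k - \sum_j \sum_k (j == k)%:R * b j).
  rewrite -sumrB !mulr_sumr -!big_split; apply: eq_bigr => j _ /=.
  by rewrite -sumrB !mulr_sumr -!big_split.
by rewrite e2 !e1 sa sb; lra.
Qed.

Lemma sub_bicomplete g : triple_system g ->
  (forall i j k, g i j k ->
     [&& A i || B i, ~~ [&& A i, A j & A k] & ~~ [&& B i, B j & B k]]) ->
  forall i j k, g i j k -> bicomplete i j k.
Proof.
move=> gS gAB i j k gijk; have gj : g j i k by rewrite (tripleC12 gS).
have gk : g k i j by rewrite (triple_rot gS).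
have ij : i != j by apply: contraTneq gijk => ->; rewrite triplexx.
have ik : i != k by apply: contraTneq gk => <-; rewrite triplexx.
have jk : j != k by apply: contraTneq gijk => ->; rewrite (triple_rot gS) triplexx.
have /and3P[h1 n1 n2] := gAB _ _ _ gijk.
have /and3P[h2 _ _] := gAB _ _ _ gj; have /and3P[h3 _ _] := gAB _ _ _ gk.
by rewrite /bicomplete h1 h2 h3 n1 n2 ij ik jk.
Qed.

Lemma bipartite_ratio_le_pred g (x : V -> R) (s r : R) i : triple_system g ->
  (forall j, 0 < x j) ->
  (forall i j k, g i j k ->
     [&& A i || B i, ~~ [&& A i, A j & A k] & ~~ [&& B i, B j & B k]]) ->
  A i -> 0 < s -> (forall j, A j -> x j = s) -> (forall j, B j -> x j = s * r) ->
  (16 <= #|A| + #|B|)%N ->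
  r = (3 * #|A|%:R + #|B|%:R + 2) / (#|A|%:R + 3 * #|B|%:R + 2) ->
  ratio g x i <= 3 / 2 * (#|A| + #|B|)%:R ^+ 2 - 3 * (#|A| + #|B|)%:R
    - (#|A|%:R - #|B|%:R) ^+ 2 / 4.
Proof.
move=> gS x0 gAB Ai s0 xA xB n16 rE.
have := sub_bicomplete gS gAB; move/(ratio_subset i (fun j => ltW (x0 j))).
rewrite (bicomplete_ratio Ai s0 xA xB) => /le_trans; apply; rewrite natrD.
apply: bipartite_ratio_le => //.
  by rewrite -natrD -[16]/(16%:R) ler_nat.
have [ba|ab] := leqP #|B| #|A|; last first.
  by apply: le_trans (sqr_ge0 _); rewrite subr_le0 ler_nat ltnW.
by rewrite -natrB // -natrX ler_nat; move: (#|A| - #|B|)%N => [|m] //; rewrite leq_pmull.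
Qed.

End Bipartite.

Section BipartiteCubic.

Variables (R : realFieldType) (V : finType) (A B : pred V).
Hypothesis AB : forall v, ~~ (A v && B v).
Variable g : V -> V -> V -> bool.
Hypothesis gS : triple_system g.
Hypothesis gAB : forall i j k, g i j k ->
  [&& A i || B i, ~~ [&& A i, A j & A k] & ~~ [&& B i, B j & B k]].

Lemma bipartite_cubic_le (y : V -> R) : (forall i, 0 <= y i) ->
  (16 <= #|A| + #|B|)%N ->
  cubic_form g y <= (3 / 2 * (#|A| + #|B|)%:R ^+ 2 - 3 * (#|A| + #|B|)%:R
    - (#|A|%:R - #|B|%:R) ^+ 2 / 4) * \sum_(i | A i || B i) y i ^+ 3.
Proof.
move=> y0 n16.
pose r : R := (3 * #|A|%:R + #|B|%:R + 2) / (#|A|%:R + 3 * #|B|%:R + 2).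
pose r' : R := (3 * #|B|%:R + #|A|%:R + 2) / (#|B|%:R + 3 * #|A|%:R + 2).
have a0 : 0 <= #|A|%:R :> R by [].
have b0 : 0 <= #|B|%:R :> R by [].
have r_gt0 : 0 < r by rewrite divr_gt0 //; lra.
have rr' : r * r' = 1.
  by rewrite /r /r'; field; apply/andP; split; rewrite gt_eqF //; lra.
pose x i : R := if B i then r else 1.
have x0 i : 0 < x i by rewrite /x; case: ifP.
have xA j : A j -> x j = 1.
  by rewrite /x; case: ifP => // Bj Aj; have := AB j; rewrite Aj Bj.
have xB j : B j -> x j = r by rewrite /x => ->.
apply: le_trans (cubic_form_le gS x0 y0) _.
rewrite mulr_sumr [X in _ <= X]big_mkcond; apply: ler_sum => i _.
have [Ai|nA] := boolP (A i) => /=.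
  rewrite mulrC ler_wpM2r ?exprn_ge0 //.
  apply: (bipartite_ratio_le_pred AB gS x0 gAB Ai ltr01 xA _ n16 (erefl : r = _)).
  by move=> j /xB->; rewrite mul1r.
have [Bi|nB] := boolP (B i).
  rewrite mulrC ler_wpM2r ?exprn_ge0 //.
  have -> : (#|A|%:R - #|B|%:R) ^+ 2 = (#|B|%:R - #|A|%:R) ^+ 2 :> R by ring.
  rewrite (addnC #|A|).
  apply: (@bipartite_ratio_le_pred _ _ B A _ g x r r') => //.
  - by move=> v; rewrite andbC.
  - by move=> i' j k /gAB /and3P[h1 -> ->]; rewrite orbC h1.
  - by move=> j /xA ->.
  - by rewrite addnC.
rewrite /ratio big1 ?mulr0 // => j _; rewrite big1 // => k _.
have [/gAB|] := boolP (g i j k); last by rewrite mul0r.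
by rewrite (negPf nA) (negPf nB).
Qed.

End BipartiteCubic.

(** * Near-extremal systems *)

Section NearExtremal.

Variables (R : realFieldType) (V : finType) (g : V -> V -> V -> bool).
Hypotheses (gS : triple_system g) (gF : fano_hom_free g).
Variable h : R.
Hypotheses (h0 : 0 < h) (h_le : h <= 1 / 500).
Let u : V -> R := fun=> h.
Hypothesis u1 : \sum_(x : V) h = 1.
Variables (y : V -> R) (m : R).
Hypotheses (y0 : forall i, 0 <= y i) (y2 : wsum u (fun i => y i ^+ 2) = 1).
Hypothesis m_ge : 3 / 2 - 3 * h - 2 * h ^+ 2 <= m.
Hypothesis ym : forall i,
  m * y i ^+ 2 <= wsum2 u (fun j k => (g i j k)%:R * (y i ^+ 2 + y j * y k)).

Let u0 x : 0 <= u x. Proof. exact: ltW. Qed.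
Let u1' : \sum_x u x = 1 := u1.
Local Notation G i j k := ((g i j k)%:R : R).
Local Notation degu := (deg g u).

Let G01 i j k : 0 <= G i j k <= 1.
Proof. by case: (g i j k); rewrite /= ?ler01 lexx. Qed.

Let hh : h ^+ 2 <= h / 500.
Proof. by have := h0; have := h_le; nra. Qed.

Lemma deg_ge0 v : 0 <= degu v.
Proof. by apply: wsum2_ge0 => // ? ?; apply: ler0n. Qed.

(** Cauchy-Schwarz bounds the sum at i by y_i^2 + 1, and m - 1 >= 49/100. *)
Lemma entry_le i : y i <= 10 / 7.
Proof.
have h1 : wsum2 u (fun j k => G i j k * (y i ^+ 2 + y j * y k)) <= y i ^+ 2 + 1.
  apply: (@le_trans _ _ (wsum2 u (fun j k => y i ^+ 2 + y j * y k))).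
    apply: ler_wsum2 => // j k; have /andP[_ G1] := G01 i j k.
    by rewrite ler_piMl // addr_ge0 ?sqr_ge0 ?mulr_ge0.
  by rewrite wsum2D wsum2_cst // wsum2_prod -expr2 lerD2l -y2; apply: sqr_wsum_le.
rewrite -ler_sqr ?nnegrE ?divr_ge0 //; have := le_trans (ym i) h1.
have := m_ge; have := hh; have := h_le; have := h0; have := sqr_ge0 (y i).
move: (y i ^+ 2) => t t0 *.
have : 49 / 100 * t <= (m - 1) * t by rewrite ler_wpM2r //; lra.
by lra.
Qed.

Let y_range i : 0 <= y i <= 10 / 7. Proof. by rewrite y0 entry_le. Qed.

Lemma wsum3_triple_sym (F : V -> V -> V -> R) :
  wsum3 u (fun i j k => G i j k * F j i k) = wsum3 u (fun i j k => G i j k * F i j k).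
Proof.
rewrite /wsum3 /wsum2 exchange_wsum; apply: eq_wsum => i; apply: eq_wsum => j.
by apply: eq_wsum => k; rewrite (tripleC12 gS).
Qed.

Lemma wsum3_triple_sym23 (F : V -> V -> V -> R) :
  wsum3 u (fun i j k => G i j k * F i k j) = wsum3 u (fun i j k => G i j k * F i j k).
Proof.
apply: eq_wsum => i; rewrite -[RHS]wsum2C; apply: eq_wsum2 => j k.
by rewrite (tripleC23 gS).
Qed.

Lemma wsum3D F1 F2 : wsum3 u (fun i j k => F1 i j k + F2 i j k) =
  wsum3 u F1 + wsum3 u F2.
Proof. by rewrite /wsum3 -wsumD; apply: eq_wsum => i; rewrite wsum2D. Qed.

Lemma wsum3Z c F : wsum3 u (fun i j k => c * F i j k) = c * wsum3 u F.
Proof. by rewrite /wsum3 -wsumZ; apply: eq_wsum => i; rewrite wsum2Z. Qed.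

Lemma wsum3_triple_fst (f : V -> R) :
  wsum3 u (fun i j k => G i j k * f i) = wsum u (fun i => degu i * f i).
Proof. by apply: eq_wsum => i; rewrite wsum2Zr. Qed.

(** Has mean 1 by the normalization of y, so w is again a weight of total mass 1. *)
Let v i := (2 + y i ^+ 2) / 3.
Let w i := u i * v i.
Let T := wsum3 w (fun i j k => G i j k).

Let v_range i : 2 / 3 <= v i <= 27 / 20.
Proof.
rewrite /v; have /andP[a b] := y_range i.
by have := sqr_ge0 (y i); apply: contraTT => /nandP[]; nra.
Qed.

Let w0 i : 0 <= w i.
Proof. by rewrite mulr_ge0 //; have /andP[+ _] := v_range i; lra. Qed.

Let w_sum : \sum_i w i = 1.
Proof.
have -> : \sum_i w i = wsum u (fun i => 2 / 3 + 1 / 3 * y i ^+ 2).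
  by apply: eq_bigr => i _; rewrite /w /v; field.
by rewrite wsumD wsum_cst // wsumZ y2; field.
Qed.

Let w_sqr : \sum_i w i ^+ 2 <= 2 * h.
Proof.
have -> : 2 * h = wsum u (fun=> 2 * h) by rewrite wsum_cst.
apply: ler_sum => i _; rewrite /w /u exprMn expr2 -mulrA ler_wpM2l ?(ltW h0) //.
rewrite mulrC ler_wpM2r ?(ltW h0) //; have /andP[] := v_range i; nra.
Qed.

Let T_le : T <= 3 / 4 + 9 / 2 * h.
Proof. by have := triple_density gS gF w0; rewrite w_sum -/T; have := w_sqr; lra. Qed.

Let TE : 27 * T = wsum3 u (fun i j k => G i j k *
  ((2 + y i ^+ 2) * (2 + y j ^+ 2) * (2 + y k ^+ 2))).
Proof.
have ww f : wsum w f = wsum u (fun i => v i * f i).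
  by apply: eq_bigr => i _; rewrite /w mulrA.
have -> : T = wsum3 u (fun i j k => G i j k * (v i * v j * v k)).
  rewrite /T /wsum3 ww; apply: eq_wsum => i; rewrite /wsum2 ww -wsumZ.
  by apply: eq_wsum => j; rewrite ww -!wsumZ; apply: eq_wsum => k; ring.
by rewrite -wsum3Z; apply: eq_wsum => i; apply: eq_wsum2 => j k; rewrite /v; field.
Qed.

Let gapE : 27 * T = wsum3 u (fun i j k => G i j k * amgm_gap (y i) (y j) (y k))
  + 27 / 2 * wsum3 u (fun i j k => G i j k * (y i ^+ 2 + y j * y k)).
Proof.
pose s1 i j k : R := y i ^+ 2 + y j * y k.
have s2 : wsum3 u (fun i j k => G i j k * (s1 j i k)) = wsum3 u (fun i j k => G i j k * s1 i j k).
  exact: wsum3_triple_sym.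
have s3 : wsum3 u (fun i j k => G i j k * (s1 k j i)) = wsum3 u (fun i j k => G i j k * s1 i j k).
  rewrite -s2 -(wsum3_triple_sym23 (fun i j k => s1 j i k)).
  by apply: eq_wsum => i; apply: eq_wsum2 => j k; rewrite /s1 [y j * y i]mulrC.
have -> : 27 / 2 * wsum3 u (fun i j k => G i j k * (y i ^+ 2 + y j * y k)) =
    9 / 2 * (wsum3 u (fun i j k => G i j k * s1 i j k)
    + wsum3 u (fun i j k => G i j k * s1 j i k)
    + wsum3 u (fun i j k => G i j k * s1 k j i)).
  by rewrite s2 s3 -/s1; field.
rewrite -!wsum3D -wsum3Z -wsum3D TE; apply: eq_wsum => i; apply: eq_wsum2 => j k.
by rewrite /amgm_gap /s1; field.
Qed.

Let form_ge : m <= wsum3 u (fun i j k => G i j k * (y i ^+ 2 + y j * y k)).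
Proof. by rewrite -[X in X <= _]mulr1 -{1}y2 -wsumZ; apply: (ler_wsum u0 ym). Qed.

Let gap_ge : 3 / 40 * wsum u (fun i => degu i * (y i - 1) ^+ 2) <=
  wsum3 u (fun i j k => G i j k * amgm_gap (y i) (y j) (y k)).
Proof.
pose s1 (i j k : V) : R := (y i - 1) ^+ 2.
have s2 : wsum3 u (fun i j k => G i j k * s1 j i k) = wsum3 u (fun i j k => G i j k * s1 i j k).
  exact: wsum3_triple_sym.
have s3 : wsum3 u (fun i j k => G i j k * s1 k i j) = wsum3 u (fun i j k => G i j k * s1 i j k).
  by rewrite -s2 -(wsum3_triple_sym23 (fun i j k => s1 j i k)).
have -> : 3 / 40 * wsum u (fun i => degu i * (y i - 1) ^+ 2) =
    1 / 40 * (wsum3 u (fun i j k => G i j k * s1 i j k)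
    + wsum3 u (fun i j k => G i j k * s1 j i k)
    + wsum3 u (fun i j k => G i j k * s1 k i j)).
  by rewrite s2 s3 (wsum3_triple_fst (fun i => (y i - 1) ^+ 2)); field.
rewrite -!wsum3D -wsum3Z; apply: ler_wsum3 => // i j k.
rewrite -!mulrDr mulrCA ler_wpM2l //.
by apply: le_trans (amgm_gap_ge (y_range i) (y_range j) (y_range k)); rewrite /s1; lra.
Qed.

(** T is at most 3/4 and the form at least 3/2, both up to O(h). As 27 * 3/4 = 27/2 * 3/2, only O(h)
    remains for the gap. *)
Lemma deg_variance : wsum u (fun i => degu i * (y i - 1) ^+ 2) <= 2300 * h.
Proof.
by have := gap_ge; have := gapE; have := form_ge; have := T_le; have := m_ge;
  have := hh; have := h0; lra.
Qed.

Let T_ge : 3 / 4 - 2 * h <= T.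
Proof.
have : 0 <= wsum3 u (fun i j k => G i j k * amgm_gap (y i) (y j) (y k)).
  apply: wsum_ge0 => // i; apply: wsum2_ge0 => // j k; rewrite mulr_ge0 //.
  apply: le_trans (amgm_gap_ge (y_range i) (y_range j) (y_range k)).
  by rewrite mulr_ge0 ?divr_ge0 // !addr_ge0 ?sqr_ge0.
by have := gapE; have := form_ge; have := m_ge; have := hh; have := h0; lra.
Qed.

(* Compare the density of the weight z with that of its restriction to the complement of the
   fractional vertex set f. *)
Lemma low_degree_mass (f : V -> R) (t p : R) (z : V -> R) : (forall i, 0 <= z i) ->
  \sum_i z i = 1 -> (forall i, 0 <= f i <= 1) ->
  (forall i, f i * deg g z i <= f i * t) -> p = wsum z f ->
  wsum3 z (fun i j k => G i j k) <= 3 / 4 * (1 - p) ^+ 3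
    + 9 / 4 * (\sum_i z i ^+ 2) + 3 * t * p.
Proof.
move=> z0 z1 f01 ft pE.
pose x i := z i * (1 - f i).
have x0 i : 0 <= x i by rewrite mulr_ge0 // subr_ge0; have /andP[] := f01 i.
have xz i : x i <= z i.
  by rewrite ler_piMr // gerBl; have /andP[] := f01 i.
have xp : \sum_i x i = 1 - p.
  rewrite pE -z1 -sumrB; apply: eq_bigr => i _; rewrite /x; ring.
have p0 : 0 <= p by rewrite pE; apply: wsum_ge0 => // i; have /andP[] := f01 i.
have p1 : 0 <= 1 - p by rewrite -xp; apply: sumr_ge0.
have xsq : \sum_i x i ^+ 2 <= \sum_i z i ^+ 2.
  by apply: ler_sum => i _; rewrite ler_sqr ?nnegrE.
have sq0 : 0 <= \sum_i x i ^+ 2 by apply: sumr_ge0 => i _; apply: sqr_ge0.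
have hx : wsum3 x (fun i j k => G i j k) <= 3 / 4 * (1 - p) ^+ 3
    + 9 / 4 * (\sum_i z i ^+ 2).
  apply: le_trans (triple_density gS gF x0) _; rewrite xp lerD2l -mulrA ler_wpM2l ?divr_ge0 //.
  by apply: (le_trans _ xsq); rewrite ler_piMl //; lra.
have -> : 3 * t * p = 3 * wsum z (fun i => f i * t) by rewrite wsumZr pE; ring.
apply: le_trans (lerD hx (lexx _)).
have zx F : wsum z (fun i => (1 - f i) * F i) = wsum x F.
  by apply: eq_bigr => i _; rewrite /x mulrA.
have -> : wsum3 x (fun i j k => G i j k) =
    wsum3 z (fun i j k => (1 - f i) * ((1 - f j) * ((1 - f k) * G i j k))).
  rewrite /wsum3 -zx; apply: eq_wsum => i; rewrite /wsum2 -zx -wsumZ.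
  by apply: eq_wsum => j; rewrite -zx -!wsumZ; apply: eq_wsum => k; ring.
have pw i j k : G i j k <= (1 - f i) * ((1 - f j) * ((1 - f k) * G i j k))
    + f i * G i j k + f j * G i j k + f k * G i j k.
  have /andP[a0 a1] := f01 i; have /andP[b0 b1] := f01 j; have /andP[c0 c1] := f01 k.
  case: (g i j k); rewrite /= ?mulr0 ?addr0 ?mulr1 //.
  have ab := mulr_ge0 a0 b0; have bc := mulr_ge0 b0 c0; have ac := mulr_ge0 a0 c0.
  have abc : f i * f j * f k <= f i * f j by rewrite ler_piMr.
  by lra.
have gen (F1 F2 : V -> V -> V -> R) : wsum3 z (fun i j k => F1 i j k + F2 i j k) =
    wsum3 z F1 + wsum3 z F2.
  by rewrite /wsum3 -wsumD; apply: eq_wsum => i; rewrite wsum2D.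
apply: le_trans (ler_wsum3 z0 pw) _; rewrite !gen -!addrA lerD2l.
have e1 : wsum3 z (fun i j k => f i * G i j k) = wsum z (fun i => f i * deg g z i).
  by apply: eq_wsum => i; rewrite wsum2Z.
have e2 : wsum3 z (fun i j k => f j * G i j k) = wsum3 z (fun i j k => f i * G i j k).
  rewrite /wsum3 /wsum2 exchange_wsum; apply: eq_wsum => i; apply: eq_wsum => j.
  by apply: eq_wsum => k; rewrite (tripleC12 gS).
have e3 : wsum3 z (fun i j k => f k * G i j k) = wsum3 z (fun i j k => f j * G i j k).
  apply: eq_wsum => i; rewrite -[RHS]wsum2C; apply: eq_wsum2 => j k.
  by rewrite (tripleC23 gS).
have : wsum z (fun i => f i * deg g z i) <= wsum z (fun i => f i * t).
  exact: ler_wsum.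
by rewrite e3 e2 e1; lra.
Qed.

(** Removes the degree factor of [deg_variance]. Vertices of degree below 1/16 have mass O(h): they
    account for at most 3/8 p of the density, while their removal lowers the bound by at least 3/4
    p. *)
Lemma variance : wsum u (fun i => (y i - 1) ^+ 2) <= 40 * 1000 * h.
Proof.
pose X i := degu i < 1 / 16.
pose p := wsum w (fun i => (X i)%:R).
have p0 : 0 <= p by apply: wsum_ge0 => // i; apply: ler0n.
have p1 : p <= 1.
  by rewrite -w_sum; apply: ler_sum => i _; case: (X i); rewrite ?mulr1 ?mulr0.
have X01 i : 0 <= ((X i)%:R : R) <= 1 by case: (X i); rewrite /= ?lexx ?ler01.
have Xt i : (X i)%:R * deg g w i <= (X i)%:R * (1 / 8).
  rewrite /X; case: ltrP => Xi; rewrite ?mul0r // !mul1r.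
  apply: (@le_trans _ _ (2 * degu i)); last by lra.
  have ww f : wsum w f = wsum u (fun i => v i * f i).
    by apply: eq_bigr => j _; rewrite /w mulrA.
  rewrite /deg /wsum2 -wsumZ ww; apply: ler_wsum => // j; rewrite ww -!wsumZ.
  apply: ler_wsum => // k; rewrite mulrA; apply: ler_wpM2r => //.
  by have /andP[] := v_range j; have /andP[] := v_range k; nra.
have := low_degree_mass w0 w_sum X01 Xt (erefl p); rewrite -/T => TX.
have cube : (1 - p) ^+ 3 <= 1 - p.
  by rewrite exprS ler_piMr ?subr_ge0 // exprn_ile1 ?subr_ge0 //; lra.
have p_le : p <= 18 * h by have := T_ge; have := w_sqr; lra.
have EX : wsum u (fun i => (X i)%:R) <= 27 * h.
  apply: (@le_trans _ _ (3 / 2 * p)); last by lra.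
  rewrite /p -wsumZ; apply: ler_sum => i _.
  case: (X i); rewrite ?mulr0 // !mulr1 /w -mulrA ler_peMr //.
  by have /andP[] := v_range i; lra.
have pw i : (y i - 1) ^+ 2 <= 16 * (degu i * (y i - 1) ^+ 2) + (X i)%:R.
  have s0 := sqr_ge0 (y i - 1).
  rewrite /X; case: ltrP => Xi /=; last by nra.
  have : 0 <= degu i * (y i - 1) ^+ 2 by rewrite mulr_ge0 ?deg_ge0.
  by have /andP[] := y_range i; nra.
apply: le_trans (ler_wsum u0 pw) _; rewrite wsumD wsumZ.
by have := deg_variance; have := h0; lra.
Qed.

(** [th] bounds the mean of |y - 1| and [kap] the mass of the vertices of degree below 3/4 - eps.
    They are scaled so that 3 eps kap exceeds 9/4 kap^2 + 10 th. *)
Variables eps kap th : R.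
Hypotheses (eps0 : 0 < eps) (eps1 : eps <= 1 / 2).
Hypotheses (kapE : kap = eps / 20) (thE : th = kap * eps / 5).
Hypothesis h_small : 40 * 1000 * h <= th ^+ 2.
Hypothesis h_th : h <= th.

Let kap0 : 0 < kap. Proof. by rewrite kapE; have := eps0; lra. Qed.
Let th0 : 0 < th. Proof. by rewrite thE; have := mulr_gt0 kap0 eps0; lra. Qed.
Let th_le : th <= eps / 100 / 2.
Proof. by rewrite thE kapE; have := eps0; have := eps1; nra. Qed.

Let abs_dev : wsum u (fun i => `|y i - 1|) <= th.
Proof.
rewrite -ler_sqr ?nnegrE ?(ltW th0) //; last by apply: wsum_ge0.
apply: le_trans (sqr_wsum_le u0 u1' _) _; apply: (le_trans _ h_small).
apply: le_trans variance; apply: ler_wsum => // i.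
by rewrite real_normK ?num_real.
Qed.

Let total_deg : 3 / 4 - 7 * th <= wsum3 u (fun i j k => G i j k).
Proof.
pose e i := `|y i - 1|.
have ve i : `|v i - 1| <= e i.
  have -> : v i - 1 = (y i - 1) * ((y i + 1) / 3) by rewrite /v; field.
  rewrite normrM ler_piMr // ger0_norm; have /andP[] := y_range i; lra.
have pw i j k : G i j k * (v i * v j * v k) <= G i j k + (2 * e i + 2 * e j + e k).
  have e0 l : 0 <= e l by apply: normr_ge0.
  have := ve i; have := ve j; have := ve k => /ler_normlP[_ vk] /ler_normlP[_ vj] /ler_normlP[_ vi].
  have /andP[ai bi] := v_range i; have /andP[aj bj] := v_range j.
  have /andP[ak bk] := v_range k.
  case: (g i j k); rewrite /= ?mul0r ?mul1r ?add0r; last by have := (e0 i, e0 j, e0 k) => -[[]]; lra.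
  have vj0 : 0 <= v j by apply: le_trans aj; rewrite divr_ge0.
  have vk0 : 0 <= v k by apply: le_trans ak; rewrite divr_ge0.
  have jk : v j * v k <= 2 by move: (v j) (v k) vj0 vk0 aj bj ak bk => a b *; nra.
  have hi : (v i - 1) * (v j * v k) <= e i * 2.
    apply: (@le_trans _ _ (e i * (v j * v k))). exact: (ler_wpM2r (mulr_ge0 vj0 vk0) vi).
    by rewrite ler_wpM2l.
  have hj : (v j - 1) * v k <= e j * 2.
    apply: (@le_trans _ _ (e j * v k)); first by rewrite ler_wpM2r.
    by rewrite ler_wpM2l //; move: (v k) bk => b; lra.
  move: (v i) (v j) (v k) (e i) (e j) (e k) (e0 k) hi hj vk => a b c a' b' c' *; lra.
have TE' : T = wsum3 u (fun i j k => G i j k * (v i * v j * v k)).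
  have ww f : wsum w f = wsum u (fun i => v i * f i).
    by apply: eq_bigr => i _; rewrite /w mulrA.
  rewrite /T /wsum3 ww; apply: eq_wsum => i; rewrite /wsum2 ww -wsumZ.
  by apply: eq_wsum => j; rewrite ww -!wsumZ; apply: eq_wsum => k; ring.
have : T <= wsum3 u (fun i j k => G i j k + (2 * e i + 2 * e j + e k)).
  by rewrite TE'; apply: ler_wsum3.
have e1 : wsum3 u (fun i j k => 2 * e i + 2 * e j + e k) = 5 * wsum u e.
  rewrite /wsum3; under eq_wsum => i do rewrite !wsum2D wsum2_cst // wsum2_fst // wsum2_snd // wsumZ.
  by rewrite !wsumD !wsumZ !wsum_cst //; ring.
by rewrite wsum3D e1; have := abs_dev; have := T_ge; have := h_th; rewrite /e; lra.
Qed.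

Let low i := degu i < 3 / 4 - eps.

(** Otherwise a fraction of the low vertices, of mass exactly kap, is removed. To first order the
    cubic bound drops by 9/4 kap, while these vertices account for at most (9/4 - 3 eps) kap, which
    contradicts [total_deg]. *)
Lemma few_low_degrees : wsum u (fun i => (low i)%:R) <= kap.
Proof.
rewrite leNgt; apply/negP; set xi := wsum u _ => xik.
have xi0 : 0 < xi by apply: lt_trans xik.
pose s := kap / xi.
have s01 : 0 <= s <= 1.
  by rewrite /s divr_ge0 ?(ltW kap0) ?(ltW xi0) //= ler_pdivrMr // mul1r ltW.
have sxi : s * xi = kap by rewrite /s divfK // gt_eqF.
clearbody s.
have f01 i : 0 <= s * (low i)%:R <= 1.
  by case: (low i); rewrite ?mulr1 ?mulr0 ?lexx ?ler01.
have ft i : s * (low i)%:R * degu i <= s * (low i)%:R * (3 / 4 - eps).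
  rewrite -!mulrA ler_wpM2l //; first by case/andP: s01.
  by rewrite /low; case: ltrP => li; rewrite ?mul0r // !mul1r ltW.
have sE : kap = wsum u (fun i => s * (low i)%:R).
  by rewrite wsumZ -/xi sxi.
have := low_degree_mass u0 u1' f01 ft sE.
have -> : \sum_i u i ^+ 2 = h.
  by rewrite -[RHS]mulr1 -[X in _ = _ * X]u1 mulr_sumr; apply: eq_bigr => i _; rewrite expr2.
have k3 : (1 - kap) ^+ 3 <= 1 - 3 * kap + 3 * kap ^+ 2.
  have := exprn_ge0 3 (ltW kap0); lra.
have kk : kap ^+ 2 = kap * eps / 20 by rewrite expr2 {2}kapE; ring.
have := total_deg; have := h_th; have := mulr_gt0 kap0 eps0; rewrite kk in k3.
rewrite thE; lra.
Qed.

Let norm_cst (f : V -> R) (c : R) : 0 <= c -> (forall i, `|f i| <= c * `|y i - 1|) ->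
  wsum u (fun i => `|f i|) <= c * th.
Proof.
move=> c0 fc; apply: le_trans (ler_wsum u0 fc) _; rewrite wsumZ.
exact: ler_wpM2l abs_dev.
Qed.

(* The constant 3 is the value of d (y^3 + 3 y + 2) - 3/2 y^3 at d = 3/4, y = 1, which is what a
   vertex must contribute for the extremal growth. *)
Lemma deletion_contradiction (lam xi : R) :
  h <= xi ->
  xi = wsum u (fun i => (low i)%:R) ->
  lam = 3 / 2 * (1 - xi) ^+ 2 - 3 * h * (1 - xi) ->
  wsum3 u (fun i j k => [&& g i j k, ~~ low i, ~~ low j & ~~ low k]%:R
                         * (y i ^+ 3 + y i * y j * y k))
    <= lam * wsum u (fun i => (~~ low i)%:R * y i ^+ 3) -> False.
Proof.
move=> hxi xiE lamE form_le.
have xik : xi <= kap by rewrite xiE; apply: few_low_degrees.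
pose s i j k := y i ^+ 3 + y i * y j * y k.
have y3 i : 0 <= y i ^+ 3 by rewrite exprn_ge0.
have s0 i j k : 0 <= s i j k by rewrite addr_ge0 // !mulr_ge0.
pose Y := wsum u (fun i => y i ^+ 3).
have mY : m * Y <= wsum3 u (fun i j k => G i j k * s i j k).
  rewrite /Y -wsumZ; apply: ler_wsum => // i.
  have -> : m * y i ^+ 3 = y i * (m * y i ^+ 2) by ring.
  apply: le_trans (ler_wpM2l (y0 i) (ym i)) _; rewrite -wsum2Z.
  by rewrite le_eqVlt; apply/orP; left; apply/eqP; apply: eq_wsum2 => j k; rewrite /s; ring.
have pw i j k : G i j k * s i j k <=
    [&& g i j k, ~~ low i, ~~ low j & ~~ low k]%:R * s i j k
    + G i j k * ((low i)%:R * s i j k) + G i j k * ((low j)%:R * s i j k)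
    + G i j k * ((low k)%:R * s i j k).
  have := s0 i j k; case: (g i j k) => /=; last by lra.
  by case: (low i); case: (low j); case: (low k) => /=; lra.
(* A triple meeting low vertices is charged to each of them; symmetrizing over the three positions
   gives the integrand at i. *)
have split : wsum3 u (fun i j k => G i j k * s i j k) <=
    lam * wsum u (fun i => (~~ low i)%:R * y i ^+ 3)
    + wsum u (fun i => (low i)%:R * wsum2 u (fun j k => G i j k *
        (y i ^+ 3 + y j ^+ 3 + y k ^+ 3 + 3 * (y i * y j * y k)))).
  apply: le_trans (ler_wsum3 u0 pw) _; rewrite !wsum3D -!addrA lerD //.
  pose s1 i j k := (low i)%:R * s i j k.
  pose s2 i j k := (low i)%:R * s j i k.
  pose s3 i j k := (low i)%:R * s k i j.
  have e2 : wsum3 u (fun i j k => G i j k * ((low j)%:R * s i j k)) =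
      wsum3 u (fun i j k => G i j k * s2 i j k) by apply: (wsum3_triple_sym s2).
  have e3 : wsum3 u (fun i j k => G i j k * ((low k)%:R * s i j k)) =
      wsum3 u (fun i j k => G i j k * s3 i j k).
    rewrite -(wsum3_triple_sym23 s3) -(wsum3_triple_sym (fun i j k => s3 i k j)).
    rewrite -(wsum3_triple_sym23 (fun i j k => s3 j k i)).
    by apply: eq_wsum => i; apply: eq_wsum2 => j k; rewrite /s3 /s [y i * y k * y j]mulrAC.
  rewrite e2 e3 -!wsum3D le_eqVlt; apply/orP; left; apply/eqP.
  apply: eq_wsum => i; rewrite -wsum2Z; apply: eq_wsum2 => j k.
  by rewrite /s2 /s3 /s; ring.
have dev3 : wsum u (fun i => `|y i ^+ 3 - 1|) <= 9 / 2 * th.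
  apply: norm_cst => [|i]; first lra.
  have -> : y i ^+ 3 - 1 = (y i - 1) * (y i ^+ 2 + y i + 1) by ring.
  have /andP[a b] := y_range i.
  by rewrite normrM mulrC ler_wpM2r // ger0_norm; nra.
have Y_ge : 1 - 9 / 2 * th <= Y.
  have : wsum u (fun i => 1 - `|y i ^+ 3 - 1|) <= Y.
    by apply: ler_wsum => // i; have /ler_normlP[] := lexx `|y i ^+ 3 - 1|; lra.
  by rewrite wsumB wsum_cst //; lra.
have vertex i : wsum2 u (fun j k => G i j k *
    (y i ^+ 3 + y j ^+ 3 + y k ^+ 3 + 3 * (y i * y j * y k))) <=
    degu i * (y i ^+ 3 + 3 * y i + 2) + 20 * th.
  pose E j := `|y j ^+ 3 - 1|; pose e j := `|y j - 1|.
  have /andP[yi0 yi1] := y_range i.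
  have pw' j k : G i j k * (y i ^+ 3 + y j ^+ 3 + y k ^+ 3 + 3 * (y i * y j * y k)) <=
     G i j k * (y i ^+ 3 + 3 * y i + 2) + (E j + E k + 30 / 7 * (10 / 7 * e j + e k)).
    have E0 l : 0 <= E l by apply: normr_ge0.
    have e0 l : 0 <= e l by apply: normr_ge0.
    have /andP[yk0 yk1] := y_range k.
    case: (g i j k); rewrite /= ?mul0r ?mul1r; last first.
      by have := E0 j; have := E0 k; have := e0 j; have := e0 k; lra.
    have /ler_normlP[_ h1] := lexx `|y j ^+ 3 - 1|.
    have /ler_normlP[_ h2] := lexx `|y k ^+ 3 - 1|.
    have h3 : y j * y k - 1 <= 10 / 7 * e j + e k.
      have -> : y j * y k - 1 = y k * (y j - 1) + (y k - 1) by ring.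
      rewrite lerD ?ler_norm //; apply: (@le_trans _ _ (y k * e j)).
        by rewrite ler_wpM2l // ler_norm.
      by rewrite ler_wpM2r.
    have e10 : 0 <= 10 / 7 * e j + e k by have := e0 j; have := e0 k; lra.
    have h4 : y i * (y j * y k - 1) <= 10 / 7 * (10 / 7 * e j + e k).
      apply: (@le_trans _ _ (y i * (10 / 7 * e j + e k))); first exact: (ler_wpM2l yi0 h3).
      exact: (ler_wpM2r e10 yi1).
    by rewrite /E; lra.
  apply: le_trans (ler_wsum2 u0 pw') _.
  have e1 : wsum2 u (fun j k => E j + E k + 30 / 7 * (10 / 7 * e j + e k)) =
      2 * wsum u E + 30 / 7 * (17 / 7 * wsum u e).
    rewrite !wsum2D wsum2Z !wsum2D wsum2Z !wsum2_fst // !wsum2_snd //.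
    by rewrite -[wsum u [eta E]]/(wsum u E) -[wsum u [eta e]]/(wsum u e); field.
  rewrite wsum2D wsum2Zr -/(degu i) e1 lerD2l.
  by have := abs_dev; rewrite -/e -/E in dev3 *; have := th0; lra.
have lowD i : (low i)%:R * wsum2 u (fun j k => G i j k *
    (y i ^+ 3 + y j ^+ 3 + y k ^+ 3 + 3 * (y i * y j * y k))) <=
    (low i)%:R * (3 - 2 * eps + 20 * th + 3 / 2 * y i ^+ 3).
  rewrite /low; case: ltrP => li; rewrite ?mul0r // !mul1r.
  apply: le_trans (vertex i) _.
  have q0 : 0 <= y i ^+ 3 + 3 * y i by rewrite addr_ge0 ?mulr_ge0.
  have := ler_wpM2r (_ : 0 <= y i ^+ 3 + 3 * y i + 2) (ltW li).
  rewrite addr_ge0 // => /(_ isT).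
  (* This product is y^3 - 3 y + 2, so 3/4 (y^3 + 3 y + 2) <= 3 + 3/2 y^3, with equality at y =
     1. *)
  have c0 : 0 <= (y i - 1) ^+ 2 * (y i + 2) by rewrite mulr_ge0 ?sqr_ge0 ?addr_ge0.
  have := mulr_ge0 (ltW eps0) q0.
  by move: (y i) (degu i) (eps) (th) q0 c0 => a b c d *; lra.
pose YX := wsum u (fun i => (low i)%:R * y i ^+ 3).
have YXE : wsum u (fun i => (~~ low i)%:R * y i ^+ 3) = Y - YX.
  rewrite /Y /YX -wsumB; apply: eq_wsum => i.
  by case: (low i); rewrite /= ?mul0r ?mul1r ?subr0 ?subrr.
have YX0 : 0 <= YX by apply: wsum_ge0 => // i; rewrite mulr_ge0.
have YX3 : YX <= 3 * xi.
  rewrite xiE -wsumZ; apply: ler_wsum => // i; rewrite mulrC ler_wpM2r //.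
  have /andP[a b] := y_range i.
  have : y i ^+ 3 <= (10 / 7) ^+ 3 by rewrite ler_pXn2r ?nnegrE ?divr_ge0.
  by move: (y i ^+ 3) => t *; lra.
have RX : wsum u (fun i => (low i)%:R * wsum2 u (fun j k => G i j k *
        (y i ^+ 3 + y j ^+ 3 + y k ^+ 3 + 3 * (y i * y j * y k)))) <=
    xi * (3 - 2 * eps + 20 * th) + 3 / 2 * YX.
  apply: le_trans (ler_wsum u0 lowD) _.
  rewrite xiE -wsumZr /YX -wsumZ -wsumD le_eqVlt; apply/orP; left; apply/eqP.
  by apply: eq_wsum => i; ring.
have xi0 : 0 < xi by apply: lt_le_trans hxi.
have xi1 : xi <= 1 / 40 by have := kapE; have := eps1; lra.
(* Everything is of order xi: the left side is about 3 xi and the right side about (3 - 2 eps) xi,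
   with all other errors below 2 eps xi. *)
have main : (m - lam) * Y <= xi * (3 - 2 * eps + 20 * th) + (3 / 2 - lam) * YX.
  by have := le_trans mY split; rewrite YXE; lra.
have m_lam : xi * (3 - 3 / 2 * kap - 5 * h) <= m - lam.
  have := ler_wpM2l (ltW xi0) xik; have := ler_wpM2l (ltW h0) hxi.
  by rewrite lamE; have := m_ge; lra.
have lam_ge : 3 / 2 - lam <= 3 * kap + 3 * h.
  have : 0 <= h * xi by rewrite mulr_ge0 // ltW.
  by rewrite lamE; have := sqr_ge0 xi; lra.
have kh : 3 / 2 * kap + 5 * h <= eps / 8.
  by have := kapE; have := h_th; have := th_le; have := eps0; lra.
have lhs : xi * (3 - 3 / 2 * kap - 5 * h) * (1 - 9 / 2 * th) <= (m - lam) * Y.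
  have c0 : 0 <= xi * (3 - 3 / 2 * kap - 5 * h).
    by rewrite mulr_ge0 ?(ltW xi0) //; have := eps1; lra.
  apply: ler_pM => //; have := th_le; have := eps1; lra.
have rhs : (3 / 2 - lam) * YX <= (3 * kap + 3 * h) * (3 * xi).
  apply: (@le_trans _ _ ((3 * kap + 3 * h) * YX)); first exact: ler_wpM2r.
  by rewrite ler_wpM2l // addr_ge0 ?mulr_ge0 ?(ltW kap0) ?(ltW h0).
have : xi * ((3 - 3 / 2 * kap - 5 * h) * (1 - 9 / 2 * th)) <=
    xi * (3 - 2 * eps + 20 * th + 9 * kap + 9 * h).
  by have := le_trans lhs (le_trans main (_ : _ <= xi * (3 - 2 * eps + 20 * th)
     + (3 * kap + 3 * h) * (3 * xi))); rewrite lerD2l => /(_ rhs); lra.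
rewrite ler_pM2l //.
have : 0 <= (3 / 2 * kap + 5 * h) * th.
  by rewrite mulr_ge0 ?(ltW th0) //; have := kap0; have := h0; lra.
have := kapE; have := h_th; have := th_le; have := eps0; lra.
Qed.

End NearExtremal.

(** * Restriction to the vertices of large degree *)

Section RestrictedBicolouring.

Variables (R : realFieldType) (V : finType) (g : V -> V -> V -> bool).
Hypotheses (gS : triple_system g) (gF : fano_hom_free g).
Variable h : R.
Hypothesis h0 : 0 < h.
Hypothesis u1 : \sum_(x : V) h = 1.
Variable low : pred V.
Let u : V -> R := fun=> h.
Let u0 x : 0 <= u x. Proof. exact: ltW. Qed.

Lemma sum_high : #|[pred x | ~~ low x]|%:R * h = 1 - wsum u (fun i => (low i)%:R).
Proof.
rewrite -[X in X - _]u1 -sumrB -sum1_card natr_sum mulr_suml big_mkcond.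
by apply: eq_bigr => x _; rewrite /u inE; case: (low x) => /=; ring.
Qed.

(** Deleting the low vertices costs at most 2 xi in each degree, and renormalizing the weight can
    only raise it. A and B are the colour classes of the induced system, seen in V. *)
Lemma restricted_bicolouring (d e : R) :
  (forall (W : finType) (f : W -> W -> W -> bool) (z : W -> R),
    triple_system f -> fano_hom_free f -> (forall x, 0 < z x) -> \sum_x z x = 1 ->
    (forall v, 3 / 4 - e <= deg f z v) ->
    exists C : pred W, forall x y z, f x y z -> ~~ ((C x == C y) && (C y == C z))) ->
  (forall v, ~~ low v -> d <= deg g u v) ->
  3 / 4 - e <= d - 2 * wsum u (fun i => (low i)%:R) ->
  wsum u (fun i => (low i)%:R) < 1 ->
  exists A B : pred V, [/\ forall v, ~~ (A v && B v),
    forall v, A v || B v = ~~ low v &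
    forall x y z, g x y z -> ~~ low x -> ~~ low y -> ~~ low z ->
      ~~ [&& A x, A y & A z] /\ ~~ [&& B x, B y & B z]].
Proof.
set xi := wsum u _ => mindeg hd de xi1.
pose S : pred V := [pred x | ~~ low x].
pose W := {x : V | S x}.
pose N : R := #|S|%:R.
have Nh : N * h = 1 - xi by rewrite /N sum_high.
have N0 : 0 < N.
  by rewrite -(pmulr_lgt0 _ h0) Nh subr_gt0.
have xi0 : 0 <= xi by apply: wsum_ge0 => // i; apply: ler0n.
pose f (x y z : W) := g (val x) (val y) (val z).
have fS : triple_system f.
  split=> [x y z|x y z|x z]; rewrite /f; first exact: (tripleC12 gS).
    exact: (tripleC23 gS).
  exact: (triplexx gS).
have fF : fano_hom_free f by move=> *; apply: gF.
have z1 : \sum_(x : W) N^-1 = 1.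
  by rewrite sumr_const -[#|_|]/(#|{: W}|) card_sig -mulr_natl mulfV ?gt_eqF.
have fdeg (v : W) : 3 / 4 - e <= deg f (fun=> N^-1) v.
  apply: le_trans de _.
  have hv : d <= deg g u (val v) by apply: hd; apply: (valP v).
  pose F := \sum_(x | S x) \sum_(y | S y) (g (val v) x y)%:R : R.
  have F0 : 0 <= F by apply: sumr_ge0 => x _; apply: sumr_ge0.
  have -> : deg f (fun=> N^-1) v = N^-1 ^+ 2 * F.
    rewrite /deg /wsum2 /wsum /F expr2 -mulrA !mulr_sumr (big_sub S).
    apply: eq_bigr => x _; congr (_ * _); rewrite mulr_sumr (big_sub S).
    by apply: eq_bigr.
  have hF : deg g u (val v) - 2 * xi <= h ^+ 2 * F.
    have -> : h ^+ 2 * F = wsum2 u (fun x y => (~~ low x)%:R * ((~~ low y)%:R * (g (val v) x y)%:R)).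
      have -> : F = \sum_x \sum_y (~~ low x)%:R * ((~~ low y)%:R * (g (val v) x y)%:R).
        rewrite /F big_mkcond; apply: eq_bigr => x _; rewrite {1}/S /=; case: (low x) => /=.
          by rewrite big1 // => y _; rewrite mul0r.
        rewrite big_mkcond; apply: eq_bigr => y _; rewrite /S /= mul1r.
        by case: (low y); rewrite /= ?mul0r ?mul1r.
      rewrite expr2 -mulrA 2!mulr_sumr; apply: eq_bigr => x _.
      by rewrite /wsum mulr_sumr.
    have -> : deg g u (val v) - 2 * xi = wsum2 u (fun x y =>
        (g (val v) x y)%:R - (low x)%:R - (low y)%:R).
      rewrite !wsum2B wsum2_fst // wsum2_snd // -/xi -/(deg g u (val v)); ring.
    apply: ler_wsum2 => // x y.
    by case: (low x); case: (low y); case: (g (val v) x y) => /=; lra.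
  have hN : h ^+ 2 <= N^-1 ^+ 2.
    rewrite ler_sqr ?nnegrE ?invr_ge0 ?(ltW h0) ?(ltW N0) // -[h]mul1r -(mulVf (_ : N != 0)).
      by rewrite -mulrA Nh ler_piMr ?invr_ge0 ?(ltW N0) // gerBl.
    by rewrite gt_eqF.
  by apply: le_trans (ler_wpM2r F0 hN); apply: le_trans hF; rewrite lerD2r.
have z0 (x : W) : 0 < N^-1 by rewrite invr_gt0.
have [C HC] := mindeg W f (fun=> N^-1) fS fF z0 z1 fdeg.
pose A v := [exists x : W, (val x == v) && C x].
pose B v := [exists x : W, (val x == v) && ~~ C x].
have AE x : A (val x) = C x.
  apply/existsP/idP => [[x' /andP[/eqP/val_inj->]] //|Cx]; by exists x; rewrite eqxx.
have BE x : B (val x) = ~~ C x.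
  apply/existsP/idP => [[x' /andP[/eqP/val_inj->]] //|Cx]; by exists x; rewrite eqxx.
have lift v : ~~ low v -> exists x : W, val x = v by move=> lv; exists (Sub v lv).
have ABlow v : low v -> A v = false /\ B v = false.
  move=> lv; split; apply/existsP => -[x /andP[/eqP xv _]];
    by have := valP x; rewrite /S /= xv lv.
exists A, B; split=> [v|v|x y z].
- have [/ABlow[-> //]|/lift[x <-]] := boolP (low v).
  by rewrite AE BE; case: (C x).
- have [lv|/[dup] lv /lift[x <-]] := boolP (low v); first by have [-> ->] := ABlow v lv.
  by rewrite AE BE; case: (C x).
move=> gxyz /lift[x' ex] /lift[y' ey] /lift[z' ez]; move: gxyz.
rewrite -{}ex -{}ey -{}ez !AE !BE => /(HC x' y' z').
by case: (C x'); case: (C y'); case: (C z').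
Qed.

End RestrictedBicolouring.

(** The slack 2 in the threshold covers the 3/2 that a balanced system may lose for odd order, plus
    the 1/2 by which unbalanced colourings lose more. *)
Lemma near_extremal_bicolouring (R : rcfType) : exists K : R,
  forall (V : finType) (g : V -> V -> V -> bool) (y : V -> R) (c : R),
  K <= #|V|%:R -> triple_system g -> fano_hom_free g ->
  (forall i, 0 <= y i) -> (exists i, y i != 0) -> subeigen g c y ->
  3 / 2 * #|V|%:R ^+ 2 - 3 * #|V|%:R - 2 <= c ->
  exists C : pred V, forall x y z, g x y z -> ~~ ((C x == C y) && (C y == C z)).
Proof.
have [e e0 mindeg] := min_degree_bicolouring R.
(* At most e/2, since the restriction costs a further 2 kap = eps/10 in degree. *)
pose eps := Num.min e 1 / 2; pose kap := eps / 20; pose th := kap * eps / 5.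
have eps0 : 0 < eps by rewrite divr_gt0 // lt_min e0 ltr01.
have eps1 : eps <= 1 / 2 by rewrite ler_pM2r ?invr_gt0 // ge_min lexx orbT.
have epse : eps <= e / 2 by rewrite ler_pM2r ?invr_gt0 // ge_min lexx.
have kap0 : 0 < kap by rewrite divr_gt0.
have th0 : 0 < th by rewrite divr_gt0 // mulr_gt0.
exists (500 + 40 * 1000 / th ^+ 2 + th^-1) => V g y c Kn gS gF y0 [i0 yi0] yc c_ge.
set n : R := #|V|%:R in Kn c_ge.
have c1 : 0 < 40 * 1000 / th ^+ 2 by apply: divr_gt0; [lra | exact: exprn_gt0].
have c2 : 0 < th^-1 by rewrite invr_gt0.
have n500 : 500 <= n by lra.
have n0 : 0 < n by lra.
pose h := n^-1.
have h0 : 0 < h by rewrite invr_gt0.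
have nh : n * h = 1 by rewrite mulfV // gt_eqF.
have h_le : h <= 1 / 500 by rewrite -(ler_pM2l n0) nh; lra.
have h_th : h <= th.
  by rewrite -(ler_pM2l n0) nh -ler_pdivrMr // div1r; lra.
have h_small : 40 * 1000 * h <= th ^+ 2.
  rewrite -(ler_pM2l n0) mulrCA nh mulr1 -ler_pdivrMr ?exprn_gt0 //; lra.
have u1 : \sum_(x : V) h = 1 by rewrite sumr_const -mulr_natl.
pose u : V -> R := fun=> h.
have u0 x : 0 <= u x by apply: ltW.
pose sg := Num.sqrt (wsum u (fun i => y i ^+ 2)).
have q0 : 0 < wsum u (fun i => y i ^+ 2).
  have y2 : 0 < u i0 * y i0 ^+ 2.
    by apply: mulr_gt0 => //; apply: exprn_gt0; rewrite lt_neqAle eq_sym yi0 y0.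
  rewrite /wsum (bigD1 i0) //=; apply: ltr_pwDl => //.
  by apply: sumr_ge0 => i _; apply: mulr_ge0; rewrite ?sqr_ge0.
have sg0 : 0 < sg by rewrite sqrtr_gt0.
have sg2 : sg ^+ 2 = wsum u (fun i => y i ^+ 2) by rewrite sqr_sqrtr // ltW.
pose t i := y i / sg.
have t0 i : 0 <= t i by rewrite divr_ge0 // ltW.
have t2 : wsum u (fun i => t i ^+ 2) = 1.
  have -> : wsum u (fun i => t i ^+ 2) = wsum u (fun i => y i ^+ 2 * sg^-1 ^+ 2).
    by apply: eq_wsum => i; rewrite /t exprMn.
  by rewrite wsumZr -sg2 exprVn mulfV // gt_eqF // exprn_gt0.
pose m := c * h ^+ 2.
have m_ge : 3 / 2 - 3 * h - 2 * h ^+ 2 <= m.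
  have := ler_wpM2r (sqr_ge0 h) c_ge.
  have -> : (3 / 2 * n ^+ 2 - 3 * n - 2) * h ^+ 2 =
    3 / 2 * (n * h) ^+ 2 - 3 * h * (n * h) - 2 * h ^+ 2 by ring.
  by rewrite nh expr1n !mulr1.
have tm i : m * t i ^+ 2 <= wsum2 u (fun j k => (g i j k)%:R * (t i ^+ 2 + t j * t k)).
  have -> : wsum2 u (fun j k => (g i j k)%:R * (t i ^+ 2 + t j * t k)) =
      h ^+ 2 / sg ^+ 2 * \sum_j \sum_k (g i j k)%:R * (y i ^+ 2 + y j * y k).
    rewrite /wsum2 /wsum mulr_sumr; apply: eq_bigr => j _; rewrite /u !mulr_sumr.
    apply: eq_bigr => k _; rewrite /t; field; rewrite gt_eqF //.
  have -> : m * t i ^+ 2 = h ^+ 2 / sg ^+ 2 * (c * y i ^+ 2).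
    by rewrite /m /t; field; rewrite gt_eqF.
  by apply: ler_wpM2l (yc i); rewrite divr_ge0 ?sqr_ge0.
pose low i := deg g u i < 3 / 4 - eps.
have few : wsum u (fun i => (low i)%:R) <= kap.
  exact: (@few_low_degrees _ _ g gS gF h h0 h_le u1 t m t0 t2 m_ge tm eps kap th).
set xi := wsum u _ in few.
have xi1 : xi < 1 / 2 by have := few; rewrite /kap; lra.
have [||| A [B [AB ABlow ABg]]] := @restricted_bicolouring _ _ g gS gF h h0 u1 low
    (3 / 4 - eps) e (mindeg).
- by move=> v; rewrite /low -leNgt.
- by rewrite -/u -/xi; have := few; rewrite /kap; lra.
- by rewrite -/u -/xi; lra.
have [/existsP[l ll]|nolow] := boolP [exists l, low l]; last first.
  have hi v : ~~ low v by move: nolow; rewrite negb_exists => /forallP.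
  exists A => a b d gabd; have [h1 h2] := ABg a b d gabd (hi a) (hi b) (hi d).
  have := ABlow a; have := ABlow b; have := ABlow d; rewrite !hi.
  by move: h1 h2; case: (A a); case: (A b); case: (A d) => //= _ h2 Bd Bb Ba;
    move: h2; rewrite Ba Bb Bd.
exfalso.
pose f i j k := [&& g i j k, ~~ low i, ~~ low j & ~~ low k].
have fS : triple_system f.
  split=> [a b d|a b d|a d]; rewrite /f.
  - by rewrite (tripleC12 gS a); case: (low a); case: (low b); case: (low d); rewrite ?andbF.
  - by rewrite (tripleC23 gS a); case: (low a); case: (low b); case: (low d); rewrite ?andbF.
  - by rewrite (triplexx gS).
have fAB a b d : f a b d ->
    [&& A a || B a, ~~ [&& A a, A b & A d] & ~~ [&& B a, B b & B d]].
  by move=> /and4P[gabd la lb ld]; rewrite ABlow la; have [-> ->] := ABg a b d gabd la lb ld.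
have cardAB : (#|A| + #|B|)%N = #|[pred x | ~~ low x]|.
  rewrite -cardUI [X in (_ + X)%N]eq_card0 ?addn0 => [|v]; last first.
    by rewrite !inE; apply/negbTE; apply: AB.
  by apply: eq_card => v; rewrite !inE -ABlow.
have Nh := sum_high u1 low; rewrite -/u -/xi in Nh.
have NE : #|[pred x | ~~ low x]|%:R = (1 - xi) * n.
  by rewrite -Nh -mulrA [h * n]mulrC nh mulr1.
have n16 : (16 <= #|A| + #|B|)%N.
  rewrite cardAB -(ler_nat R) NE; have := ler_wpM2r (ltW n0) (_ : 1 / 2 <= 1 - xi).
  by move=> /(_ _) hh; apply: le_trans (hh _); lra.
have cub := bipartite_cubic_le AB fS fAB t0 n16.
rewrite cardAB NE in cub.
apply: (@deletion_contradiction _ _ g gS gF h h0 h_le u1 t m t0 t2 m_ge tm eps kap th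
  eps0 eps1 _ _ h_small h_th (3 / 2 * (1 - xi) ^+ 2 - 3 * h * (1 - xi)) xi) => //.
- rewrite /xi /wsum (bigD1 l) //= ll mulr1 lerDl; apply: sumr_ge0 => i _.
  by rewrite mulr_ge0 // ltW.
have -> : wsum3 (fun=> h) (fun i j k => [&& g i j k, ~~ low i, ~~ low j & ~~ low k]%:R *
    (t i ^+ 3 + t i * t j * t k)) = h ^+ 3 * cubic_form f t.
  rewrite /wsum3 /wsum2 /wsum /cubic_form mulr_sumr; apply: eq_bigr => i _.
  rewrite !mulr_sumr; apply: eq_bigr => j _; rewrite !mulr_sumr.
  by apply: eq_bigr => k _; rewrite /f; ring.
have sumAB : wsum (fun=> h) (fun i => (~~ low i)%:R * t i ^+ 3) =
    h * \sum_(i | A i || B i) t i ^+ 3.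
  rewrite /wsum mulr_sumr [RHS]big_mkcond; apply: eq_bigr => i _ /=.
  by rewrite ABlow; case: (low i); rewrite /= ?mul0r ?mul1r ?mulr0.
rewrite sumAB; set Sig := \sum_(i | _) _ in cub *.
have Sig0 : 0 <= Sig by apply: sumr_ge0 => i _; rewrite exprn_ge0.
have h30 : 0 <= h ^+ 3 by rewrite exprn_ge0 // ltW.
apply: le_trans (ler_wpM2l h30 cub) _.
have -> : (3 / 2 * (1 - xi) ^+ 2 - 3 * h * (1 - xi)) * (h * Sig) =
    h ^+ 3 * ((3 / 2 * ((1 - xi) * n) ^+ 2 - 3 * ((1 - xi) * n)) * Sig).
  have -> : h ^+ 3 * ((3 / 2 * ((1 - xi) * n) ^+ 2 - 3 * ((1 - xi) * n)) * Sig) =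
    (3 / 2 * (1 - xi) ^+ 2 * (n * h) ^+ 2 - 3 * h * (1 - xi) * (n * h)) * (h * Sig) by ring.
  by rewrite nh expr1n !mulr1.
apply: ler_wpM2l => //; apply: ler_wpM2r => //.
by rewrite gerBl divr_ge0 ?sqr_ge0.
Qed.

(** * Hypergraphs and their eigenvalues *)

Section Hypergraph.

Variables (V : finType) (H : hypergraph V).
Hypothesis H3 : uniform 3 H.

Definition triples (i j k : V) : bool := [set i; j; k]%SET \in H.

Lemma cards3 (i j k : V) :
  (#|[set i; j; k]%SET| == 3) = [&& i != j, i != k & j != k].
Proof.
rewrite finset.setUC cardsU1 cards2 !inE negb_or ![k == _]eq_sym.
by case: (i == j); case: (i == k); case: (j == k).
Qed.

Lemma triples_neq i j k : triples i j k -> [&& i != j, i != k & j != k].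
Proof. by move=> /H3/eqP; rewrite cards3. Qed.

Lemma triples_system : triple_system triples.
Proof.
split=> [i j k|i j k|i k].
- by rewrite /triples [[set i; j]%SET]finset.setUC.
- by rewrite /triples -!finset.setUA [[set j; k]%SET]finset.setUC.
- by apply/negP => /triples_neq; rewrite eqxx.
Qed.

Lemma fano_hom_free_triples : ~ contains_subgraph fano H -> fano_hom_free triples.
Proof.
move=> nF v x1 x2 y1 y2 z1 z2; apply/negP => /and5P[g1 g2 g3 g4 /and3P[g5 g6 g7]].
apply: nF; pose t := [tuple of [:: x1; y1; z1; x2; y2; z2; v]].
exists (tnth t).
  apply/tuple_uniqP; rewrite /= !inE !negb_or.
  have [/and3P[a1 a2 a3] /and3P[b1 b2 b3]] := (triples_neq g1, triples_neq g2).
  have [/and3P[c1 c2 c3] /and3P[d1 d2 d3]] := (triples_neq g3, triples_neq g4).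
  have [/and3P[e1 e2 e3] /and3P[f1 f2 f3]] := (triples_neq g5, triples_neq g6).
  have /and3P[h1 h2 h3] := triples_neq g7.
  by do ?[apply/andP; split] => //; rewrite eq_sym.
have tE (a : nat) : (a < 7)%N -> tnth t (inord a) = nth v t a.
  by move=> a7; rewrite (tnth_nth v) inordK.
have lE (a b c : nat) : (a < 7)%N -> (b < 7)%N -> (c < 7)%N ->
    tnth t @: [set i : 'I_7 | i.+1 \in [:: a.+1; b.+1; c.+1]]%SET =
    [set nth v t a; nth v t b; nth v t c]%SET.
  move=> a7 b7 c7; have -> : [set i : 'I_7 | i.+1 \in [:: a.+1; b.+1; c.+1]]%SET =
      [set inord a; inord b; inord c]%SET.
    by apply/finset.setP => i; rewrite !inE -!val_eqE /= !inordK // orbA !eqSS.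
  by rewrite !imsetU !imset_set1 !tE.
have [gC12 gC23 _] := triples_system.
move=> e; rewrite finset.in_set /= !inE.
do ?[case/orP]; move=> /eqP ->; rewrite lE //=; rewrite -[_ \in _]/(triples _ _ _).
all: first [done | by rewrite gC12 | by rewrite gC23 | by rewrite gC12 gC23
  | by rewrite gC23 gC12 | by rewrite gC12 gC23 gC12].
Qed.

End Hypergraph.

Section Eigenvalues.

Variables (R : rcfType) (n : nat) (H : hypergraph 'I_n).
Hypothesis H3 : uniform 3 H.
Local Notation g := (triples H).
Local Notation normc := (@ComplexField.Normc.normc R).

Lemma sum_triples i : (\sum_j \sum_k g i j k)%N = (degree H i).*2.
Proof.
rewrite /degree -sum1_card -mul2n big_distrr /= muln1 pair_big /=.
rewrite (eq_bigl (fun e : {set 'I_n} => (e \in H) && (i \in e))); last first.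
  by move=> e; rewrite inE.
transitivity (\sum_(e | (e \in H) && (i \in e))
    \sum_(p : 'I_n * 'I_n) ([set i; p.1; p.2]%SET == e))%N.
  rewrite exchange_big; apply: eq_bigr => -[j k] _ /=; rewrite /triples.
  have [h|nh] := boolP (_ \in H).
    rewrite (bigD1 [set i; j; k]%SET) /=; last by rewrite h !inE eqxx.
    by rewrite eqxx big1 // => e /andP[_ /negPf]; rewrite eq_sym => ->.
  rewrite big1 // => e /andP[eH _]; case: eqP => // eE.
  by rewrite eE eH in nh.
apply: eq_bigr => e /andP[eH ie].
have /cards2P[a [b [ab eE]]] : #|(e :\ i)%SET| == 2.
  by have := H3 eH; rewrite (cardsD1 i) ie add1n => -[->].
have [ai bi] : a != i /\ b != i.
  have: a \in (e :\ i)%SET by rewrite eE !inE eqxx.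
  have: b \in (e :\ i)%SET by rewrite eE !inE eqxx orbT.
  by rewrite !inE => /andP[-> _] /andP[-> _].
have {}eE : e = [set i; a; b]%SET.
  by rewrite -(finset.setD1K ie) eE finset.setUA.
have pE (p : 'I_n * 'I_n) :
    ([set i; p.1; p.2]%SET == e) = (p == (a, b)) || (p == (b, a)).
  case: p => j k /=; apply/eqP/orP => [e'|[] /eqP[-> ->] //]; last first.
    by rewrite eE -!finset.setUA [[set b; a]%SET]finset.setUC.
  have: #|e| == 3 by rewrite (H3 eH).
  rewrite -e' cards3 => /and3P[ij ik jk].
  have: j \in e by rewrite -e' !inE eqxx orbT.
  have: k \in e by rewrite -e' !inE eqxx orbT.
  rewrite eE !inE ![_ == i]eq_sym (negPf ij) (negPf ik) /=.
  case/orP => /eqP kE /orP[] /eqP jE; rewrite jE kE ?eqxx // in jk *.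
    by right.
  by left.
rewrite (eq_bigr (fun p => (p == (a, b)) + (p == (b, a)))%N); last first.
  move=> p _; rewrite pE; case: (p =P (a, b)) => [->|//]; rewrite xpair_eqE.
  by rewrite (negPf ab).
have e1 (p0 : 'I_n * 'I_n) : (\sum_p (p == p0))%N = 1%N.
  by rewrite (bigD1 p0) //= eqxx big1 // => p /negPf->.
by rewrite big_split /= !e1.
Qed.

Lemma signless_laplacian_apply (K : numFieldType) (x : 'cV[K]_n) i :
  2 * tensor_apply (@signless_laplacian K n H) x i 0 =
  \sum_j \sum_k (g i j k)%:R * (x i 0 ^+ 2 + x j 0 * x k 0).
Proof.
have -> : tensor_apply (@signless_laplacian K n H) x i 0 =
    (degree H i)%:R * x i 0 ^+ 2
    + \sum_j \sum_k (g i j k)%:R / 2 * (x j 0 * x k 0).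
  rewrite mxE; under eq_bigr do under eq_bigr do rewrite -mulrA mulrDl.
  under eq_bigr do rewrite big_split; rewrite big_split /=; congr (_ + _).
    rewrite (bigD1 i) //= (bigD1 i) //= /degree_tensor eqxx /= expr2.
    rewrite big1 ?addr0 => [|k ki]; last by rewrite eq_sym (negPf ki) mul0r.
    rewrite big1 ?addr0 // => j ji; rewrite big1 // => k _.
    by rewrite eq_sym (negPf ji) mul0r.
  apply: eq_bigr => j _; apply: eq_bigr => k _; rewrite /adjacency_tensor /triples.
  by case: (_ \in H); rewrite ?mul1r ?mul0r.
under [RHS]eq_bigr do under eq_bigr do rewrite mulrDr.
under [RHS]eq_bigr do rewrite big_split; rewrite big_split /= mulrDr; congr (_ + _).
  under [RHS]eq_bigr do rewrite -mulr_suml -natr_sum.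
  rewrite -mulr_suml -natr_sum sum_triples -mul2n natrM; ring.
rewrite mulr_sumr; apply: eq_bigr => j _; rewrite mulr_sumr; apply: eq_bigr => k _.
by field.
Qed.

Lemma norm_normc (z : R[i]) : (normc z)%:C%C = `|z|.
Proof. by rewrite normc_def; case: z. Qed.

Lemma eigenvalue_subeigen (lambda : R[i]) :
  tensor_eigenvalue (@signless_laplacian R[i] n H) lambda ->
  exists y : 'I_n -> R, [/\ forall i, 0 <= y i, exists i, y i != 0
    & subeigen g (2 * normc lambda) y].
Proof.
move=> [x x0 xE]; exists (fun i => normc (x i 0)).
split.
- by move=> i; case: (x i 0) => a b; apply: sqrtr_ge0.
- apply/existsP; apply: contraR x0; rewrite negb_exists => /forallP h.
  apply/eqP/matrixP => i j; rewrite mxE ord1.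
  by apply: ComplexField.Normc.eq0_normc; apply/eqP; have := h i; rewrite negbK.
move=> i; have /matrixP/(_ i 0) : 2 *: tensor_apply (@signless_laplacian R[i] n H) x =
    2 *: (lambda *: (\col_i x i 0 ^+ 2)) by rewrite xE.
rewrite [LHS]mxE signless_laplacian_apply !mxE => e.
have -> : 2 * normc lambda * normc (x i 0) ^+ 2 = normc (2 * (lambda * x i 0 ^+ 2)).
  rewrite !ComplexField.Normc.normcM mulrA; congr (_ * _ * _).
  by apply: (@complexI R); rewrite norm_normc normr_nat rmorph_nat.
rewrite -e -lecR norm_normc rmorph_sum /=.
apply: le_trans (ler_norm_sum _ _ _) _; apply: ler_sum => j _.
rewrite rmorph_sum /=; apply: le_trans (ler_norm_sum _ _ _) _; apply: ler_sum => k _.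
rewrite rmorphM rmorphD rmorphXn !rmorphM rmorph_nat /= !norm_normc normrM normr_nat.
rewrite ler_wpM2l ?ler0n //; apply: le_trans (ler_normD _ _) _.
by rewrite normrX normrM.
Qed.

Lemma ratio_eigenvalue (x : 'I_n -> R) (m : R) : (0 < n)%N -> (forall i, 0 < x i) ->
  (forall i, ratio g x i = m) ->
  tensor_eigenvalue (@signless_laplacian R[i] n H) (m / 2)%:C%C.
Proof.
move=> n0 x0 xm; exists (\col_i (x i)%:C%C).
  apply/eqP => /matrixP/(_ (Ordinal n0) 0)/eqP; rewrite !mxE (inj_eq (@complexI R)).
  by rewrite gt_eqF.
apply/matrixP => i j; rewrite ord1 {j}.
apply: (@mulfI _ (2 : R[i])); first by rewrite pnatr_eq0.
rewrite signless_laplacian_apply !mxE.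
transitivity (((x i) ^+ 2 * ratio g x i)%:C%C); last first.
  rewrite xm -rmorphXn -rmorphM -(rmorph_nat (real_complex R) 2) -rmorphM.
  by congr (_%:C%C); field.
rewrite /ratio mulr_sumr rmorph_sum; apply: eq_bigr => j _.
rewrite mulr_sumr rmorph_sum; apply: eq_bigr => k _ /=.
rewrite !mxE -rmorphXn -rmorphM -rmorphD -(rmorph_nat (real_complex R)) -rmorphM.
by congr (_%:C%C); field; rewrite gt_eqF.
Qed.
End Eigenvalues.
(** * The balanced bipartite system *)

Section Balanced.

Variable R : rcfType.

(** The entries are 1 on the class of size a and r on the other, with r from the intermediate value
    theorem so that both ratios agree. The last bound compares m with the mean ratio of the all-ones
    vector; the difference carries a factor (r - 1)^2. *)
Lemma balanced_weight (a b : R) : 2 <= a -> a <= b -> exists r m : R,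
  [/\ 0 < r,
      2 * (a - 1) * b * (1 + r) + b * (b - 1) * (1 + r ^+ 2) = m,
      2 * (b - 1) * a * (1 + r^-1) + a * (a - 1) * (1 + r^-1 ^+ 2) = m
    & 6 * a * b * (a + b - 2) <= (a + b) * m].
Proof.
move=> a2 ab.
pose p : {poly R} := 'X^2 * ((2 * (a - 1) * b)%:P * (1 + 'X) + (b * (b - 1))%:P * (1 + 'X^2))
  - ((2 * (b - 1) * a)%:P * ('X^2 + 'X) + (a * (a - 1))%:P * ('X^2 + 1)).
have pE t : p.[t] = t ^+ 2 * (2 * (a - 1) * b * (1 + t) + b * (b - 1) * (1 + t ^+ 2))
    - (2 * (b - 1) * a * (t ^+ 2 + t) + a * (a - 1) * (t ^+ 2 + 1)).
  by rewrite /p !hornerE.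
have p0 : p.[0] < 0 by rewrite pE; nra.
have p1 : 0 <= p.[1].
  rewrite pE [X in 0 <= X](_ : _ = 2 * (b - a) * (a + b - 3)); last by ring.
  by rewrite mulr_ge0 //; lra.
have [r /andP[r0 _] /rootP rp] : exists2 r : R, 0 <= r <= 1 & root p r.
  by apply: poly_ivt => //; rewrite (ltW p0) p1.
have {}r0 : 0 < r.
  by rewrite lt_neqAle r0 andbT; apply/eqP => z; rewrite (_ : p.[0] = 0) ?ltxx // -[RHS]rp -z in p0.
have e : 2 * (a - 1) * b * (1 + r) + b * (b - 1) * (1 + r ^+ 2) =
    2 * (b - 1) * a * (1 + r^-1) + a * (a - 1) * (1 + r^-1 ^+ 2).
  apply: (@mulfI _ (r ^+ 2)); first by rewrite gt_eqF // exprn_gt0.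
  apply/eqP; rewrite -subr_eq0 -[X in _ == X]rp pE; apply/eqP; field.
  by rewrite gt_eqF.
exists r; eexists; split; [by []|reflexivity|by rewrite -e|].
set m := (X in _ <= _ * X).
have -> : (a + b) * m = a * m + b * m by ring.
rewrite {2}/m e /m -subr_ge0.
rewrite [X in 0 <= X](_ : _ = a * b * (r - 1) ^+ 2 *
  ((a - 1) * (2 * r + 1) / r ^+ 2 + (b - 1) * (r + 2) / r)); last first.
  by field; rewrite gt_eqF.
have a1 : 0 <= a - 1 by lra. have b1 : 0 <= b - 1 by lra.
have ag : 0 <= a by lra. have bg : 0 <= b by lra. have rg := ltW r0.
move: (a - 1) (b - 1) a1 b1 => a' b' a1 b1.
by rewrite mulr_ge0 ?(mulr_ge0 _ (sqr_ge0 _)) ?(mulr_ge0 ag) // addr_ge0 // divr_ge0 ?exprn_ge0 //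
  mulr_ge0 // addr_ge0 // mulr_ge0.
Qed.

Lemma bicompleteC (V : finType) (A B : pred V) i j k :
  bicomplete A B i j k = bicomplete B A i j k.
Proof.
rewrite /bicomplete ![B _ || _]orbC; congr (_ && _).
by rewrite andbCA.
Qed.

(** One m serves all copies of the balanced system on n vertices. The term with [odd n] reflects
    that 4 ab is n^2 or n^2 - 1. *)
Lemma balanced_ratio n : (4 <= n)%N -> exists m : R,
  3 / 2 * n%:R ^+ 2 - 3 * n%:R - 3 / 2 * (odd n)%:R <= m /\
  forall (V : finType) (C : pred V), #|V| = n -> #|C| = n./2 ->
    exists2 x : V -> R, forall i, 0 < x i &
      forall i, ratio (bicomplete C (predC C)) x i = m.
Proof.
move=> n4; pose a := n./2; pose b := (n - n./2)%N.
have abn : (a + b)%N = n by rewrite /a /b; lia.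
have ab : (a <= b)%N by rewrite /a /b; lia.
have ba : (b - a)%N = odd n by rewrite /a /b; lia.
have a2 : (2 <= a)%N by rewrite /a; lia.
have [r [m [r0 mA mB mge]]] : exists r m : R, [/\ 0 < r,
      2 * (a%:R - 1) * b%:R * (1 + r) + b%:R * (b%:R - 1) * (1 + r ^+ 2) = m,
      2 * (b%:R - 1) * a%:R * (1 + r^-1) + a%:R * (a%:R - 1) * (1 + r^-1 ^+ 2) = m
    & 6 * a%:R * b%:R * (a%:R + b%:R - 2) <= (a%:R + b%:R) * m].
  by apply: balanced_weight; rewrite ler_nat.
exists m; split.
  have n0 : 0 < n%:R :> R by rewrite ltr0n; lia.
  have nE : n%:R = a%:R + b%:R :> R by rewrite -natrD abn.
  have oE : (odd n)%:R = (b%:R - a%:R) ^+ 2 :> R.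
    by rewrite -natrB // ba -natrX; case: (odd n).
  rewrite -(ler_pM2l n0) [X in _ <= X * _]nE; apply: le_trans mge; rewrite -nE oE.
  rewrite -subr_ge0 nE [X in 0 <= X](_ : _ = 3 * (b%:R - a%:R) ^+ 2); last by field.
  by rewrite mulr_ge0 ?sqr_ge0.
move=> V C Vn Ca; have Cb : #|predC C| = b.
  by rewrite /b; move: (cardC C); rewrite Ca Vn => e; rewrite -[X in (X - _)%N]e addKn.
have D1 v : ~~ (C v && predC C v) by rewrite /= andbN.
have D2 v : ~~ (predC C v && C v) by rewrite /= andNb.
pose x i := if C i then 1 else r.
have xC i : C i -> x i = 1 by rewrite /x => ->.
have xN i : predC C i -> x i = r by rewrite /x /= => /negPf ->.
exists x => i; first by rewrite /x; case: ifP.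
have [Ci|Ci] := boolP (C i).
  rewrite (@bicomplete_ratio _ _ _ _ D1 x 1 r) // ?Ca ?Cb //.
  by move=> j /xN ->; rewrite mul1r.
transitivity (ratio (bicomplete (predC C) C) x i).
  by do 2 (apply: eq_bigr => ? _); rewrite bicompleteC.
rewrite (@bicomplete_ratio _ _ _ _ D2 x r r^-1) // ?Ca ?Cb //.
by move=> j /xC ->; rewrite mulfV // gt_eqF.
Qed.

End Balanced.

(** * Strict decrease when a triple is missing *)

Section Strict.

Variables (R : realFieldType) (V : finType).

Lemma ltr_sum2 (F G : V -> V -> R) u k : (forall i j, F i j <= G i j) -> F u k < G u k ->
  \sum_i \sum_j F i j < \sum_i \sum_j G i j.
Proof.
move=> FG Fu; rewrite (bigD1 u) //= [X in _ < X](bigD1 u) //= ltr_leD //.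
  rewrite (bigD1 k) //= [X in _ < X](bigD1 k) //= ltr_leD //.
  by apply: ler_sum => *.
by apply: ler_sum => *; apply: ler_sum => *.
Qed.

(* Shrinking the entry of x at u lowers every other ratio strictly, and if the shrinking is
   slight then the ratio at u stays below m, since a triple at u is missing in g. *)
Lemma missing_triple_lt (g h : V -> V -> V -> bool) (x : V -> R) m u v w :
  triple_system g -> (forall i j k, g i j k -> h i j k) -> (forall i, 0 < x i) ->
  (forall i, ratio h x i = m) -> h u v w -> ~~ g u v w ->
  (forall i, i != u -> exists k, h i u k) ->
  exists2 c0 : R, 0 <= c0 < m & forall (y : V -> R) c, (forall i, 0 <= y i) ->
    (exists i, y i != 0) -> subeigen g c y -> c <= c0.
Proof.
move=> gS gh x0 xm huvw nguvw hu.
have term0 (z : V -> R) (z0 : forall i, 0 < z i) i j k : 0 < 1 + z j * z k / z i ^+ 2.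
  by rewrite addr_gt0 // divr_gt0 ?mulr_gt0 ?exprn_gt0.
have ratio0 (z : V -> R) i : (forall i, 0 < z i) -> 0 <= ratio g z i.
  by move=> z0; do 2 (apply: sumr_ge0 => ? _); rewrite mulr_ge0 // (ltW (term0 z z0 _ _ _)).
have gh' i j k : (g i j k)%:R <= (h i j k)%:R :> R.
  by rewrite ler_nat; case: (boolP (g _ _ _)) => // /gh ->.
have rho_lt : ratio g x u < m.
  rewrite -(xm u); apply: (@ltr_sum2 _ _ v w) => [j k|].
    by rewrite ler_wpM2r // (ltW (term0 x x0 _ _ _)).
  by rewrite huvw (negPf nguvw) mul0r mul1r (term0 x x0).
have m0 : 0 < m by apply: le_lt_trans rho_lt; apply: ratio0.
pose q := ratio g x u / m.
have q0 : 0 <= q by rewrite divr_ge0 ?ratio0 // ltW.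
have q1 : q < 1 by rewrite ltr_pdivrMr ?mul1r.
(* Shrinking x u by t raises the ratio at u at most by the factor 1 / t^2, and t^2 - q = ((1 - q) /
   2)^2 > 0. *)
pose t := (1 + q) / 2.
have t0 : 0 < t by rewrite /t; lra.
have t1 : t < 1 by rewrite /t; lra.
have qt : q < t ^+ 2.
  by rewrite -subr_gt0 [X in 0 < X](_ : _ = ((1 - q) / 2) ^+ 2) ?exprn_gt0 /t; [|lra|field].
pose x' i := if i == u then t * x i else x i.
have x'0 i : 0 < x' i by rewrite /x'; case: ifP => _ //; rewrite mulr_gt0.
have x'x i : x' i <= x i.
  by rewrite /x'; case: ifP => _ //; rewrite ler_piMl // ltW.
have xx' i : x' i * x' i <= x i * x i by rewrite ler_pM ?(ltW (x'0 _)).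
have lt i : ratio g x' i < m.
  have [->|iu] := eqVneq i u.
    apply: (@le_lt_trans _ _ (ratio g x u / t ^+ 2)); last first.
      by rewrite ltr_pdivrMr ?exprn_gt0 // mulrC -ltr_pdivrMr.
    rewrite /ratio mulr_suml; apply: ler_sum => j _; rewrite mulr_suml.
    apply: ler_sum => k _; rewrite -[X in _ <= X]mulrA ler_wpM2l // mulrDl mul1r lerD //.
      by rewrite invf_ge1 ?exprn_gt0 // expr_le1 // ltW.
    have -> : x j * x k / x u ^+ 2 / t ^+ 2 = x j * x k / (t * x u) ^+ 2.
      by field; rewrite !gt_eqF.
    have -> : x' u = t * x u by rewrite /x' eqxx.
    by rewrite ler_wpM2r ?invr_ge0 ?sqr_ge0 // ler_pM ?(ltW (x'0 _)).
  have [k hk] := hu i iu.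
  rewrite -(xm i); have x'i : x' i = x i by rewrite /x' (negPf iu).
  have xi0 : 0 < (x i ^+ 2)^-1 by rewrite invr_gt0 exprn_gt0.
  apply: le_lt_trans (ratio_subset i (fun j => ltW (x'0 j)) gh) _.
  apply: (@ltr_sum2 _ _ u k) => [j l|]; rewrite x'i.
    rewrite ler_wpM2l // lerD2l ler_wpM2r ?(ltW xi0) //.
    by rewrite ler_pM ?(ltW (x'0 _)).
  rewrite hk !mul1r ltrD2l ltr_pM2r //.
  apply: (@lt_le_trans _ _ (x u * x' k)).
    by rewrite ltr_pM2r // /x' eqxx gtr_pMl.
  by rewrite ler_wpM2l // ltW.
(* The largest ratio is one bound below m for all eigenvalues, so the inequality stays strict for
   their supremum. *)
pose i0 := [arg max_(i > u) ratio g x' i]%O.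
have imax i : ratio g x' i <= ratio g x' i0.
  by rewrite /i0; case: arg_maxP => // j _; apply.
exists (ratio g x' i0); first by rewrite ratio0 // lt.
by move=> y c y0 yn0 yc; apply: (subeigen_ratio_le gS x'0 y0 yn0 yc imax).
Qed.

End Strict.

Definition bicolouring (V : finType) (g : V -> V -> V -> bool) (C : pred V) : bool :=
  [forall x, forall y, forall z, g x y z ==> ~~ ((C x == C y) && (C y == C z))].

Lemma bicolouringP (V : finType) (g : V -> V -> V -> bool) (C : pred V) :
  reflect (forall x y z, g x y z -> ~~ ((C x == C y) && (C y == C z))) (bicolouring g C).
Proof.
by apply: (iffP 'forall_'forall_'forall_implyP).
Qed.

Lemma bicolouring_split (V : finType) (g : V -> V -> V -> bool) (C : pred V) :
  bicolouring g C -> forall i j k, g i j k ->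
  [&& C i || predC C i, ~~ [&& C i, C j & C k] & ~~ [&& predC C i, predC C j & predC C k]].
Proof.
by move=> /bicolouringP Cg i j k /Cg /=; case: (C i); case: (C j); case: (C k).
Qed.

(** Meets the last hypothesis of [missing_triple_lt]: any third vertex works if i and u differ in
    colour, otherwise one of the other colour. *)
Lemma bicomplete_neighbour (V : finType) (C : pred V) u i :
  (0 < #|C|)%N -> (0 < #|predC C|)%N -> (2 < #|V|)%N -> i != u ->
  exists k, bicomplete C (predC C) i u k.
Proof.
move=> /card_gt0P[p Cp] /card_gt0P[q Cq] V2 iu.
have /card_gt0P[k] : (0 < #|~: [set i; u]%SET|)%N.
  by have := cardsC [set i; u]%SET; rewrite cards2; lia.
rewrite !inE negb_or -!topredE /= in Cp Cq * => /andP[ki ku].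
have neq z : C u != C z -> u != z by apply: contraNneq => ->.
case: (eqVneq (C i) (C u)) => [iuE|iuN]; last first.
  exists k; rewrite /bicomplete !orbN /= iu ![_ == k]eq_sym ki ku /= andbT.
  by move: iuN; case: (C i); case: (C u).
pose z := if C u then q else p.
have uz : C u != C z by rewrite /z; case: (boolP (C u)) => _; rewrite ?Cp ?(negPf Cq).
exists z; rewrite /bicomplete !orbN /= iu (neq z uz) /= iuE.
rewrite (_ : i != z) ?andbT; last by apply: contraNneq uz => <-; rewrite iuE.
by move: uz; case: (C u); case: (C z).
Qed.

(** * Comparison with the balanced system *)

Section Extremal.

Variable R : rcfType.

Lemma bicolouring_subeigen_le (V : finType) (g : V -> V -> V -> bool) (C : pred V)
    (y : V -> R) c : triple_system g -> bicolouring g C -> (16 <= #|V|)%N ->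
  (forall i, 0 <= y i) -> (exists i, y i != 0) -> subeigen g c y ->
  c <= 3 / 2 * #|V|%:R ^+ 2 - 3 * #|V|%:R - (#|C|%:R - #|predC C|%:R) ^+ 2 / 4.
Proof.
move=> gS /bicolouring_split gC n16 y0 [i0 yi0] yc.
have CC v : ~~ (C v && predC C v) by rewrite /= andbN.
have Y0 : 0 < \sum_i y i ^+ 3.
  rewrite (bigD1 i0) //= ltr_pwDl ?sumr_ge0 // => [|i _]; last by rewrite exprn_ge0.
  by rewrite exprn_gt0 // lt_neqAle eq_sym yi0 y0.
rewrite -(ler_pM2r Y0); apply: le_trans (subeigen_cubic y0 yc) _.
have := bipartite_cubic_le CC gS gC y0; rewrite cardC => /(_ n16).
rewrite (eq_bigl xpredT) // => i; exact: orbN.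
Qed.

(** The sizes differ by at least 2 for even and 3 for odd a + b, and 2^2/4 >= 1/2, 3^2/4 >= 2. *)
Lemma unbalanced_gap a b : a != (a + b)./2 -> b != (a + b)./2 ->
  3 / 2 * (odd (a + b))%:R + 1 / 2 <= (a%:R - b%:R) ^+ 2 / 4 :> R.
Proof.
have [ab|ba] := leqP a b.
  have -> : (a%:R - b%:R) ^+ 2 = (b - a)%N%:R ^+ 2 :> R by rewrite natrB //; ring.
  move=> an bn; have : (2 + odd (a + b) <= b - a)%N by lia.
  rewrite -(ler_nat R) natrD; case: (odd _) => /=; nra.
have -> : (a%:R - b%:R) ^+ 2 = (a - b)%N%:R ^+ 2 :> R by rewrite natrB // ltnW.
move=> an bn; have : (2 + odd (a + b) <= a - b)%N by lia.
rewrite -(ler_nat R) natrD; case: (odd _) => /=; nra.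
Qed.

Lemma bicomplete_or_smaller : exists K : R,
  forall (V : finType) (g : V -> V -> V -> bool) (m : R),
  K <= #|V|%:R -> triple_system g -> fano_hom_free g ->
  3 / 2 * #|V|%:R ^+ 2 - 3 * #|V|%:R - 3 / 2 * (odd #|V|)%:R <= m ->
  (forall C : pred V, #|C| = #|V|./2 -> exists2 x : V -> R, forall i, 0 < x i &
      forall i, ratio (bicomplete C (predC C)) x i = m) ->
  (exists2 C : pred V, #|C| = #|V|./2 &
     forall i j k, g i j k = bicomplete C (predC C) i j k) \/
  (exists2 c0 : R, 0 <= c0 < m & forall (y : V -> R) c, (forall i, 0 <= y i) ->
    (exists i, y i != 0) -> subeigen g c y -> c <= c0).
Proof.
have [K Kg] := near_extremal_bicolouring R.
exists (Num.max K 16) => V g m; rewrite ge_max => /andP[Kn n16'] gS gF mge bal.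
have n16 : (16 <= #|V|)%N by rewrite -(ler_nat R).
have cC (C : pred V) : (#|C| + #|predC C|)%N = #|V| by apply: cardC.
have [/existsP[/= S /andP[/eqP Sn Sg]]|nobal] :=
    boolP [exists S : {set V}, (#|S| == #|V|./2) && bicolouring g (fun x => x \in S)].
  pose C : pred V := fun x => x \in S.
  have Cn : #|C| = #|V|./2 by rewrite -Sn.
  have Cn' : #|predC C| = (#|V| - #|V|./2)%N by have := cC C; lia.
  have gK := sub_bicomplete gS (bicolouring_split Sg).
  have [/'forall_'forall_'forall_eqP e|] :=
      boolP [forall i, forall j, forall k, g i j k == bicomplete C (predC C) i j k].
    by left; exists C.
  rewrite negb_forall => /existsP[u]; rewrite negb_forall => /existsP[v].
  rewrite negb_forall => /existsP[w guvw]; right.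
  have [x x0 xm] := bal C Cn.
  have [huvw nguvw] : bicomplete C (predC C) u v w /\ ~~ g u v w.
    move: guvw (gK u v w); rewrite -/C.
    by case: (g u v w); case: (bicomplete _ _ _ _ _) => // _ /(_ isT).
  apply: (missing_triple_lt gS gK x0 xm huvw nguvw) => i iu.
  by apply: bicomplete_neighbour => //; rewrite ?Cn ?Cn'; lia.
right; exists (m - 1 / 2).
  have : 16 <= #|V|%:R :> R by [].
  move: #|V|%:R mge => N; case: (odd _) => /=; nra.
move=> y c y0 yn0 yc.
have [c_lt|c_ge] := ltP c (3 / 2 * #|V|%:R ^+ 2 - 3 * #|V|%:R - 2).
  by move: c_lt mge; case: (odd _) => /=; lra.
have [C /bicolouringP Cg] := Kg V g y c Kn gS gF y0 yn0 yc c_ge.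
have nb (D : pred V) : bicolouring g D -> #|D| != #|V|./2.
  move=> /bicolouringP Dg; apply: contraNneq nobal => Dn; apply/existsP.
  exists [set x | D x]%SET; rewrite cardsE Dn eqxx /=.
  by apply/bicolouringP => i j k /Dg; rewrite !inE.
have Cg' : bicolouring g (predC C).
  by apply/bicolouringP => i j k /(bicolouringP _ _ Cg) /=; case: (C i); case: (C j); case: (C k).
have := bicolouring_subeigen_le gS Cg n16 y0 yn0 yc.
have := @unbalanced_gap #|C| #|predC C|; rewrite cC => /(_ (nb _ Cg) (nb _ Cg')).
by move: mge; lra.
Qed.

End Extremal.

(** * Recognizing the balanced system up to isomorphism *)

Section BalancedBicomplete.

Variable n : nat.
Local Notation L := (fun i : 'I_n => (i < n./2)%N).

Lemma card_lower_half : #|L| = n./2.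
Proof.
rewrite -sum1_card -(big_ord_widen n (fun=> 1%N)); last by lia.
by rewrite sum1_card card_ord.
Qed.

Lemma cards3P (V : finType) (e : {set V}) :
  #|e| = 3 -> exists i j k, e = [set i; j; k]%SET.
Proof.
move=> e3; have /card_gt0P[i ie] : (0 < #|e|)%N by rewrite e3.
have /cards2P[a [b [ab eE]]] : #|(e :\ i)%SET| == 2.
  by move: e3; rewrite (cardsD1 i) ie add1n => -[->].
by exists i, a, b; rewrite -(finset.setD1K ie) eE finset.setUA.
Qed.

Lemma uniform_balanced_bicomplete : uniform 3 (balanced_bicomplete n).
Proof. by move=> e; rewrite inE => /and3P[/eqP]. Qed.

Lemma triples_balanced_bicomplete i j k :
  triples (balanced_bicomplete n) i j k = bicomplete L (predC L) i j k.
Proof.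
rewrite /triples /bicomplete inE cards3 !orbN /=.
have e (P : {set 'I_n}) : ([set i; j; k]%SET :&: P != finset.set0) = [|| i \in P, j \in P | k \in P].
  apply/finset.set0Pn/or3P => [[z]|].
    by rewrite !inE => /andP[/orP[/orP[]|] /eqP-> ->]; constructor.
  by case=> zP; [exists i|exists j|exists k]; rewrite !inE eqxx ?orbT.
rewrite !e !inE andbC; case: (L i); case: (L j); case: (L k) => //=.
all: by rewrite ?andbT ?andbF.
Qed.

Lemma iso_balanced_bicomplete (H : hypergraph 'I_n) : uniform 3 H ->
  hypergraph_iso H (balanced_bicomplete n) <->
  exists2 C : pred 'I_n, #|C| = n./2 &
    forall i j k, triples H i j k = bicomplete C (predC C) i j k.
Proof.
move=> H3.
have pull (f : 'I_n -> 'I_n) (C : pred 'I_n) i j k : injective f -> (forall i, C i = L (f i)) ->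
    (f @: [set i; j; k]%SET \in balanced_bicomplete n) = bicomplete C (predC C) i j k.
  move=> finj CE; rewrite !imsetU !imset_set1 -[LHS]/(triples _ _ _ _).
  rewrite triples_balanced_bicomplete /bicomplete /= !(inj_eq finj).
  by rewrite !CE.
split=> [[f fbij fH]|[C Cn CH]].
  have finj := bij_inj fbij.
  exists (fun i => L (f i)).
    rewrite -[LHS]/#|[preim f of L]| card_preim // -[RHS]card_lower_half.
    by apply: eq_card => i; rewrite inE (injF_onto finj).
  by move=> i j k; rewrite /triples -fH; apply: pull.
(* As C is listed first, the index of a vertex is below n./2 exactly on C. *)
pose s := enum C ++ enum (predC C).
have sx x : x \in s by rewrite mem_cat !mem_enum -!topredE /= orbN.
have sn : size s = n by rewrite size_cat -!cardE cardC card_ord.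
have lt x : (index x s < n)%N by rewrite -[X in (_ < X)%N]sn index_mem.
pose f x := Ordinal (lt x).
have finj : injective f.
  by move=> x y /(congr1 val) /= e; rewrite -(nth_index x (sx x)) e nth_index.
exists f; first exact: injF_bij.
move=> e; have [e3|e3] := eqVneq #|e| 3; last first.
  transitivity false; last by apply/esym; apply: contraNF e3 => /H3 ->.
  by apply: contraNF e3 => /uniform_balanced_bicomplete; rewrite card_imset // => ->.
have [i [j [k ->]]] := cards3P e3; rewrite -[RHS]/(triples _ _ _ _) CH; apply: pull => // x.
rewrite /f /= index_cat mem_enum -topredE /= -Cn cardE.
case: (boolP (C x)) => Cx; last by rewrite ltnNge leq_addr.
by rewrite index_mem mem_enum.
Qed.

End BalancedBicomplete.

(** * The spectral radius as a supremum *)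

Section SpectralRadius.

Variables (R : realType) (n : nat) (H : hypergraph 'I_n).
Hypothesis H3 : uniform 3 H.

Lemma spectral_radius_le c : 0 <= c -> (forall (y : 'I_n -> R) d, (forall i, 0 <= y i) ->
    (exists i, y i != 0) -> subeigen (triples H) d y -> d <= c) ->
  signless_spectral_radius R H <= c / 2.
Proof.
move=> c0 cH; rewrite /signless_spectral_radius; set E := (X in sup X).
(* The supremum of the empty set is 0 by convention. *)
have [->|E0] := eqVneq E classical_sets.set0; first by rewrite sup0 divr_ge0.
apply: ge_sup; first by apply/set0P.
move=> r [lambda /(eigenvalue_subeigen H3)[y [y0 yn0 ys]] ->].
by have := cH _ _ y0 yn0 ys; lra.
Qed.

Lemma spectral_radius_ratio (x : 'I_n -> R) m : (0 < n)%N -> (forall i, 0 < x i) ->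
  (forall i, ratio (triples H) x i = m) -> signless_spectral_radius R H = m / 2.
Proof.
move=> n0 x0 xm.
have m0 : 0 <= m.
  rewrite -(xm (Ordinal n0)); do 2 (apply: sumr_ge0 => ? _).
  by rewrite mulr_ge0 // addr_ge0 // divr_ge0 ?sqr_ge0 // mulr_ge0 // ltW.
have H_le (y : 'I_n -> R) d : (forall i, 0 <= y i) -> (exists i, y i != 0) ->
    subeigen (triples H) d y -> d <= m.
  move=> y0 yn0 ys; apply: (subeigen_ratio_le (triples_system H3) x0 y0 yn0 ys) => i.
  by rewrite xm.
apply/eqP; rewrite eq_le spectral_radius_le //=; apply: ub_le_sup.
  exists (m / 2) => r [lambda /(eigenvalue_subeigen H3)[y [y0 yn0 ys]] ->].
  by have := H_le _ _ y0 yn0 ys; lra.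
exists (m / 2)%:C%C; first exact: ratio_eigenvalue n0 x0 xm.
by apply: (@complexI R); rewrite norm_normc ger0_norm // lecR divr_ge0.
Qed.

End SpectralRadius.

Theorem theorem2p2 (R : realType) :
  exists n0 : nat, forall n : nat, (n0 <= n)%N ->
    forall G : hypergraph 'I_n,
      uniform 3 G -> ~ contains_subgraph fano G ->
      signless_spectral_radius R G
        <= signless_spectral_radius R (balanced_bicomplete n) /\
      (signless_spectral_radius R G
         = signless_spectral_radius R (balanced_bicomplete n) <->
       hypergraph_iso G (balanced_bicomplete n)).
Proof.
have [K Kg] := bicomplete_or_smaller R.
(* With n >= 4 both halves have at least two vertices; the archimedean bound turns K into a natural
   number. *)
exists (maxn 4 (Num.bound `|K|)) => n; rewrite geq_max => /andP[n4 nK] G G3 nF.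
have n0 : (0 < n)%N by lia.
have Kn : K <= #|'I_n|%:R.
  rewrite card_ord; apply: le_trans (ler_norm K) _; apply: ltW.
  by apply: lt_le_trans (archi_boundP (normr_ge0 K)) _; rewrite ler_nat.
have [m [mge bal]] := balanced_ratio R n4.
have q_bal (H : hypergraph 'I_n) : uniform 3 H -> hypergraph_iso H (balanced_bicomplete n) ->
    signless_spectral_radius R H = m / 2.
  move=> H3 /(iso_balanced_bicomplete H3)[C Cn CH].
  have [x x0 xm] := bal _ C (card_ord n) Cn.
  apply: (spectral_radius_ratio H3 n0 x0) => i; rewrite -(xm i).
  by do 2 (apply: eq_bigr => ? _); rewrite CH.
have B3 := @uniform_balanced_bicomplete n.
have qB : signless_spectral_radius R (balanced_bicomplete n) = m / 2.
  by apply: q_bal => //; exists id => [|e]; [exists id | rewrite imset_id].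
have := Kg _ _ m Kn (triples_system G3) (fano_hom_free_triples G3 nF).
rewrite card_ord => /(_ mge (fun C => bal _ C (card_ord n))).
case=> [[C Cn CG]|[c0 /andP[c0_ge c0_lt] Gc0]].
  have iso : hypergraph_iso G (balanced_bicomplete n).
    by apply/(iso_balanced_bicomplete G3); exists C.
  by rewrite qB (q_bal _ G3 iso).
have Gm : signless_spectral_radius R G < m / 2.
  by apply: le_lt_trans (spectral_radius_le G3 c0_ge Gc0) _; lra.
split; first by rewrite qB ltW.
split=> [|/(q_bal _ G3)] e; last by rewrite qB.
by move: Gm; rewrite e qB ltxx.
Qed.
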